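(* For every $g\in\mathrm{BMOA}$ the integral operator $V_g$ on $H^2$ is uniformly asymptotically Hankel with asymptotic symbol $0$, and for every $g\in H^\infty$ the integral operator $S_g$ on $H^2$ is uniformly asymptotically Hankel with asymptotic symbol $0$.
   Context: $\mathbb{D}$ is the open unit disk, $H^2$ is the Hardy space of $\mathbb{D}$ with orthonormal basis $e_i(z)=z^i$, $i\ge 0$, and $H^\infty$ is the algebra of bounded holomorphic functions on $\mathbb{D}$. $\mathrm{BMOA}$ is the space of functions in $H^2$ whose boundary values have bounded mean oscillation on the unit circle. For $g$ holomorphic in $\mathbb{D}$, $V_gf(z)=\int_0^z f(u)g'(u)\,du$ and $S_gf(z)=\int_0^z f'(u)g(u)\,du$. $V_g$ is bounded on $H^2$ iff $g\in\mathrm{BMOA}$; $S_g$ is bounded on $H^2$ iff $g\in H^\infty$. The shift $S$ on $H^2$ is $Sf(z)=zf(z)$ (not to be confused with $S_g$). For $n\ge 0$, $J_n$ is the bounded operator on $H^2$ with $J_ne_i=e_{n-i}$ for $0\le i\le n$ and $J_ne_i=0$ for $i>n$. For a bounded operator $T$ on $H^2$ put $H_n(T)=J_nTS^{n+1}$. $T$ is uniformly asymptotically Hankel if $\{H_n(T)\}_n$ converges in the operator norm; the limit is then a Hankel operator, and a symbol of that Hankel operator is called the asymptotic (Hankel) symbol of $T$. Asymptotic symbol $0$ means that the limit is the zero operator. *)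

(* Defs.v *)
From HB Require Import structures.
From mathcomp Require Import all_boot all_order all_algebra.
From mathcomp Require Import complex.
From mathcomp Require Import all_classical all_reals all_analysis.

Set Implicit Arguments.
Unset Strict Implicit.
Unset Printing Implicit Defensive.

Import Order.TTheory GRing.Theory Num.Theory.
Import numFieldNormedType.Exports.

Local Open Scope classical_set_scope.
Local Open Scope ring_scope.
Local Open Scope complex_scope.

(** A function on the unit disk is represented by a function [C -> C], of which
    only the values on the disk matter; in particular two such functions are
    the same element of H^2 when they agree on the disk. *)

(* The type R[i] itself carries its module structure over R; seen through the
   structure of numClosedFieldType, it is a normed module over itself, so that
   limits and derivatives are the complex ones. *)
Definition cplx (R : realType) : numClosedFieldType := R[i].

Section Disk.
Context {R : realType}.
Local Notation C := (cplx R).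
Local Notation mu := (@lebesgue_measure R).
Implicit Types (f g h : C -> C) (z : C).

Definition of_real (r : R) : C := r%:C.

Definition modulus z : R := Normc.normc z.

Definition unit_disk : set C := [set z | `|z| < 1].

Definition holomorphic_on_disk f := forall z, unit_disk z -> derivable f z 1.

(* Lebesgue integral of a complex-valued function of a real variable *)
Definition cintegral (D : set R) (b : R -> C) : C :=
  (\int[mu]_(t in D) complex.Re (b t))%R +i* (\int[mu]_(t in D) complex.Im (b t))%R.

Definition cintegrable (D : set R) (b : R -> C) : Prop :=
  mu.-integrable D (fun t => (complex.Re (b t))%:E) /\
  mu.-integrable D (fun t => (complex.Im (b t))%:E).

(* integral of h along the segment from 0 to z *)
Definition primitive0 h z : C :=
  z * cintegral `[0, 1] (fun t => h (of_real t * z)).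

Definition integral_V g : (C -> C) -> (C -> C) :=
  fun f => primitive0 (fun u => f u * derive1 g u).

Definition integral_S g : (C -> C) -> (C -> C) :=
  fun f => primitive0 (fun u => derive1 f u * g u).

Definition taylor_coef f (k : nat) : C := derive1n k f 0 / (k`!)%:R.

(* The norm for which the monomials z^k form an orthonormal basis; it is +oo
   exactly when the Taylor coefficients are not square summable. *)
Definition hardy_norm f : \bar R :=
  sqrte (\sum_(0 <= k <oo) ((modulus (taylor_coef f k)) ^+ 2)%:E)%E.

Definition hardy2 : set (C -> C) :=
  [set f | holomorphic_on_disk f /\ (hardy_norm f < +oo)%E].

Definition hardy_infty : set (C -> C) :=
  [set f | holomorphic_on_disk f /\
    exists M : R, forall z, unit_disk z -> modulus (f z) <= M].

(* point of angle t on the unit circle *)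
Definition circle (t : R) : C := cos t +i* sin t.

(* b is the radial boundary function of f, in the angular variable *)
Definition boundary_values f (b : R -> C) : Prop :=
  {ae mu, forall t : R, f (of_real r * circle t) @[r --> (1 : R)^'-] --> b t}.

Definition arc_mean (b : R -> C) (s t : R) : C :=
  of_real (t - s)^-1 * cintegral `[s, t] b.

Definition mean_oscillation (b : R -> C) (s t : R) : R :=
  (t - s)^-1 * (\int[mu]_(x in `[s, t]) modulus (b x - arc_mean b s t))%R.

(* Arcs of the circle are the intervals [s, t] of length at most 2 pi, where the
   starting angle s is arbitrary, so that arcs through the angle 0 are included. *)
Definition bounded_mean_oscillation (b : R -> C) : Prop :=
  (forall s t : R, s < t -> cintegrable `[s, t] b) /\
  exists M : R, forall s t : R, s < t -> t <= s + 2 * pi ->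
    mean_oscillation b s t <= M.

Definition BMOA : set (C -> C) :=
  [set f | hardy2 f /\
    exists b : R -> C, boundary_values f b /\ bounded_mean_oscillation b].

Implicit Types T L : (C -> C) -> (C -> C).

Definition operator_norm T : \bar R :=
  ereal_sup [set hardy_norm (T f) | f in [set f | hardy2 f /\ (hardy_norm f <= 1)%E]].

Definition bounded_operator T : Prop :=
  [/\ forall f, hardy2 f -> hardy2 (T f),
      forall (a : C) f h, hardy2 f -> hardy2 h ->
        forall z, unit_disk z ->
          T (fun w => a * f w + h w) z = a * T f z + T h z
    & (operator_norm T < +oo)%E].

Definition shift : (C -> C) -> (C -> C) := fun f z => z * f z.

Definition flip_op (n : nat) : (C -> C) -> (C -> C) :=
  fun f z => \sum_(k < n.+1) taylor_coef f k * z ^+ (n - k).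

Definition hankel_part (n : nat) T : (C -> C) -> (C -> C) :=
  fun f => flip_op n (T (iter n.+1 shift f)).

Definition asymptotic_limit T L : Prop :=
  bounded_operator L /\
  operator_norm (fun f z => hankel_part n T f z - L f z) @[n --> \oo] --> 0%E.

Definition uniformly_asymptotically_hankel T : Prop :=
  bounded_operator T /\ exists L, asymptotic_limit T L.

(* 0 is a symbol of a Hankel operator exactly when that operator is zero. *)
Definition asymptotic_symbol_zero T : Prop := asymptotic_limit T (fun _ _ => 0).

End Disk.

(* Main.v *)
Require Import Defs.
From HB Require Import structures.
From mathcomp Require Import all_boot all_order all_algebra.
From mathcomp Require Import complex.
From mathcomp Require Import all_classical all_reals all_analysis.
From mathcomp Require Import measurable_realfun ring lra.

(** Multiplication by [z ^ (n + 1)] before an integration that starts at 0 leaves no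
    Taylor coefficient of index at most [n]: this holds for [f g'] and, since a derivative
    loses only one power of [z], also for [f' g]. Hence every Hankel part of [integral_V g]
    and of [integral_S g] is zero, and what has to be proved is that the two operators are
    bounded on the Hardy space.

    Both bounds come from one principle ([hardy_comparison]). By Parseval's identity a
    pointwise inequality between the derivatives of holomorphic functions becomes an
    inequality between power series in the square of the radius; two integrations remove
    the factors brought in by differentiation. For [integral_S g] the derivative is [f' g],
    and the bound is the supremum of [|g|] ([integral_S_bound]).

    For [integral_V g] the derivative is [f g'], which is compared with derivatives of the
    functions [f exp (- H / 2) g ^ k] with weights [1 / k!], where [H] is holomorphic and
    [|g| ^ 2 <= Re H <= |g| ^ 2 + M]. The exponential series sums their squares to at most
    [|f| ^ 2], and the variance of a Poisson law ([exp_weighted_lower]) bounds the sum of the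
    squares of their derivatives from below by [exp (- M) |f g'| ^ 2]; so the squared norm
    grows at most by the factor [exp M] ([volterra_bound]).

    The function [Re H] is the Poisson integral of [|b| ^ 2], with [b] the boundary function
    of [g], and [Re H - |g| ^ 2] at a point is the variance of [b] under the Poisson density
    of that point ([BMOA_harmonic_majorant]). To bound it, mean oscillation is first turned
    into mean square oscillation by a stopping time on dyadic intervals
    ([mean_square_oscillation]), and then the Poisson kernel is dominated on dyadic shells
    around the angle of the point ([weighted_oscillation], [poisson_shell]). The radial
    limits are used through the fact that the dilations of [g] converge to [b] in mean square
    ([boundary_approx]).

    The complex analysis underneath starts from Goursat's bisection, applied to the
    parametrization of a disk by segments from a point to the circle ([contour_shrink]);
    it gives Cauchy's formula, Taylor expansions and Parseval's identity. *)

Set Implicit Arguments.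
Unset Strict Implicit.
Unset Printing Implicit Defensive.

Import Order.TTheory GRing.Theory Num.Theory.
Import numFieldNormedType.Exports.

Local Open Scope classical_set_scope.
Local Open Scope ring_scope.

(** * Moduli, real and imaginary parts, and the circle map *)

Notation measurableR D := (@measurable _ (measurableTypeR _) D).
Notation measurable_funR D f := (@measurable_fun _ _ (measurableTypeR _) _ D f).

Section ComplexBasics.
Context {R : realType}.
Local Notation C := (cplx R).
Implicit Types (z w : C) (x y t : R).

Lemma normE z : `|z| = of_real (modulus z).
Proof. by []. Qed.

Lemma modulusE z : modulus z = Num.sqrt (complex.Re z ^+ 2 + complex.Im z ^+ 2).
Proof. by case: z. Qed.

Lemma sqr_modulus z : modulus z ^+ 2 = complex.Re z ^+ 2 + complex.Im z ^+ 2.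
Proof. by rewrite modulusE sqr_sqrtr// addr_ge0 ?sqr_ge0. Qed.

Lemma modulus_ge0 z : 0 <= modulus z.
Proof. by rewrite modulusE sqrtr_ge0. Qed.

Lemma modulusM z w : modulus (z * w) = modulus z * modulus w.
Proof. exact: Normc.normcM. Qed.

Lemma modulusD z w : modulus (z + w) <= modulus z + modulus w.
Proof. exact: le_normcD. Qed.

Lemma modulusN z : modulus (- z) = modulus z.
Proof. exact: normcN. Qed.

Lemma modulusB z w : modulus (z - w) <= modulus z + modulus w.
Proof. by rewrite -[modulus w]modulusN modulusD. Qed.

Lemma modulusC z w : modulus (z - w) = modulus (w - z).
Proof. by rewrite -modulusN opprB. Qed.

Lemma modulusV z : modulus z^-1 = (modulus z)^-1.
Proof. exact: Normc.normcV. Qed.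

Lemma modulus0 : modulus (0 : C) = 0.
Proof. exact: Normc.normc0. Qed.

Lemma modulus1 : modulus (1 : C) = 1.
Proof. exact: Normc.normc1. Qed.

Lemma modulusX z n : modulus (z ^+ n) = modulus z ^+ n.
Proof.
by elim: n => [|n ih]; rewrite ?modulus1// !exprS modulusM ih.
Qed.

Lemma modulus_eq0 z : (modulus z == 0) = (z == 0).
Proof.
by apply/idP/idP => [/eqP/Normc.eq0_normc ->//|/eqP ->]; rewrite modulus0.
Qed.

Lemma modulus_gt0 z : (0 < modulus z) = (z != 0).
Proof. by rewrite lt_neqAle modulus_ge0 andbT eq_sym modulus_eq0. Qed.

Lemma modulus_real x : modulus (of_real x) = `|x|.
Proof. by rewrite modulusE /= expr0n/= addr0 sqrtr_sqr. Qed.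

Lemma modulus_sub z w : modulus z - modulus w <= modulus (z - w).
Proof. by rewrite lerBlDr (le_trans _ (modulusD _ _))// subrK. Qed.

Lemma Re_le_modulus z : `|complex.Re z| <= modulus z.
Proof. by rewrite modulusE -sqrtr_sqr ler_wsqrtr// lerDl sqr_ge0. Qed.

Lemma Im_le_modulus z : `|complex.Im z| <= modulus z.
Proof. by rewrite modulusE -sqrtr_sqr ler_wsqrtr// lerDr sqr_ge0. Qed.

Lemma modulus_le_ReIm z : modulus z <= `|complex.Re z| + `|complex.Im z|.
Proof.
rewrite -(@ler_pXn2r _ 2)// ?nnegrE ?modulus_ge0 ?addr_ge0//.
rewrite sqr_modulus sqrrD !real_normK ?num_real//.
by rewrite -addrA lerD2l lerDr mulrn_wge0// mulr_ge0.
Qed.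

Lemma of_realD x y : of_real (x + y) = of_real x + of_real y.
Proof. exact: rmorphD. Qed.
Lemma of_realB x y : of_real (x - y) = of_real x - of_real y.
Proof. exact: rmorphB. Qed.
Lemma of_realM x y : of_real (x * y) = of_real x * of_real y.
Proof. exact: rmorphM. Qed.
Lemma of_realV x : of_real x^-1 = (of_real x)^-1.
Proof. exact: fmorphV. Qed.
Lemma of_realX x n : of_real (x ^+ n) = of_real x ^+ n.
Proof. exact: rmorphXn. Qed.
Lemma of_real0 : of_real (0 : R) = 0.
Proof. by []. Qed.
Lemma of_real1 : of_real (1 : R) = 1.
Proof. by []. Qed.
Lemma of_real_nat n : of_real (n%:R : R) = n%:R.
Proof. exact: rmorph_nat. Qed.
Lemma of_real_eq0 x : (of_real x == 0) = (x == 0).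
Proof. exact: fmorph_eq0. Qed.

Lemma ReD z w : complex.Re (z + w) = complex.Re z + complex.Re w.
Proof. by case: z w => [? ?] [? ?]. Qed.
Lemma ImD z w : complex.Im (z + w) = complex.Im z + complex.Im w.
Proof. by case: z w => [? ?] [? ?]. Qed.
Lemma ReN z : complex.Re (- z) = - complex.Re z.
Proof. by case: z. Qed.
Lemma ImN z : complex.Im (- z) = - complex.Im z.
Proof. by case: z. Qed.
Lemma ReM z w : complex.Re (z * w) =
  complex.Re z * complex.Re w - complex.Im z * complex.Im w.
Proof. by case: z w => [? ?] [? ?]. Qed.
Lemma ImM z w : complex.Im (z * w) =
  complex.Re z * complex.Im w + complex.Im z * complex.Re w.
Proof. by case: z w => [? ?] [? ?]. Qed.
Lemma Re_real x : complex.Re (of_real x) = x. Proof. by []. Qed.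
Lemma Im_real x : complex.Im (of_real x) = 0. Proof. by []. Qed.

Lemma eqC z w : complex.Re z = complex.Re w -> complex.Im z = complex.Im w -> z = w.
Proof. by case: z w => [? ?] [? ?] /= -> ->. Qed.

Lemma unit_diskE z : unit_disk z <-> modulus z < 1.
Proof. by rewrite /unit_disk /= normE -of_real1 ltcR. Qed.

Lemma ltC_real (e : C) : 0 < e -> exists2 x : R, 0 < x & e = of_real x.
Proof.
case: e => a b; rewrite ltcE /= => /andP[/eqP -> a0].
by exists a.
Qed.

Lemma cvgC {T : Type} {F : set_system T} {FF : Filter F} (K : T -> C) (l : C) :
  K @ F --> l <-> forall e : R, 0 < e -> \forall t \near F, modulus (l - K t) < e.
Proof.
split.
  move/cvgrPdist_lt => H e e0.
  have e0' : 0 < of_real e by rewrite -of_real0 ltcR.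
  have := H _ e0'; apply: filterS => t.
  by rewrite normE ltcR.
move=> H; apply/cvgrPdist_lt => _ /ltC_real[e e0 ->].
have := H _ e0; apply: filterS => t.
by rewrite normE ltcR.
Qed.

Lemma nearC (z : C) (P : C -> Prop) :
  (\forall w \near z, P w) <->
  exists2 d : R, 0 < d & forall w, modulus (w - z) < d -> P w.
Proof.
split.
  move/nbhs_ballP => [_ /= /ltC_real[d d0 ->]] H; exists d => // w wz.
  by apply: H; rewrite /ball /= modulusC in wz *; rewrite normE ltcR.
move=> [d d0 H]; apply/nbhs_ballP; exists (of_real d) => /=.
  by rewrite -of_real0 ltcR.
by move=> w; rewrite /ball/= normE ltcR => wz; apply: H; rewrite modulusC.
Qed.

Lemma continuous_Re : continuous (fun z : C => complex.Re z).
Proof.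
move=> z; apply/(@cvgrPdist_lt R R^o C (nbhs z) _) => e e0; apply/nearC; exists e => // w wz.
by rewrite -ReN -ReD (le_lt_trans (Re_le_modulus _))// modulusC.
Qed.

Lemma continuous_Im : continuous (fun z : C => complex.Im z).
Proof.
move=> z; apply/(@cvgrPdist_lt R R^o C (nbhs z) _) => e e0; apply/nearC; exists e => // w wz.
by rewrite -ImN -ImD (le_lt_trans (Im_le_modulus _))// modulusC.
Qed.

Lemma continuous_modulus : continuous (fun z : C => modulus z).
Proof.
move=> z; apply/(@cvgrPdist_lt R R^o C (nbhs z) _) => e e0; apply/nearC; exists e => // w wz.
apply: le_lt_trans wz; rewrite ler_norml lerNl opprB; apply/andP; split.
  exact: modulus_sub.
by rewrite modulusC modulus_sub.
Qed.

Lemma continuous_of_real : continuous (@of_real R : R -> C).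
Proof.
move=> x; apply/cvgC => e e0; near=> y.
by rewrite -of_realB modulus_real; near: y; apply: cvgr_dist_lt.
Unshelve. all: by end_near. Qed.

Lemma cvgC_ReIm {T : Type} {F : set_system T} {FF : Filter F} (K : T -> C) (l : C) :
  (fun s : T => complex.Re (K s)) @ F --> complex.Re l ->
  (fun s : T => complex.Im (K s)) @ F --> complex.Im l -> K @ F --> l.
Proof.
move=> hr hi; apply/cvgC => e e0.
have e20 : 0 < e / 2 by rewrite divr_gt0.
near=> t.
rewrite (le_lt_trans (modulus_le_ReIm _))// ReD ReN ImD ImN [e]splitr ltrD//.
  by near: t; move/cvgrPdist_lt : hr; exact.
by near: t; move/cvgrPdist_lt : hi; exact.
Unshelve. all: by end_near. Qed.

Lemma continuous_circle : continuous (@circle R : R -> C).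
Proof.
move=> t; apply: cvgC_ReIm => /=; [exact: continuous_cos|exact: continuous_sin].
Qed.

Lemma circleD x y : circle (x + y) = circle x * circle y :> C.
Proof.
by apply: eqC; rewrite ?ReM ?ImM /= ?cosD ?sinD// addrC mulrC [X in _ + X]mulrC.
Qed.

Lemma circle0 : circle 0 = 1 :> C.
Proof. by apply: eqC; rewrite /= ?cos0 ?sin0. Qed.

Lemma circleN x : circle x * circle (- x) = 1 :> C.
Proof. by rewrite -circleD subrr circle0. Qed.

Lemma modulus_circle x : modulus (circle x : C) = 1.
Proof. by rewrite modulusE /= cos2Dsin2 sqrtr1. Qed.

Lemma circle_neq0 x : circle x != 0 :> C.
Proof. by rewrite -modulus_eq0 modulus_circle oner_eq0. Qed.

Lemma circleX x n : circle x ^+ n = circle (x *+ n) :> C.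
Proof. by elim: n => [|n ih]; rewrite ?circle0// exprS mulrS circleD ih. Qed.

Lemma circle_2pi x : circle (x + 2 * pi) = circle x :> C.
Proof. by apply: eqC; rewrite /= mulr_natl ?cosD2pi ?sinD2pi. Qed.

End ComplexBasics.

(** * Integrals of complex functions of a real variable *)

Section ComplexIntegral.
Context {R : realType}.
Local Notation C := (cplx R).
Local Notation mu := (@lebesgue_measure R).
Implicit Types (z w c : C) (x y t a b : R) (D : set R) (K L : R -> C).

Lemma eq_cintegrable D K L : measurableR D -> {in D, K =1 L} -> cintegrable D K -> cintegrable D L.
Proof.
move=> mD KL [rK iK]; split.
- by apply: (eq_integrable mD _ _ _ rK) => t tD /=; rewrite KL.
- by apply: (eq_integrable mD _ _ _ iK) => t tD /=; rewrite KL.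
Qed.

Lemma eq_cintegral D K L : {in D, K =1 L} -> cintegral D K = cintegral D L.
Proof. by move=> KL; congr Complex; apply: eq_Rintegral => t tD; rewrite KL. Qed.

Lemma cintegrableD D K L : measurableR D -> cintegrable D K -> cintegrable D L ->
  cintegrable D (fun t => K t + L t).
Proof.
move=> mD [rK iK] [rL iL]; split.
- apply: (eq_integrable mD _ _ _ (integrableD mD rK rL)) => t _ /=.
  by rewrite ReD.
- apply: (eq_integrable mD _ _ _ (integrableD mD iK iL)) => t _ /=.
  by rewrite ImD.
Qed.

Lemma cintegralD D K L : measurableR D -> cintegrable D K -> cintegrable D L ->
  cintegral D (fun t => K t + L t) = cintegral D K + cintegral D L.
Proof.
move=> mD [rK iK] [rL iL]; apply: eqC; rewrite ?ReD ?ImD /= -RintegralD//.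
- by apply: eq_Rintegral => t _; rewrite ReD.
- by apply: eq_Rintegral => t _; rewrite ImD.
Qed.

Lemma cintegrableZ D c K : measurableR D -> cintegrable D K ->
  cintegrable D (fun t => c * K t).
Proof.
move=> mD [rK iK]; split.
- apply: (eq_integrable mD _ _ _ (integrableB mD (integrableZl mD (complex.Re c) rK)
    (integrableZl mD (complex.Im c) iK))) => t _ /=.
  by rewrite ReM EFinB !EFinM.
- apply: (eq_integrable mD _ _ _ (integrableD mD (integrableZl mD (complex.Re c) iK)
    (integrableZl mD (complex.Im c) rK))) => t _ /=.
  by rewrite ImM EFinD !EFinM.
Qed.

Lemma rintegrableZ D x (f : R -> R) : measurableR D ->
  mu.-integrable D (EFin \o f) -> mu.-integrable D (EFin \o (fun t => x * f t)).
Proof.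
by move=> mD fi; apply: (eq_integrable mD _ _ _ (integrableZl mD x fi)) => t _ /=.
Qed.

Lemma rintegrableD D (f h : R -> R) : measurableR D -> mu.-integrable D (EFin \o f) ->
  mu.-integrable D (EFin \o h) -> mu.-integrable D (EFin \o (fun t => f t + h t)).
Proof. by move=> mD fi hi; apply: (eq_integrable mD _ _ _ (integrableD mD fi hi)). Qed.

Lemma cintegralZ D c K : measurableR D -> cintegrable D K ->
  cintegral D (fun t => c * K t) = c * cintegral D K.
Proof.
move=> mD [rK iK].
apply: eqC; rewrite ?ReM ?ImM /= -!RintegralZl//.
- rewrite -RintegralB//; try exact: rintegrableZ.
  by apply: eq_Rintegral => t _; rewrite ReM.
- rewrite -RintegralD//; try exact: rintegrableZ.
  by apply: eq_Rintegral => t _; rewrite ImM.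
Qed.

Lemma cintegrableN D K : measurableR D -> cintegrable D K ->
  cintegrable D (fun t => - K t).
Proof.
move=> mD /(cintegrableZ (-1) mD); apply: eq_cintegrable => // t _ /=.
by rewrite mulN1r.
Qed.

Lemma cintegrableB D K L : measurableR D -> cintegrable D K -> cintegrable D L ->
  cintegrable D (fun t => K t - L t).
Proof. by move=> mD iK iL; apply: cintegrableD => //; exact: cintegrableN. Qed.

Lemma cintegralB D K L : measurableR D -> cintegrable D K -> cintegrable D L ->
  cintegral D (fun t => K t - L t) = cintegral D K - cintegral D L.
Proof.
move=> mD iK iL; rewrite cintegralD//; last exact: cintegrableN.
congr (_ + _); rewrite -mulN1r -cintegralZ//.
by apply: eq_cintegral => t _; rewrite mulN1r.
Qed.

Lemma measurable_modulus D K : measurableR D -> cintegrable D K ->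
  measurable_funR D (fun t => modulus (K t)).
Proof.
move=> mD [/measurable_int/measurable_EFinP rK /measurable_int/measurable_EFinP iK].
have -> : (fun t => modulus (K t)) =
    (fun r : R => Num.sqrt r) \o
    (fun t => complex.Re (K t) ^+ 2 + complex.Im (K t) ^+ 2).
  by apply/funext => t; rewrite /= modulusE.
apply: measurableT_comp.
  apply: continuous_measurable_fun; exact: sqrt_continuous.
by apply: measurable_funD; apply: measurable_funX.
Qed.

Lemma integrable_modulus D K : measurableR D -> cintegrable D K ->
  mu.-integrable D (EFin \o (fun t => modulus (K t))).
Proof.
move=> mD iK; have [rK iK'] := iK.
apply: le_integrable (integrableD mD (integrable_abse rK) (integrable_abse iK')) => //.
  by apply/measurable_EFinP; exact: measurable_modulus.
move=> t Dt; rewrite /= lee_fin ger0_norm ?modulus_ge0// ger0_norm ?addr_ge0//.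
exact: modulus_le_ReIm.
Qed.

(** Rotating the integral onto the positive real axis reduces the inequality to
    the one for real parts. *)
Lemma le_modulus_cintegral D K : measurableR D -> cintegrable D K ->
  modulus (cintegral D K) <= \int[mu]_(t in D) modulus (K t).
Proof.
move=> mD iK.
set I := cintegral D K.
have [->|I0] := eqVneq I 0.
  by rewrite modulus0; apply: Rintegral_ge0 => t _; exact: modulus_ge0.
pose Ib : C := Complex (complex.Re I) (- complex.Im I).
have IbE : modulus Ib = modulus I by rewrite !modulusE /= sqrrN.
have Igt0 : 0 < modulus I by rewrite modulus_gt0.
rewrite -(@ler_pM2l _ (modulus I))//.
have -> : modulus I * modulus I = complex.Re (cintegral D (fun t => Ib * K t)).
  rewrite cintegralZ// -/I ReM -expr2 sqr_modulus.
  by rewrite [complex.Im Ib]/(- _) mulNr opprK -!expr2.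
rewrite -RintegralZl//; last exact: integrable_modulus.
apply: le_Rintegral => //.
- by case: (cintegrableZ Ib mD iK).
- by apply: rintegrableZ => //; exact: integrable_modulus.
- move=> t Dt; rewrite (le_trans (ler_norm _))// (le_trans (Re_le_modulus _))//.
  by rewrite modulusM IbE.
Qed.

Lemma Rintegral_cst_itv a b x : a <= b -> \int[mu]_(t in `[a, b]) x = x * (b - a).
Proof.
move=> ab; rewrite Rintegral_cst//; congr (_ * _).
have : fine (lebesgue_measure [set` `[a, b]]) = b - a :> R.
  rewrite lebesgue_measure_itv /= lte_fin.
  by case: ltgtP ab => // ->; rewrite subrr.
exact.
Qed.

Lemma rintegrable_cst a b x : mu.-integrable `[a, b] (EFin \o (fun=> x)).
Proof.
apply: continuous_compact_integrable; first exact: segment_compact.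
by apply: continuous_subspaceT => t; exact: cvg_cst.
Qed.

Lemma Rintegral_le_bound a b (f : R -> R) M : a <= b ->
  mu.-integrable `[a, b] (EFin \o f) -> (forall t, a <= t <= b -> f t <= M) ->
  \int[mu]_(t in `[a, b]) f t <= M * (b - a).
Proof.
move=> ab fi fM; rewrite -(Rintegral_cst_itv _ ab).
by apply: le_Rintegral => //; exact: rintegrable_cst.
Qed.

Lemma cintegral_le_bound a b K M : a <= b -> cintegrable `[a, b] K ->
  (forall t, a <= t <= b -> modulus (K t) <= M) ->
  modulus (cintegral `[a, b] K) <= M * (b - a).
Proof.
move=> ab iK KM; rewrite (le_trans (le_modulus_cintegral _ _))//.
by apply: Rintegral_le_bound => //; exact: integrable_modulus.
Qed.

Lemma within_continuous_cintegrable a b K : {within `[a, b], continuous K} ->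
  cintegrable `[a, b] K.
Proof.
move=> cK; split.
- apply: (@continuous_compact_integrable R (fun t => complex.Re (K t)));
    first exact: segment_compact.
  move=> t; exact: (continuous_comp (cK t) (@continuous_Re R _)).
- apply: (@continuous_compact_integrable R (fun t => complex.Im (K t)));
    first exact: segment_compact.
  move=> t; exact: (continuous_comp (cK t) (@continuous_Im R _)).
Qed.

Lemma continuous_cintegrable a b K : continuous K -> cintegrable `[a, b] K.
Proof.
by move=> cK; apply: within_continuous_cintegrable; exact: continuous_subspaceT.
Qed.

Lemma continuous_compact_bound a b K : {within `[a, b], continuous K} ->
  exists2 M : R, 0 < M & forall t, a <= t <= b -> modulus (K t) <= M.
Proof.
move=> cK.
have cm : {within `[a, b], continuous (fun t => modulus (K t))}.
  by move=> t; exact: (continuous_comp (cK t) (@continuous_modulus R _)).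
have /compact_bounded[M [_ HM]] := continuous_compact cm (@segment_compact R a b).
exists (`|M| + 1); first by rewrite ltr_pwDr.
move=> t tab; rewrite -[leLHS]ger0_norm ?modulus_ge0//.
apply: HM; first by rewrite (le_lt_trans (ler_norm _))// ltrDl.
by exists t => //=; rewrite in_itv.
Qed.

Lemma integrableM_continuous a b (f h : R -> R) :
  mu.-integrable `[a, b] (EFin \o f) -> {within `[a, b], continuous h} ->
  mu.-integrable `[a, b] (EFin \o (fun t => f t * h t)).
Proof.
move=> fi hc.
have -> : (EFin \o (fun t => f t * h t)) = ((EFin \o f) \* (EFin \o h))%E.
  by apply/funext => t /=; rewrite EFinM.
apply: integrableMl => //.
- apply: subspace_continuous_measurable_fun => //.
- have /compact_bounded := continuous_compact hc (@segment_compact R a b).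
  move=> [M [Mr HM]]; by exists M; split => // x Mx t tab; apply: HM.
Qed.

Lemma cintegrableM_continuous a b K L :
  cintegrable `[a, b] K -> {within `[a, b], continuous L} ->
  cintegrable `[a, b] (fun t => K t * L t).
Proof.
move=> [rK iK] cL.
have cr : {within `[a, b], continuous (fun t => complex.Re (L t))}.
  by move=> t; exact: (continuous_comp (cL t) (@continuous_Re R _)).
have ci : {within `[a, b], continuous (fun t => complex.Im (L t))}.
  by move=> t; exact: (continuous_comp (cL t) (@continuous_Im R _)).
split.
- apply: (eq_integrable _ _ _ _ (integrableB _ (integrableM_continuous rK cr)
    (integrableM_continuous iK ci))) => // t _ /=.
  by rewrite ReM.
- apply: (eq_integrable _ _ _ _ (integrableD _ (integrableM_continuous rK ci)
    (integrableM_continuous iK cr))) => // t _ /=.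
  by rewrite ImM.
Qed.

Lemma Rintegral_split a (c : R) b (f : R -> R) : a <= c -> c <= b ->
  mu.-integrable `[a, b] (EFin \o f) ->
  \int[mu]_(t in `[a, b]) f t =
  \int[mu]_(t in `[a, c]) f t + \int[mu]_(t in `[c, b]) f t.
Proof.
move=> ac cb fi.
have := @Rintegral_itvB _ f (BLeft a) (BRight b) c fi.
rewrite !bnd_simp => /(_ ac cb) H.
rewrite -[X in _ = _ + X]Rintegral_itv_obnd_cbnd; last first.
  apply: integrableS fi => //; apply: subset_itvr.
  by rewrite bnd_simp.
by rewrite -H addrC subrK.
Qed.

Lemma cintegrable_subitv a b a' b' K : a <= a' -> b' <= b ->
  cintegrable `[a, b] K -> cintegrable `[a', b'] K.
Proof.
move=> aa bb [rK iK].
have sub : [set` `[a', b']] `<=` [set` `[a, b]].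
  by apply: subset_itv; rewrite bnd_simp.
by split; [apply: integrableS rK|apply: integrableS iK].
Qed.

Lemma cintegral_split a (c : R) b K : a <= c -> c <= b -> cintegrable `[a, b] K ->
  cintegral `[a, b] K = cintegral `[a, c] K + cintegral `[c, b] K.
Proof.
move=> ac cb [rK iK].
by apply: eqC; rewrite ?ReD ?ImD /= (Rintegral_split ac cb).
Qed.

Lemma Rintegral_FTC a b (f F : R -> R) : a <= b ->
  {within `[a, b], continuous f} ->
  (forall t, a <= t <= b -> is_derive t 1 F (f t)) ->
  \int[mu]_(t in `[a, b]) f t = F b - F a.
Proof.
rewrite le_eqVlt => /predU1P[->|ab] cf dF.
  by rewrite set_itv1 Rintegral_set1 subrr.
have cF t : a <= t <= b -> {for t, continuous F}.
  move=> tab; apply: differentiable_continuous; apply/derivable1_diffP.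
  by case: (dF t tab).
have oocc t : t \in `]a, b[ -> a <= t <= b.
  by rewrite in_itv /= => /andP[/ltW -> /ltW ->].
rewrite /Rintegral (continuous_FTC2 ab cf (F := F))//.
- split; first by move=> t /oocc tab; case: (dF t tab).
  + by apply/cvg_at_right_filter/cF; rewrite lexx ltW.
  + by apply/cvg_at_left_filter/cF; rewrite lexx ltW.
- by move=> t /oocc tab; have dFt := dF t tab; rewrite derive1E; apply: derive_val.
Qed.

Lemma cintegral_FTC a b K (P : R -> C) : a <= b -> {within `[a, b], continuous K} ->
  (forall t, a <= t <= b -> is_derive t 1 (fun s => complex.Re (P s)) (complex.Re (K t))) ->
  (forall t, a <= t <= b -> is_derive t 1 (fun s => complex.Im (P s)) (complex.Im (K t))) ->
  cintegral `[a, b] K = P b - P a.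
Proof.
move=> ab cK dr di; apply: eqC; rewrite ?ReD ?ReN ?ImD ?ImN /=.
- apply: (Rintegral_FTC ab _ dr).
  by move=> t; exact: (continuous_comp (cK t) (@continuous_Re R _)).
- apply: (Rintegral_FTC ab _ di).
  by move=> t; exact: (continuous_comp (cK t) (@continuous_Im R _)).
Qed.

Lemma cintegral_cst a b c : a <= b -> cintegral `[a, b] (fun=> c) = of_real (b - a) * c.
Proof.
move=> ab.
by apply: eqC; rewrite ?ReM ?ImM /= mul0r ?subr0 ?addr0 Rintegral_cst_itv// mulrC.
Qed.

End ComplexIntegral.

(** * Goursat's bisection *)

Section RectangleBisection.
Context {R : realType}.
Local Notation C := (cplx R).
Implicit Types (s t a b c d e : R).

Definition rect_diff (P : R -> R -> C) a b c d : C :=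
  P b d - P a d - P b c + P a c.

Lemma half_expS (x : R) n : x / 2 ^+ n.+1 + x / 2 ^+ n.+1 = x / 2 ^+ n.
Proof. by rewrite exprS; field; rewrite expf_neq0. Qed.

Lemma nested_limit (u : nat -> R) (x : R) :
  (forall n, u n <= u n.+1) -> (forall n, u n.+1 + x / 2 ^+ n.+1 <= u n + x / 2 ^+ n) ->
  0 <= x -> exists l, forall n, u n <= l <= u n + x / 2 ^+ n.
Proof.
move=> un wn x0.
have um n k : u n <= u (n + k)%N.
  by elim: k => [|k ih]; rewrite ?addn0// addnS (le_trans ih).
have wm n k : u (n + k)%N + x / 2 ^+ (n + k) <= u n + x / 2 ^+ n.
  by elim: k => [|k ih]; rewrite ?addn0// addnS (le_trans _ ih).
have pos n : 0 <= x / 2 ^+ n by rewrite divr_ge0// exprn_ge0.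
have uw n m : u n <= u m + x / 2 ^+ m.
  apply: (le_trans (um n m)); apply: le_trans (wm m n).
  by rewrite addnC lerDl.
exists (sup (range u)) => n; apply/andP; split.
  apply: ub_le_sup; last by exists n.
  by exists (u 0%N + x / 2 ^+ 0) => _ [m _ <-].
by apply: ge_sup => [|_ [m _ <-]//]; exists (u 0%N), 0%N.
Qed.

Lemma exists_half_lt (x d : R) : 0 < d -> exists n, x / 2 ^+ n < d.
Proof.
move=> d0; have [n hn] : exists n, x / d < n%:R.
  by exists (Num.bound `|x / d|); rewrite (le_lt_trans (ler_norm _))// archi_boundP.
exists n; rewrite ltr_pdivrMr ?exprn_gt0// mulrC -ltr_pdivrMr//.
apply: (lt_trans hn); rewrite -natrX ltr_nat.
exact: ltn_expl.
Qed.

(** Goursat's bisection: a rectangle function that is a second difference is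
    additive, so halving both sides repeatedly keeps a quarter of its absolute
    value at each step; at the limit point this contradicts smallness compared
    with the square of the size. *)
Lemma rect_diff_eq0 (P : R -> R -> C) a b c d : a <= b -> c <= d ->
  (forall s t, a <= s <= b -> c <= t <= d -> forall e, 0 < e ->
    exists2 r, 0 < r & forall s1 s2 t1 t2, a <= s1 -> s1 <= s <= s2 -> s2 <= b ->
      c <= t1 -> t1 <= t <= t2 -> t2 <= d -> s2 - s1 < r -> t2 - t1 < r ->
      modulus (rect_diff P s1 s2 t1 t2) <= e * (s2 - s1 + (t2 - t1)) ^+ 2) ->
  rect_diff P a b c d = 0.
Proof.
move=> ab cd loc; apply/eqP/negPn/negP; rewrite -modulus_gt0 => eta0.
set eta := modulus _ in eta0.
pose l := b - a; pose m := d - c.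
have l0 : 0 <= l by rewrite subr_ge0.
have m0 : 0 <= m by rewrite subr_ge0.
pose good n (p : R * R) := eta / 4 ^+ n <=
  modulus (rect_diff P p.1 (p.1 + l / 2 ^+ n) p.2 (p.2 + m / 2 ^+ n)).
have step n (p : R * R) : {q : R * R | good n p -> [/\ good n.+1 q,
    p.1 <= q.1, q.1 + l / 2 ^+ n.+1 <= p.1 + l / 2 ^+ n,
    p.2 <= q.2 & q.2 + m / 2 ^+ n.+1 <= p.2 + m / 2 ^+ n]}.
  apply: cid.
  have [gp|] := pselect (good n p); last by exists p.
  move: p gp => [s t]; rewrite /good /=.
  have hl := half_expS l n; have hm := half_expS m n.
  have pl : 0 <= l / 2 ^+ n.+1 by rewrite divr_ge0// exprn_ge0.
  have pm : 0 <= m / 2 ^+ n.+1 by rewrite divr_ge0// exprn_ge0.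
  have -> : eta / 4 ^+ n = eta / 4 ^+ n.+1 *+ 4.
    by rewrite exprS -mulr_natr; field; rewrite expf_neq0.
  move: hl hm pl pm; set x := l / 2 ^+ n.+1; set y := m / 2 ^+ n.+1.
  set E := eta / 4 ^+ n.+1.
  move=> <- <- x0 y0.
  have -> : rect_diff P s (s + (x + x)) t (t + (y + y)) =
      rect_diff P s (s + x) t (t + y) +
      rect_diff P (s + x) (s + x + x) t (t + y) +
      (rect_diff P s (s + x) (t + y) (t + y + y) +
      rect_diff P (s + x) (s + x + x) (t + y) (t + y + y)).
    by rewrite /rect_diff !addrA; ring.
  move=> H.
  have [h1|h1] := leP E (modulus (rect_diff P s (s + x) t (t + y))).
    by exists (s, t) => /= _; split => //; rewrite lerD2l ?lerDl.
  have [h2|h2] := leP E (modulus (rect_diff P (s + x) (s + x + x) t (t + y))).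
    by exists (s + x, t) => /= _; split => //; rewrite ?addrA ?lerDl// lerD2l ?lerDl.
  have [h3|h3] := leP E (modulus (rect_diff P s (s + x) (t + y) (t + y + y))).
    by exists (s, t + y) => /= _; split => //; rewrite ?addrA ?lerDl// lerD2l ?lerDl.
  exists (s + x, t + y) => /= _; split => //; rewrite ?addrA ?lerDl//.
  rewrite leNgt; apply/negP => h4; move: H; apply/negP; rewrite -ltNge.
  apply: (le_lt_trans (modulusD _ _)).
  apply: (le_lt_trans (lerD (modulusD _ _) (modulusD _ _))).
  rewrite (_ : E *+ 4 = E + E + (E + E)); last by rewrite -mulr_natr; ring.
  by rewrite ltrD// ltrD.
pose q := fix q n := if n is k.+1 then sval (step k (q k)) else (a, c).
have gq n : good n (q n).
  elim: n => [|n ih].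
    by rewrite /good /= !expr0 !divr1 /l /m ![_ + (_ - _)]addrC !subrK.
  by case: (svalP (step n (q n)) ih).
have q1 n : (q n).1 <= (q n.+1).1 by case: (svalP (step n (q n)) (gq n)).
have q2 n : (q n.+1).1 + l / 2 ^+ n.+1 <= (q n).1 + l / 2 ^+ n.
  by case: (svalP (step n (q n)) (gq n)).
have q3 n : (q n).2 <= (q n.+1).2 by case: (svalP (step n (q n)) (gq n)).
have q4 n : (q n.+1).2 + m / 2 ^+ n.+1 <= (q n).2 + m / 2 ^+ n.
  by case: (svalP (step n (q n)) (gq n)).
have [s hs] := nested_limit q1 q2 l0.
have [t ht] := nested_limit q3 q4 m0.
have qa n : a <= (q n).1 by elim: n => //= n /le_trans; apply; exact: q1.
have qc n : c <= (q n).2 by elim: n => //= n /le_trans; apply; exact: q3.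
have qb n : (q n).1 + l / 2 ^+ n <= b.
  elim: n => [|n ih]; first by rewrite expr0 divr1 /l /= addrC subrK.
  exact: le_trans (q2 n) ih.
have qd n : (q n).2 + m / 2 ^+ n <= d.
  elim: n => [|n ih]; first by rewrite expr0 divr1 /m /= addrC subrK.
  exact: le_trans (q4 n) ih.
have sab : a <= s <= b.
  have /andP[h1 h2] := hs 0%N; rewrite (le_trans (qa 0%N) h1)/=.
  exact: le_trans h2 (qb 0%N).
have tcd : c <= t <= d.
  have /andP[h1 h2] := ht 0%N; rewrite (le_trans (qc 0%N) h1)/=.
  exact: le_trans h2 (qd 0%N).
pose K := (l + m) ^+ 2 + 1.
have K0 : 0 < K by rewrite ltr_wpDl// sqr_ge0.
have e0 : 0 < eta / (2 * K) by rewrite divr_gt0// mulr_gt0.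
have [r r0 hr] := loc s t sab tcd _ e0.
have [n hn] := exists_half_lt (l + m) r0.
have ln : l / 2 ^+ n < r.
  apply: le_lt_trans hn; rewrite ler_wpM2r ?invr_ge0 ?exprn_ge0//.
  by rewrite lerDl.
have mn : m / 2 ^+ n < r.
  apply: le_lt_trans hn; rewrite ler_wpM2r ?invr_ge0 ?exprn_ge0//.
  by rewrite lerDr.
have := hr _ _ _ _ (qa n) (hs n) (qb n) (qc n) (ht n) (qd n).
have simp (x y : R) : x + y - x = y by rewrite addrC addKr.
rewrite !simp => /(_ ln mn) /(le_trans (gq n)).
have e4 : (4 : R) ^+ n = (2 ^+ n) ^+ 2 by rewrite -exprM mulnC exprM; congr (_ ^+ _); ring.
rewrite -mulrDl expr_div_n e4 mulrA ler_pM2r ?invr_gt0 ?exprn_gt0//.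
apply/negP; rewrite -ltNge.
rewrite mulrAC ltr_pdivrMr ?mulr_gt0// ltr_pM2l//.
rewrite (_ : 2 * K = K + K); last by ring.
by rewrite ltr_pwDl// /K lerDl.
Qed.

End RectangleBisection.

(** * Complex derivatives *)

Section ComplexDerivative.
Context {R : realType}.
Local Notation C := (cplx R).
Implicit Types (f g : C -> C) (z w l : C).

(** The complex derivative as a statement about real moduli: all later differentiations
    are done by such estimates. *)
Lemma is_deriveC f z l : is_derive z (1 : C) f l <->
  forall e : R, 0 < e -> exists2 d : R, 0 < d & forall h : C, modulus h < d ->
    modulus (f (z + h) - f z - l * h) <= e * modulus h.
Proof.
split.
  move=> df e e0.
  have dfz : derivable f z 1 by case: df.
  have -> : l = 'D_1 f z by rewrite derive_val.
  have /cvgC/(_ e e0) : h^-1 *: ((f \o shift z) (h *: (1 : C)) - f z) @[h --> (0 : C)^'] -->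
     'D_1 f z by exact: dfz.
  rewrite /dnbhs /within /= => /nearC[d d0 hd]; exists d => // h hh.
  have [->|h0] := eqVneq h 0; first by rewrite addr0 subrr mulr0 subr0 modulus0 mulr0.
  have := hd h; rewrite subr0 => /(_ hh h0).
  set q := 'D_1 f z.
  rewrite /GRing.scale /= mulr1 => H.
  have -> : f (z + h) - f z - q * h = - h * (q - h^-1 * (f (h + z) - f z)).
    by rewrite [h + z]addrC; field.
  by rewrite modulusM modulusN mulrC ler_wpM2r ?modulus_ge0// ltW.
move=> H.
suff cv : h^-1 *: ((f \o shift z) (h *: (1 : C)) - f z) @[h --> (0 : C)^'] --> l.
  split; first by apply/cvg_ex; exists l.
  by apply: cvg_lim.
apply/cvgC => e e0.
have e20 : 0 < e / 2 by rewrite divr_gt0.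
have [d d0 hd] := H _ e20.
apply/nearC; exists d => // h; rewrite subr0 => hh h0.
rewrite /GRing.scale /= mulr1.
have -> : l - h^-1 * (f (h + z) - f z) = - h^-1 * (f (z + h) - f z - l * h).
  by rewrite [h + z]addrC; field.
rewrite modulusM modulusN modulusV mulrC ltr_pdivrMr ?modulus_gt0//.
apply: (le_lt_trans (hd _ hh)); rewrite ltr_pM2r ?modulus_gt0//.
by rewrite ltr_pdivrMr// ltr_pMr// ltr1n.
Qed.

Lemma is_deriveC_quadratic f z l (d K : R) : 0 < d ->
  (forall h : C, modulus h < d -> modulus (f (z + h) - f z - l * h) <= K * modulus h ^+ 2) ->
  is_derive z (1 : C) f l.
Proof.
move=> d0 H; apply/is_deriveC => e e0.
have K0 : 0 < `|K| + 1 by rewrite ltr_wpDl.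
exists (Num.min d (e / (`|K| + 1))); first by rewrite lt_min d0 divr_gt0.
move=> h; rewrite lt_min => /andP[hd he].
apply: (le_trans (H h hd)); rewrite expr2 mulrA ler_wpM2r ?modulus_ge0//.
rewrite ltr_pdivlMr// in he; apply: le_trans (ltW he).
rewrite mulrC ler_wpM2l ?modulus_ge0//.
by rewrite (le_trans (ler_norm _))// lerDl.
Qed.

Lemma derivable_continuousC f z : derivable f z 1 -> {for z, continuous f}.
Proof.
move=> /derivableP/is_deriveC/(_ 1 ltr01)[d d0 hd].
set l := 'D_1 f z in hd.
apply/(@cvgC R C (nbhs z)) => e e0.
pose M := modulus l + 1.
have M0 : 0 < M by rewrite ltr_wpDl// modulus_ge0.
apply/nearC; exists (Num.min d (e / M)); first by rewrite lt_min d0 divr_gt0.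
move=> w; rewrite lt_min => /andP[wd we].
have := hd _ wd; rewrite addrCA subrr addr0 mul1r => H.
rewrite modulusC.
have -> : f w - f z = (f w - f z - l * (w - z)) + l * (w - z) by rewrite subrK.
apply: (le_lt_trans (modulusD _ _)).
rewrite modulusM; apply: (@le_lt_trans _ _ (M * modulus (w - z))).
  by rewrite /M mulrDl mul1r addrC lerD2l.
by rewrite mulrC -ltr_pdivlMr.
Qed.

Lemma holomorphic_continuous f z : holomorphic_on_disk f -> modulus z < 1 ->
  {for z, continuous f}.
Proof. by move=> hf z1; apply/derivable_continuousC/hf/unit_diskE. Qed.

Lemma is_derive_circle (t : R) :
  is_derive t 1 (fun s : R => complex.Re (circle s)) (complex.Re (Complex 0 1 * circle t : C)) /\
  is_derive t 1 (fun s : R => complex.Im (circle s)) (complex.Im (Complex 0 1 * circle t : C)).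
Proof.
split; rewrite ?ReM ?ImM /= mul0r mul1r ?add0r.
  exact: is_derive_cos.
exact: is_derive_sin.
Qed.

Lemma continuous_mulC (K L : R -> C) : continuous K -> continuous L ->
  continuous (fun t => K t * L t).
Proof. by move=> cK cL t; apply: cvgM; [exact: cK|exact: cL]. Qed.

Lemma continuous_addC (K L : R -> C) : continuous K -> continuous L ->
  continuous (fun t => K t + L t).
Proof. by move=> cK cL t; apply: cvgD; [exact: cK|exact: cL]. Qed.

Lemma continuous_subC (K L : R -> C) : continuous K -> continuous L ->
  continuous (fun t => K t - L t).
Proof. by move=> cK cL t; apply: cvgB; [exact: cK|exact: cL]. Qed.

Lemma continuous_cstC (c : C) : continuous (fun _ : R => c).
Proof. by move=> t; exact: cvg_cst. Qed.

Lemma cintegral_circle (a b : R) : a <= b ->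
  cintegral `[a, b] (fun t => Complex 0 1 * circle t : C) = circle b - circle a.
Proof.
move=> ab; apply: (cintegral_FTC ab).
- apply: continuous_subspaceT; apply: continuous_mulC; last exact: continuous_circle.
  exact: continuous_cstC.
- by move=> t _; case: (is_derive_circle t).
- by move=> t _; case: (is_derive_circle t).
Qed.

Lemma circle_lipschitz (s t : R) : modulus (circle t - circle s : C) <= `|t - s|.
Proof.
wlog st : s t / s <= t.
  by move=> H; have [/H//|/ltW/H] := leP s t; rewrite modulusC distrC.
rewrite -cintegral_circle// ger0_norm ?subr_ge0// -[leRHS]mul1r.
apply: cintegral_le_bound => //.
  apply: continuous_cintegrable; apply: continuous_mulC; last exact: continuous_circle.
  exact: continuous_cstC.
by move=> u _; rewrite modulusM modulus_circle modulusE /= expr0n expr1n add0r sqrtr1 mulr1.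
Qed.

Lemma cintegral_near_le (a b : R) (K L : R -> C) (M : R) : a <= b ->
  cintegrable `[a, b] K -> cintegrable `[a, b] L ->
  (forall t, a <= t <= b -> modulus (K t - L t) <= M) ->
  modulus (cintegral `[a, b] K - cintegral `[a, b] L) <= M * (b - a).
Proof.
move=> ab iK iL H; rewrite -cintegralB//; apply: cintegral_le_bound => //.
exact: cintegrableB.
Qed.

End ComplexDerivative.

(** * Shrinking a circle to a point *)

Section CauchyFormula.
Context {R : realType}.
Local Notation C := (cplx R).
Local Notation mu := (@lebesgue_measure R).

Section Contour.
Variables (f : C -> C) (r : R) (a : C).
Hypothesis hf : holomorphic_on_disk f.
Hypothesis r1 : r < 1.
Hypothesis ar : modulus a < r.
Implicit Types (s t : R).

Let r0 : 0 < r. Proof. exact: le_lt_trans (modulus_ge0 _) ar. Qed.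

Let z t : C := of_real r * circle t.
(** The segments from [a] to the circle: [w 1 t] is on the circle and [w 0 t] is [a]. *)
Let w s t : C := a + of_real s * (z t - a).
Let ker t : C := Complex 0 1 * z t / (z t - a).

Let mz t : modulus (z t) = r.
Proof. by rewrite modulusM modulus_circle modulus_real mulr1 gtr0_norm. Qed.

Let za_neq0 t : z t - a != 0.
Proof.
rewrite -modulus_gt0; apply: lt_le_trans (modulus_sub _ _).
by rewrite mz subr_gt0.
Qed.

Let cz : continuous z.
Proof. by apply: continuous_mulC; [exact: continuous_cstC|exact: continuous_circle]. Qed.

Let cker : continuous ker.
Proof.
move=> t; apply: cvgM.
  by apply: cvgM; [exact: cvg_cst|exact: cz].
apply: cvgV => //; by apply: cvgB; [exact: cz|exact: cvg_cst].
Qed.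

Let w_disk s t : 0 <= s <= 1 -> modulus (w s t) < 1.
Proof.
move=> /andP[s0 s1]; apply: le_lt_trans r1.
have -> : w s t = of_real (1 - s) * a + of_real s * z t.
  by rewrite /w of_realB of_real1; ring.
apply: (le_trans (modulusD _ _)).
rewrite (modulusM _ a) (modulusM _ (z t)) !modulus_real mz (ger0_norm s0) ger0_norm ?subr_ge0//.
have {2}-> : r = (1 - s) * r + s * r by ring.
by rewrite lerD2r ler_wpM2l ?subr_ge0// ltW.
Qed.

Let K s t : C := f (w s t).

Let cKt s : 0 <= s <= 1 -> continuous (K s).
Proof.
move=> s01 t.
apply: (@continuous_comp _ _ _ (w s) f).
  apply: cvgD; first exact: cvg_cst.
  apply: cvgM; first exact: cvg_cst.
  by apply: cvgB; [exact: cz|exact: cvg_cst].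
exact/(holomorphic_continuous hf)/w_disk.
Qed.

Let cKs s t : 0 <= s <= 1 -> {for s, continuous (K^~ t)}.
Proof.
move=> s01.
apply: (@continuous_comp _ _ _ (w^~ t) f).
  apply: cvgD; first exact: cvg_cst.
  apply: cvgM; last exact: cvg_cst.
  exact: continuous_of_real.
exact/(holomorphic_continuous hf)/w_disk.
Qed.

Variable e : R.
Hypotheses (e0 : 0 < e) (e1 : e <= 1).

(** [U] and [V] integrate the closed form [f w dw / (w - a)] along the two coordinate
    directions, so the second differences of [P] are its integrals around rectangles. *)
Let U s t : C := cintegral `[0, t] (fun x => K s x * ker x).
Let V s t : C := cintegral `[e, s] (fun x => K x t * of_real x^-1).
Let P s t : C := U s t - V s t.

Let iU s b c : 0 <= s <= 1 -> cintegrable `[b, c] (fun x => K s x * ker x).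
Proof.
move=> s01; apply: continuous_cintegrable.
exact: (continuous_mulC (cKt s01) cker).
Qed.

Let iV b c t : e <= b -> c <= 1 ->
  cintegrable `[b, c] (fun x => K x t * of_real x^-1).
Proof.
move=> eb c1; apply: within_continuous_cintegrable.
apply: continuous_in_subspaceT => x; rewrite inE /= in_itv /= => /andP[bx xc].
have x0 : 0 < x by rewrite (lt_le_trans e0)// (le_trans eb).
apply: cvgM; first by apply: cKs; rewrite (ltW x0)/= (le_trans xc).
apply: (@continuous_comp _ _ _ (fun x : R => x^-1) (@of_real R)).
  by apply: cvgV; [rewrite gt_eqF|exact: cvg_id].
exact: continuous_of_real.
Qed.

Let rdE s1 s2 t1 t2 : e <= s1 -> s1 <= s2 -> s2 <= 1 -> 0 <= t1 -> t1 <= t2 ->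
  rect_diff P s1 s2 t1 t2 =
  cintegral `[t1, t2] (fun x => (K s2 x - K s1 x) * ker x) -
  cintegral `[s1, s2] (fun x => (K x t2 - K x t1) * of_real x^-1).
Proof.
move=> es1 s12 s21 t10 t12.
have h1 : 0 <= s1 <= 1 by rewrite (le_trans (ltW e0))//= (le_trans s12).
have h2 : 0 <= s2 <= 1 by rewrite (le_trans (ltW e0)) ?(le_trans es1).
have -> : cintegral `[t1, t2] (fun x => (K s2 x - K s1 x) * ker x) =
   cintegral `[t1, t2] (fun x => K s2 x * ker x) -
   cintegral `[t1, t2] (fun x => K s1 x * ker x).
  rewrite -cintegralB//; try exact: iU.
  by apply: eq_cintegral => x _; rewrite mulrBl.
have -> : cintegral `[s1, s2] (fun x => (K x t2 - K x t1) * of_real x^-1) =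
   cintegral `[s1, s2] (fun x => K x t2 * of_real x^-1) -
   cintegral `[s1, s2] (fun x => K x t1 * of_real x^-1).
  rewrite -cintegralB//; try exact: iV.
  by apply: eq_cintegral => x _; rewrite mulrBl.
rewrite /rect_diff /P /U /V.
rewrite (@cintegral_split _ 0 t1 t2 _ t10 t12 (iU _ _ h2)).
rewrite (@cintegral_split _ 0 t1 t2 _ t10 t12 (iU _ _ h1)).
rewrite (@cintegral_split _ e s1 s2 _ es1 s12 (iV _ (lexx _) s21)).
rewrite (@cintegral_split _ e s1 s2 _ es1 s12 (iV _ (lexx _) s21)).
by do 8 (move: (cintegral _ _) => ?); ring.
Qed.

Let w_lip s t s' t' : 0 <= s <= 1 ->
  modulus (w s' t' - w s t) <= 2 * (`|s' - s| + `|t' - t|).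
Proof.
move=> /andP[s0 s1].
have -> : w s' t' - w s t = of_real (s' - s) * (z t' - a) +
    of_real s * (of_real r * (circle t' - circle t)).
  by rewrite /w /z of_realB; ring.
apply: (le_trans (modulusD _ _)); rewrite [leRHS]mulrDr lerD//.
  rewrite modulusM modulus_real mulrC ler_wpM2r//.
  rewrite (le_trans (modulusB _ _))// mz.
  have -> : (2 : R) = 1 + 1 by ring.
  by rewrite lerD// ltW// (lt_trans ar).
rewrite !modulusM !modulus_real (ger0_norm s0) (gtr0_norm r0) mulrA.
rewrite ler_pM ?mulr_ge0 ?modulus_ge0 ?(ltW r0)//; last exact: circle_lipschitz.
rewrite (@le_trans _ _ 1)// ?ler1n// -[1](mulr1 1) ler_pM// ltW//.
Qed.

(** Locally [f] is affine up to a small error, and the form has no integral around a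
    rectangle when [f] is affine: both contributions then equal [Lin]. *)
Let rd_local s t : e <= s <= 1 -> 0 <= t <= 2 * pi -> forall d, 0 < d ->
  exists2 q, 0 < q & forall s1 s2 t1 t2, e <= s1 -> s1 <= s <= s2 -> s2 <= 1 ->
    0 <= t1 -> t1 <= t <= t2 -> t2 <= 2 * pi -> s2 - s1 < q -> t2 - t1 < q ->
    modulus (rect_diff P s1 s2 t1 t2) <= d * (s2 - s1 + (t2 - t1)) ^+ 2.
Proof.
move=> /andP[es s1] t2pi d d0.
have s01 : 0 <= s <= 1 by rewrite (le_trans (ltW e0)).
have [M M0 hM] := continuous_compact_bound (@continuous_subspaceT _ _ `[0, 2 * pi] _ cker).
have := hf (proj2 (unit_diskE _) (w_disk t s01)).
move=> /derivableP/is_deriveC; set l := 'D_1 f _ => der.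
pose d' := d / (4 * (M + e^-1)).
have Me : 0 < M + e^-1 by rewrite addr_gt0// invr_gt0.
have d'0 : 0 < d' by rewrite divr_gt0// mulr_gt0.
have [q q0 hq] := der _ d'0.
exists (q / 4); first by rewrite divr_gt0.
move=> s1' s2' t1 t2 es1 /andP[s1s ss2] s21 t10 /andP[t1t tt2] t22 sq tq.
set sg := s2' - s1' + (t2 - t1).
have sg2 : 2 * sg < q.
  have -> : q = 2 * (q / 4 + q / 4) by field.
  by rewrite ltr_pM2l// ltrD.
pose E x y := K x y - K s t - l * (w x y - w s t).
have hE x y : s1' <= x <= s2' -> t1 <= y <= t2 -> modulus (E x y) <= d' * (2 * sg).
  move=> /andP[x1 x2] /andP[y1 y2].
  have wl : modulus (w x y - w s t) <= 2 * sg.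
    apply: (le_trans (w_lip _ _ _ s01)); rewrite ler_pM2l// lerD//.
      by rewrite ler_norml; lra.
    by rewrite ler_norml; lra.
  have := hq _ (le_lt_trans wl sg2).
  rewrite addrCA subrr addr0 => /le_trans; apply.
  by rewrite ler_pM2l.
have s12 : s1' <= s2' by rewrite (le_trans s1s).
have t12 : t1 <= t2 by rewrite (le_trans t1t).
have h1 : 0 <= s1' <= 1 by rewrite (le_trans (ltW e0))//= (le_trans s12).
have h2 : 0 <= s2' <= 1 by rewrite (le_trans (ltW e0)) ?(le_trans es1).
rewrite rdE//.
pose Lin := l * of_real (s2' - s1') * (z t2 - z t1).
have A1 : modulus (cintegral `[t1, t2] (fun x => (K s2' x - K s1' x) * ker x) - Lin)
    <= 4 * d' * sg * M * (t2 - t1).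
  have -> : Lin = cintegral `[t1, t2]
      (fun x => l * of_real (s2' - s1') * of_real r * (Complex 0 1 * circle x)).
    rewrite cintegralZ//.
      by rewrite cintegral_circle// /Lin /z; ring.
    apply: continuous_cintegrable; apply: continuous_mulC; last exact: continuous_circle.
    exact: continuous_cstC.
  apply: cintegral_near_le => //.
  - apply: continuous_cintegrable.
    exact: (continuous_mulC (continuous_subC (cKt h2) (cKt h1)) cker).
  - apply: continuous_cintegrable; apply: continuous_mulC; first exact: continuous_cstC.
    by apply: continuous_mulC; [exact: continuous_cstC|exact: continuous_circle].
  - move=> x xt.
    have -> : (K s2' x - K s1' x) * ker x -
      l * of_real (s2' - s1') * of_real r * (Complex 0 1 * circle x) =
      (E s2' x - E s1' x) * ker x.
      rewrite /E /ker /w of_realB.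
      have -> : l * (of_real s2' - of_real s1') * of_real r * (Complex 0 1 * circle x)
        = l * (of_real s2' - of_real s1') * (Complex 0 1 * z x) by rewrite /z; ring.
      move: (za_neq0 x) (K s2' x) (K s1' x) (K s t) => + K2 K1 K0.
      move: (z x) (z t) => zx zt zxa.
      by field.
    rewrite modulusM ler_pM ?modulus_ge0//; last first.
      apply: hM; case/andP: xt => xt1 xt2.
      by rewrite (le_trans t10)//= (le_trans xt2).
    have -> : 4 * d' * sg = d' * (2 * sg) + d' * (2 * sg) by ring.
    by rewrite (le_trans (modulusB _ _))// lerD// hE// ?lexx ?s12.
have A2 : modulus (cintegral `[s1', s2'] (fun x => (K x t2 - K x t1) * of_real x^-1) - Lin)
    <= 4 * d' * sg * e^-1 * (s2' - s1').
  have -> : Lin = cintegral `[s1', s2'] (fun x => l * (z t2 - z t1)).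
    by rewrite cintegral_cst// /Lin; ring.
  apply: cintegral_near_le => //.
  - apply: (@eq_cintegrable _ _ (fun x => K x t2 * of_real x^-1 - K x t1 * of_real x^-1)) => //.
      by move=> x _; rewrite mulrBl.
    by apply: cintegrableB => //; exact: iV.
  - by apply: continuous_cintegrable; exact: continuous_cstC.
  - move=> x xs; have /andP[sx xs2] := xs.
    have x0 : 0 < x by rewrite (lt_le_trans e0)// (le_trans es1).
    have -> : (K x t2 - K x t1) * of_real x^-1 - l * (z t2 - z t1) =
      (E x t2 - E x t1) * of_real x^-1.
      rewrite /E /w of_realV.
      have : of_real x != 0 by rewrite of_real_eq0 gt_eqF.
      move: (of_real x) => X X0.
      by field.
    rewrite modulusM modulus_real ler_pM ?modulus_ge0//; last first.
      rewrite ger0_norm ?invr_ge0 ?(ltW x0)// lef_pV2 ?posrE//.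
      by rewrite (le_trans es1).
    have -> : 4 * d' * sg = d' * (2 * sg) + d' * (2 * sg) by ring.
    by rewrite (le_trans (modulusB _ _))// lerD// hE// ?lexx ?t12.
set I1 := cintegral _ _ in A1 *; set I2 := cintegral _ _ in A2 *.
have -> : I1 - I2 = (I1 - Lin) - (I2 - Lin) by ring.
apply: (le_trans (modulusB _ _)); apply: (le_trans (lerD A1 A2)).
have sgs : s2' - s1' <= sg by rewrite lerDl subr_ge0.
have sgt : t2 - t1 <= sg by rewrite lerDr subr_ge0.
have sg0 : 0 <= sg by rewrite addr_ge0 ?subr_ge0.
have -> : d = 4 * d' * (M + e^-1).
  by rewrite /d'; field; rewrite gt_eqF//= gt_eqF// addr_gt0// mulr_gt0.
rewrite expr2.
have -> : 4 * d' * (M + e^-1) * (sg * sg) =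
  4 * d' * sg * M * sg + 4 * d' * sg * e^-1 * sg by ring.
have c0 : 0 <= 4 * d' * sg by rewrite mulr_ge0// mulr_ge0// ltW.
by rewrite lerD// ler_wpM2l// mulr_ge0 ?invr_ge0 ?(ltW M0) ?(ltW e0).
Qed.

(** The circle of radius r shrinks to a small circle-like loop around [a] along
    the segments joining it to [a]; the integral of [f (z) / (z - a)] over the
    loop does not change. *)
Lemma contour_shrink :
  cintegral `[0, 2 * pi] (fun t => f (z t) * ker t) =
  cintegral `[0, 2 * pi] (fun t => K e t * ker t).
Proof.
have pi2 : 0 <= 2 * pi :> R by rewrite mulr_ge0// pi_ge0.
have := rect_diff_eq0 e1 pi2 rd_local.
rewrite rdE// => /eqP; rewrite subr_eq0.
have -> : cintegral `[e, 1] (fun x => (K x (2 * pi) - K x 0) * of_real x^-1) = 0.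
  rewrite (@eq_cintegral _ _ _ (fun=> 0)); first by rewrite cintegral_cst// mulr0.
  move=> x _; suff -> : K x (2 * pi) = K x 0 by rewrite subrr mul0r.
  by rewrite /K /w /z -[2 * pi]add0r circle_2pi.
rewrite (@eq_cintegral _ _ _ (fun x => K 1 x * ker x - K e x * ker x)); last first.
  by move=> x _; rewrite mulrBl.
rewrite cintegralB//; [|by apply: iU; rewrite ler01 lexx|by apply: iU; rewrite (ltW e0)].
rewrite subr_eq0 => /eqP <-; apply: eq_cintegral => t _; congr (f _ * _).
by rewrite /w mul1r addrC subrK.
Qed.

End Contour.
End CauchyFormula.

(** * Circle means and the Cauchy kernel *)

Section CircleMean.
Context {R : realType}.
Local Notation C := (cplx R).
Local Notation mu := (@lebesgue_measure R).
Local Notation T := `[0, 2 * pi : R]%classic.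
Implicit Types (K L : R -> C) (c z : C) (t : R).

Lemma two_pi_gt0 : 0 < 2 * pi :> R.
Proof. by rewrite mulr_gt0// pi_gt0. Qed.

Definition circle_mean K : C := of_real (2 * pi)^-1 * cintegral T K.

Definition real_circle_mean (f : R -> R) : R := (2 * pi)^-1 * \int[mu]_(t in T) f t.

Lemma eq_circle_mean K L : K =1 L -> circle_mean K = circle_mean L.
Proof. by move=> KL; congr (_ * _); apply: eq_cintegral => t _; exact: KL. Qed.

Lemma circle_meanD K L : cintegrable T K -> cintegrable T L ->
  circle_mean (fun t => K t + L t) = circle_mean K + circle_mean L.
Proof. by move=> iK iL; rewrite /circle_mean cintegralD// mulrDr. Qed.

Lemma circle_meanB K L : cintegrable T K -> cintegrable T L ->
  circle_mean (fun t => K t - L t) = circle_mean K - circle_mean L.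
Proof. by move=> iK iL; rewrite /circle_mean cintegralB// mulrBr. Qed.

Lemma circle_meanZ c K : cintegrable T K ->
  circle_mean (fun t => c * K t) = c * circle_mean K.
Proof. by move=> iK; rewrite /circle_mean cintegralZ// mulrCA. Qed.

Lemma circle_mean_cst c : circle_mean (fun=> c) = c.
Proof.
rewrite /circle_mean cintegral_cst ?(ltW two_pi_gt0)// subr0 mulrA -of_realM.
by rewrite mulVf ?mul1r// gt_eqF// two_pi_gt0.
Qed.

Lemma Re_circle_mean K : complex.Re (circle_mean K) =
  real_circle_mean (fun t => complex.Re (K t)).
Proof. by rewrite ReM Re_real Im_real mul0r subr0. Qed.

Lemma Im_circle_mean K : complex.Im (circle_mean K) =
  real_circle_mean (fun t => complex.Im (K t)).
Proof. by rewrite ImM Re_real Im_real mul0r addr0. Qed.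

Lemma le_modulus_circle_mean K : cintegrable T K ->
  modulus (circle_mean K) <= real_circle_mean (fun t => modulus (K t)).
Proof.
move=> iK; rewrite modulusM modulus_real ger0_norm ?invr_ge0 ?(ltW two_pi_gt0)//.
rewrite ler_wpM2l ?invr_ge0 ?(ltW two_pi_gt0)//.
exact: le_modulus_cintegral.
Qed.

Lemma real_circle_mean_ge0 (f : R -> R) : (forall t, 0 <= f t) -> 0 <= real_circle_mean f.
Proof.
move=> f0; rewrite mulr_ge0 ?invr_ge0 ?(ltW two_pi_gt0)//.
by apply: Rintegral_ge0.
Qed.

Lemma le_real_circle_mean (f g : R -> R) : mu.-integrable T (EFin \o f) ->
  mu.-integrable T (EFin \o g) -> (forall t, f t <= g t) ->
  real_circle_mean f <= real_circle_mean g.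
Proof.
move=> fi gi fg; rewrite ler_wpM2l ?invr_ge0 ?(ltW two_pi_gt0)//.
by apply: le_Rintegral.
Qed.

Lemma real_circle_meanZ x (f : R -> R) : mu.-integrable T (EFin \o f) ->
  real_circle_mean (fun t => x * f t) = x * real_circle_mean f.
Proof. by move=> fi; rewrite /real_circle_mean RintegralZl// mulrCA. Qed.

Lemma real_circle_mean_cst x : real_circle_mean (fun=> x) = x.
Proof.
rewrite /real_circle_mean Rintegral_cst_itv ?(ltW two_pi_gt0)// subr0 mulrCA.
by rewrite mulVf ?mulr1// gt_eqF// two_pi_gt0.
Qed.

Lemma circle_mean_le_bound K (M : R) : cintegrable T K ->
  (forall t, modulus (K t) <= M) -> modulus (circle_mean K) <= M.
Proof.
move=> iK KM; rewrite (le_trans (le_modulus_circle_mean iK))//.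
rewrite -[leRHS]real_circle_mean_cst; apply: le_real_circle_mean => //.
  exact: integrable_modulus.
exact: rintegrable_cst.
Qed.

Lemma is_derive_circleM (x t : R) :
  is_derive t 1 (fun s : R => complex.Re (circle (x * s)))
    (complex.Re (Complex 0 x * circle (x * t) : C)) /\
  is_derive t 1 (fun s : R => complex.Im (circle (x * s)))
    (complex.Im (Complex 0 x * circle (x * t) : C)).
Proof.
have dx : is_derive t 1 (fun s : R => x * s) x.
  have := @is_deriveZ R _ _ id x t 1 1 (is_derive_id _ _).
  by rewrite /GRing.scale /= mulr1.
split; rewrite ?ReM ?ImM /= mul0r ?add0r.
  have := @is_derive1_comp R cos (fun s => x * s) t _ _ (is_derive_cos _) dx.
  by rewrite mulNr mulrC.
have := @is_derive1_comp R sin (fun s => x * s) t _ _ (is_derive_sin _) dx.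
by rewrite mulrC.
Qed.

Lemma continuous_circleM (x : R) : continuous (fun t => circle (x * t) : C).
Proof.
move=> t; apply: (@continuous_comp _ _ _ (fun t => x * t) (@circle R)).
  exact: mulrl_continuous.
exact: continuous_circle.
Qed.

Lemma circle_mulpi (k : nat) : circle (k%:R * (2 * pi)) = 1 :> C.
Proof.
elim: k => [|k ih]; first by rewrite mul0r circle0.
by rewrite -natr1 mulrDl mul1r circle_2pi.
Qed.

Lemma circle_mean_circleM (x : R) (k : nat) : (0 < k)%N -> `|x| = k%:R ->
  circle_mean (fun t => circle (x * t)) = 0.
Proof.
move=> k0 xk.
have x0 : x != 0 by rewrite -normr_eq0 xk pnatr_eq0 -lt0n.
have ci := @continuous_cintegrable R 0 (2 * pi) _ (@continuous_circleM x).
have cx1 : circle (x * (2 * pi)) = 1 :> C.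
  have [x_ge0|x_lt0] := leP 0 x; first by rewrite -(ger0_norm x_ge0) xk circle_mulpi.
  apply: (mulIf (circle_neq0 (k%:R * (2 * pi)))).
  by rewrite -circleD -xk ltr0_norm// mulNr addrN circle0 mul1r -mulNr -ltr0_norm// xk circle_mulpi.
have : cintegral T (fun t => Complex 0 x * circle (x * t) : C) = 0.
  have -> : (0 : C) = circle (x * (2 * pi)) - circle (x * 0).
    by rewrite cx1 mulr0 circle0 subrr.
  apply: (@cintegral_FTC R 0 (2 * pi) _ (fun t => circle (x * t))).
  - exact: ltW two_pi_gt0.
  - apply: continuous_subspaceT; apply: continuous_mulC; first exact: continuous_cstC.
    exact: continuous_circleM.
  - by move=> t _; case: (is_derive_circleM x t).
  - by move=> t _; case: (is_derive_circleM x t).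
rewrite cintegralZ// => /eqP; rewrite mulf_eq0 => /orP[|/eqP].
  by move=> /eqP[/eqP]; rewrite (negbTE x0).
by rewrite /circle_mean => ->; rewrite mulr0.
Qed.

Lemma circleN_exp t n : circle (- t) ^+ n = circle (- n%:R * t) :> C.
Proof. by rewrite circleX mulNr mulr_natl mulNrn. Qed.

Lemma circle_mean_circleN n : (0 < n)%N -> circle_mean (fun t => circle (- t) ^+ n) = 0.
Proof.
move=> n0; under eq_circle_mean do rewrite circleN_exp.
by apply: (circle_mean_circleM n0); rewrite normrN normr_nat.
Qed.

Definition cauchy_kernel z t : C := (1 - z * circle (- t))^-1.

Lemma modulus_mul_circle z t : modulus (z * circle t) = modulus z.
Proof. by rewrite modulusM modulus_circle mulr1. Qed.

Lemma cauchy_denom_ge z t : 1 - modulus z <= modulus (1 - z * circle (- t)).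
Proof. by rewrite -{1}(modulus_mul_circle z (- t)) -{1}modulus1 modulus_sub. Qed.

Lemma cauchy_denom_neq0 z t : modulus z < 1 -> 1 - z * circle (- t) != 0.
Proof.
by move=> z1; rewrite -modulus_gt0 (lt_le_trans _ (cauchy_denom_ge _ _))// subr_gt0.
Qed.

Lemma cauchy_kernel_le z t : modulus z < 1 ->
  modulus (cauchy_kernel z t) <= (1 - modulus z)^-1.
Proof.
move=> z1; rewrite modulusV lef_pV2 ?cauchy_denom_ge// posrE ?subr_gt0//.
by rewrite modulus_gt0 cauchy_denom_neq0.
Qed.

Lemma continuous_circleN : continuous (fun t => circle (- t) : C).
Proof.
by move=> t; apply: (@continuous_comp _ _ _ -%R (@circle R)); [exact: opp_continuous|exact: continuous_circle].
Qed.

Lemma continuous_expC K n : continuous K -> continuous (fun t => K t ^+ n).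
Proof.
move=> cK; elim: n => [|n ih]; first exact: continuous_cstC.
by under eq_fun do rewrite exprS; exact: continuous_mulC.
Qed.

Lemma continuous_cauchy_kernel z : modulus z < 1 -> continuous (cauchy_kernel z).
Proof.
move=> z1 t; apply: cvgV; first exact: cauchy_denom_neq0.
apply: cvgB; first exact: cvg_cst.
by apply: cvgM; [exact: cvg_cst|exact: continuous_circleN].
Qed.

Lemma cauchy_kernel_geometric z t N : modulus z < 1 ->
  cauchy_kernel z t = \sum_(n < N) z ^+ n * circle (- t) ^+ n +
    z ^+ N * (circle (- t) ^+ N * cauchy_kernel z t).
Proof.
move=> z1; have d0 := cauchy_denom_neq0 t z1.
apply: (mulIf d0); rewrite /cauchy_kernel mulVf// mulrDl -!mulrA mulVf// mulr1.
have -> : \sum_(n < N) z ^+ n * circle (- t) ^+ n = \sum_(i < N) (z * circle (- t)) ^+ i.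
  by apply: eq_bigr => i _; rewrite exprMn.
by rewrite -exprMn mulrC -[1 - _]opprB mulNr -subrX1 opprB subrK.
Qed.

Lemma continuous_sumC N (F : nat -> R -> C) : (forall n, continuous (F n)) ->
  continuous (fun t => \sum_(n < N) F n t).
Proof.
move=> cF; elim: N => [|N ih].
  by under eq_fun do rewrite big_ord0; exact: continuous_cstC.
under eq_fun do rewrite big_ord_recr /=.
exact: (continuous_addC ih (cF N)).
Qed.

End CircleMean.

(** * Cauchy transforms and Cauchy's formula *)

Section CauchyTransform.
Context {R : realType}.
Local Notation C := (cplx R).
Local Notation mu := (@lebesgue_measure R).
Local Notation T := `[0, 2 * pi : R]%classic.
Implicit Types (K L : R -> C) (c z : C) (t : R).

Lemma cintegrable_mulT K L : cintegrable T K -> continuous L ->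
  cintegrable T (fun t => K t * L t).
Proof.
by move=> iK cL; apply: cintegrableM_continuous => //; exact: continuous_subspaceT.
Qed.

Lemma continuous_circleN_exp n : continuous (fun t => circle (- t) ^+ n : C).
Proof. exact: (@continuous_expC R _ n (@continuous_circleN R)). Qed.

Definition fourier K n : C := circle_mean (fun t => K t * circle (- t) ^+ n).

Definition cauchy_transform K z : C := circle_mean (fun t => K t * cauchy_kernel z t).

Lemma cintegrable_fourier K n : cintegrable T K ->
  cintegrable T (fun t => K t * circle (- t) ^+ n).
Proof.
by move=> iK; exact: (cintegrable_mulT iK (@continuous_circleN_exp n)).
Qed.

Lemma cintegrable_sum N (F : nat -> R -> C) : (forall n, cintegrable T (F n)) ->
  cintegrable T (fun t => \sum_(n < N) F n t).
Proof.
move=> iF; elim: N => [|N ih].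
  rewrite (_ : (fun _ => _) = fun=> 0); last by apply/funext => t; rewrite big_ord0.
  by apply: continuous_cintegrable; exact: continuous_cstC.
rewrite (_ : (fun _ => _) = fun t => \sum_(n < N) F n t + F N t).
  exact: (cintegrableD _ ih (iF N)).
by apply/funext => t; rewrite big_ord_recr.
Qed.

Lemma circle_mean_sum N (F : nat -> R -> C) : (forall n, cintegrable T (F n)) ->
  circle_mean (fun t => \sum_(n < N) F n t) = \sum_(n < N) circle_mean (F n).
Proof.
move=> iF; elim: N => [|N ih].
  under eq_circle_mean do rewrite big_ord0.
  by rewrite big_ord0 circle_mean_cst.
under eq_circle_mean do rewrite big_ord_recr /=.
rewrite (circle_meanD (cintegrable_sum N iF) (iF N)).
by rewrite big_ord_recr /= ih.
Qed.

(** The geometric expansion of the Cauchy kernel, integrated term by term. *)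
Lemma cauchy_transform_remainder K z N : cintegrable T K -> modulus z < 1 ->
  modulus (cauchy_transform K z - \sum_(n < N) fourier K n * z ^+ n) <=
  modulus z ^+ N * ((1 - modulus z)^-1 * real_circle_mean (fun t => modulus (K t))).
Proof.
move=> iK z1.
have ick := continuous_cauchy_kernel z1.
have iu n := cintegrable_fourier n iK.
have iR : cintegrable T (fun t => K t * (circle (- t) ^+ N * cauchy_kernel z t)).
  exact: (cintegrable_mulT iK (continuous_mulC (@continuous_circleN_exp N) ick)).
have -> : cauchy_transform K z - \sum_(n < N) fourier K n * z ^+ n =
    z ^+ N * circle_mean (fun t => K t * (circle (- t) ^+ N * cauchy_kernel z t)).
  apply/eqP; rewrite subr_eq; apply/eqP.
  have -> : \sum_(n < N) fourier K n * z ^+ n =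
     circle_mean (fun t => \sum_(n < N) z ^+ n * (K t * circle (- t) ^+ n)).
    rewrite (@circle_mean_sum N (fun n t => z ^+ n * (K t * circle (- t) ^+ n))).
      by apply: eq_bigr => n _; rewrite circle_meanZ// mulrC.
    by move=> n; exact: cintegrableZ.
  rewrite -circle_meanZ// -circle_meanD//; [|exact: cintegrableZ|]; last first.
    by apply: (@cintegrable_sum N (fun n t => z ^+ n * (K t * circle (- t) ^+ n))) => n; exact: cintegrableZ.
  apply: eq_circle_mean => t.
  rewrite [LHS](congr1 (fun k => K t * k) (cauchy_kernel_geometric t N z1)).
  rewrite mulrDr addrC [K t * (z ^+ N * _)]mulrCA; congr (_ + _).
  by rewrite mulr_sumr; apply: eq_bigr => n _; rewrite mulrCA.
rewrite modulusM modulusX ler_wpM2l ?exprn_ge0 ?modulus_ge0//.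
apply: (le_trans (le_modulus_circle_mean iR)).
rewrite -real_circle_meanZ; last exact: integrable_modulus.
apply: le_real_circle_mean.
- exact: integrable_modulus.
- by apply: rintegrableZ => //; exact: integrable_modulus.
- move=> t; rewrite 2!modulusM modulusX modulus_circle expr1n mul1r mulrC.
  by rewrite ler_wpM2r ?modulus_ge0// cauchy_kernel_le.
Qed.

Lemma exp_lt_eps (x K e : R) : 0 <= x -> x < 1 -> 0 < e -> exists N, forall n, (N <= n)%N ->
  x ^+ n * K <= e.
Proof.
move=> x0 x1 e0.
have K0 : 0 < `|K| + 1 by rewrite ltr_wpDl.
have := @cvg_expr R x; rewrite ger0_norm// => /(_ x1) /cvgrPdist_lt.
move=> /(_ (e / (`|K| + 1)) (divr_gt0 e0 K0)) [N _ hN].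
exists N => n Nn; have := hN n Nn; rewrite sub0r normrN ger0_norm ?exprn_ge0//.
rewrite ltr_pdivlMr// => /ltW; apply: le_trans.
by rewrite ler_wpM2l ?exprn_ge0// (le_trans (ler_norm _))// lerDl.
Qed.

Lemma cauchy_transform_coef_eq K z (c : C) : cintegrable T K -> modulus z < 1 ->
  fourier K 0 = c -> (forall n, (0 < n)%N -> fourier K n = 0) -> cauchy_transform K z = c.
Proof.
move=> iK z1 K0 Kn.
apply/eqP; rewrite -subr_eq0 -modulus_eq0; apply/eqP/le_anti; rewrite modulus_ge0 andbT.
apply/ler_addgt0Pl => e e0; rewrite addr0.
have [N hN] := exp_lt_eps ((1 - modulus z)^-1 * real_circle_mean (fun t => modulus (K t)))
  (modulus_ge0 z) z1 e0.
apply: le_trans (hN N.+1 (leqnSn N)).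
apply: le_trans (cauchy_transform_remainder N.+1 iK z1).
rewrite big_ord_recl /= K0 expr0 mulr1 big1 ?addr0// => i _.
by rewrite Kn ?mul0r.
Qed.

Lemma circle_mean_cauchy_kernel z : modulus z < 1 -> circle_mean (cauchy_kernel z) = 1.
Proof.
move=> z1.
have i1 : cintegrable T (fun=> 1 : C).
  by apply: continuous_cintegrable; exact: continuous_cstC.
rewrite -(@cauchy_transform_coef_eq (fun=> 1) z 1) //.
- by apply: eq_circle_mean => t; rewrite mul1r.
- by rewrite /fourier; under eq_circle_mean do rewrite expr0 mulr1; rewrite circle_mean_cst.
- move=> n n0; rewrite /fourier; under eq_circle_mean do rewrite mul1r.
  exact: circle_mean_circleN.
Qed.

(** Shrinking the circle to the point [a] leaves [f a] times the mean of the Cauchy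
    kernel, which is 1. *)
Lemma cauchy_formula (f : C -> C) (r : R) (a : C) :
  holomorphic_on_disk f -> r < 1 -> modulus a < r ->
  f a = cauchy_transform (fun t => f (of_real r * circle t)) (a / of_real r).
Proof.
move=> hf r1 ar.
have r0 : 0 < r := le_lt_trans (modulus_ge0 _) ar.
have rr0 : of_real r != 0 :> C by rewrite of_real_eq0 gt_eqF.
set z := a / of_real r.
have z1 : modulus z < 1.
  by rewrite modulusM modulusV modulus_real gtr0_norm// ltr_pdivrMr// mul1r.
have ck := continuous_cauchy_kernel z1.
pose w s t : C := a + of_real s * (of_real r * circle t - a).
have kerE t : Complex 0 1 * (of_real r * circle t) / (of_real r * circle t - a) =
    Complex 0 1 * cauchy_kernel z t.
  rewrite /cauchy_kernel -mulrA; congr (_ * _).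
  have d0 := cauchy_denom_neq0 t z1.
  have -> : of_real r * circle t - a = of_real r * circle t * (1 - z * circle (- t)).
    rewrite mulrBr mulr1 /z; congr (_ - _).
    rewrite mulrACA [of_real r * _]mulrCA mulfV// mulr1.
    by rewrite circleN mulr1.
  by rewrite invfM mulrA mulfV ?mul1r// mulf_neq0 ?circle_neq0.
have cfw s : 0 <= s <= 1 -> continuous (fun t => f (w s t)).
  move=> /andP[s0 s1] t.
  apply: (@continuous_comp _ _ _ (w s) f).
    apply: cvgD; first exact: cvg_cst.
    apply: cvgM; first exact: cvg_cst.
    apply: cvgB; last exact: cvg_cst.
    by apply: cvgM; [exact: cvg_cst|exact: continuous_circle].
  apply: (holomorphic_continuous hf); apply: le_lt_trans r1.
  have -> : w s t = of_real (1 - s) * a + of_real s * (of_real r * circle t).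
    by rewrite /w of_realB of_real1; ring.
  apply: (le_trans (modulusD _ _)).
  rewrite modulusM mulrA modulus_mul_circle modulusM !modulus_real.
  rewrite (ger0_norm s0) (gtr0_norm r0) ger0_norm ?subr_ge0//.
  have {2}-> : r = (1 - s) * r + s * r by ring.
  by rewrite lerD2r ler_wpM2l ?subr_ge0// ltW.
pose I s := circle_mean (fun t => f (w s t) * cauchy_kernel z t).
have iI s : 0 <= s <= 1 -> cintegrable T (fun t => f (w s t) * cauchy_kernel z t).
  move=> s01; apply: continuous_cintegrable.
  exact: (continuous_mulC (cfw s s01) ck).
have i0 : Complex 0 1 != 0 :> C.
  by rewrite -modulus_eq0 modulusE /= expr0n expr1n add0r sqrtr1 oner_eq0.
have IE e : 0 < e -> e <= 1 ->
    cauchy_transform (fun t => f (of_real r * circle t)) z = I e.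
  move=> e0 e1; congr (_ * _).
  have := contour_shrink hf r1 ar e0 e1.
  rewrite (@eq_cintegral _ _ _
    (fun t => Complex 0 1 * (f (of_real r * circle t) * cauchy_kernel z t))); last first.
    by move=> t _; rewrite kerE mulrCA.
  rewrite [RHS](@eq_cintegral _ _ _
    (fun t => Complex 0 1 * (f (w e t) * cauchy_kernel z t))); last first.
    by move=> t _; rewrite kerE mulrCA.
  rewrite !cintegralZ//; first exact: mulfI.
    by apply: iI; rewrite (ltW e0).
  have := iI 1; rewrite ler01 lexx => /(_ isT); apply: eq_cintegrable => // t _.
  by rewrite /w mul1r addrC subrK.
apply/eqP; rewrite eq_sym -subr_eq0 -modulus_eq0; apply/eqP/le_anti.
rewrite modulus_ge0 andbT.
apply/ler_addgt0Pl => e e0; rewrite addr0.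
have a1 : modulus a < 1 := lt_trans ar r1.
have k0 : 0 < 1 - modulus z by rewrite subr_gt0.
have e'0 : 0 < e * (1 - modulus z) by rewrite mulr_gt0.
have /(@cvgC R C (nbhs a))/(_ _ e'0)/nearC[d d0 hd] := holomorphic_continuous hf a1.
pose s := Num.min 1 (d / 4).
have s0 : 0 < s by rewrite lt_min ltr01 divr_gt0.
have s1 : s <= 1 by rewrite ge_min lexx.
have s01 : 0 <= s <= 1 by rewrite (ltW s0).
rewrite (IE s)// /I.
have {1}-> : f a = circle_mean (fun t => f a * cauchy_kernel z t).
  by rewrite circle_meanZ ?circle_mean_cauchy_kernel ?mulr1//; exact: continuous_cintegrable.
have ia : cintegrable T (fun t => f a * cauchy_kernel z t).
  by apply: cintegrableZ => //; exact: continuous_cintegrable.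
rewrite -circle_meanB//; last exact: iI.
apply: circle_mean_le_bound.
  by apply: cintegrableB => //; exact: iI.
move=> t; rewrite -mulrBl modulusM.
have -> : e = e * (1 - modulus z) * (1 - modulus z)^-1 by rewrite mulfK// gt_eqF.
apply: ler_pM; rewrite ?modulus_ge0//; last exact: cauchy_kernel_le.
rewrite ltW// modulusC; apply: hd.
rewrite /w addrC addKr modulusM modulus_real (gtr0_norm s0).
apply: (@le_lt_trans _ _ (s * 2)).
  rewrite ler_wpM2l ?(ltW s0)// (le_trans (modulusB _ _))//.
  rewrite modulus_mul_circle modulus_real (gtr0_norm r0).
  have -> : (2 : R) = 1 + 1 by ring.
  by rewrite lerD// ltW.
apply: (@le_lt_trans _ _ (d / 4 * 2)); first by rewrite ler_wpM2r// /s ge_min lexx orbT.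
have -> : d / 4 * 2 = d / 2 by field.
by rewrite ltr_pdivrMr// ltr_pMr// ltr1n.
Qed.

End CauchyTransform.

(** * Chain rules *)

Section ChainRules.
Context {R : realType}.
Local Notation C := (cplx R).
Implicit Types (f g : C -> C) (z w l m : C).

(** The estimate common to the chain rules in a complex and in a real variable. *)
Lemma chain_estimate f w l m : is_derive w (1 : C) f l ->
  forall e : R, 0 < e -> exists2 d : R, 0 < d & forall h k : C, modulus h < d ->
    modulus (k - m * h) <= d * modulus h ->
    modulus (f (w + k) - f w - l * m * h) <= e * modulus h.
Proof.
move=> /is_deriveC df e e0.
pose M := modulus m + 1; pose L := modulus l + 1.
have M0 : 0 < M by rewrite ltr_wpDl// modulus_ge0.
have L0 : 0 < L by rewrite ltr_wpDl// modulus_ge0.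
have e1 : 0 < e / 2 / M by rewrite !divr_gt0.
have [d1 d10 hd1] := df _ e1.
exists (Num.min (Num.min 1 (d1 / M)) (e / 2 / L)).
  by rewrite !lt_min ltr01 !divr_gt0.
move=> h k; rewrite !lt_min => /andP[/andP[h1 hM] hL] hk.
have hk1 : modulus (k - m * h) <= modulus h.
  apply: (le_trans hk); rewrite -[leRHS]mul1r ler_wpM2r ?modulus_ge0//.
  by rewrite !ge_min lexx.
have hk2 : modulus (k - m * h) <= e / 2 / L * modulus h.
  apply: (le_trans hk); rewrite ler_wpM2r ?modulus_ge0//.
  by rewrite !ge_min lexx !orbT.
have kM : modulus k <= M * modulus h.
  rewrite -[k](subrK (m * h)) (le_trans (modulusD _ _))// modulusM /M mulrDl mul1r.
  by rewrite addrC lerD2l.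
have kd : modulus k < d1.
  by rewrite (le_lt_trans kM)// mulrC -ltr_pdivlMr.
have -> : f (w + k) - f w - l * m * h = (f (w + k) - f w - l * k) + l * (k - m * h).
  by ring.
apply: (le_trans (modulusD _ _)).
have -> : e * modulus h = e / 2 / M * (M * modulus h) + L * (e / 2 / L * modulus h).
  by field; rewrite ?gt_eqF.
apply: lerD.
  by apply: (le_trans (hd1 _ kd)); rewrite ler_wpM2l ?(ltW e1).
rewrite modulusM ler_pM ?modulus_ge0//.
by rewrite /L lerDl.
Qed.

Lemma is_derive_compC f g z l m : is_derive (g z) (1 : C) f l -> is_derive z (1 : C) g m ->
  is_derive z (1 : C) (fun w => f (g w)) (l * m).
Proof.
move=> df /is_deriveC dg; apply/is_deriveC => e e0.
have [d d0 hd] := chain_estimate m df e0.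
have [d' d'0 hd'] := dg _ d0.
exists (Num.min d d'); first by rewrite lt_min d0.
move=> h; rewrite lt_min => /andP[h1 h2].
have := hd h (g (z + h) - g z) h1 (hd' _ h2).
by rewrite addrCA subrr addr0.
Qed.

Lemma is_derive_near f g z l (d : R) : 0 < d ->
  (forall w, modulus (w - z) < d -> f w = g w) ->
  is_derive z (1 : C) g l -> is_derive z (1 : C) f l.
Proof.
move=> d0 fg /is_deriveC dg; apply/is_deriveC => e e0.
have [d' d'0 hd'] := dg _ e0.
exists (Num.min d d'); first by rewrite lt_min d0.
move=> h; rewrite lt_min => /andP[h1 h2].
by rewrite !fg ?subrr ?modulus0// ?hd'// addrC addKr.
Qed.

(** The derivative of a complex function of a real variable, taken on its real and
    imaginary parts because the fundamental theorem of calculus is used in that form. *)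
Definition rderive (u : R -> C) (t : R) (l : C) :=
  is_derive t 1 (fun s : R => complex.Re (u s)) (complex.Re l) /\
  is_derive t 1 (fun s : R => complex.Im (u s)) (complex.Im l).

Lemma is_derive1P (u : R -> R) (t l : R) : is_derive t 1 u l <->
  forall e : R, 0 < e -> exists2 d : R, 0 < d & forall h : R, `|h| < d ->
    `|u (t + h) - u t - l * h| <= e * `|h|.
Proof.
split.
  move=> du e e0.
  have duz : derivable u t 1 by case: du.
  have -> : l = 'D_1 u t by rewrite derive_val.
  have /cvgrPdist_lt/(_ e e0) : h^-1 *: ((u \o shift t) (h *: (1 : R)) - u t)
    @[h --> (0 : R)^'] --> 'D_1 u t by exact: duz.
  rewrite /dnbhs /within /= => /nbhs_ballP[d /= d0 hd]; exists d => // h hh.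
  have [->|h0] := eqVneq h 0; first by rewrite addr0 subrr mulr0 subr0 normr0 mulr0.
  have := hd h; rewrite /ball /= sub0r normrN => /(_ hh h0).
  set q := 'D_1 u t.
  rewrite /GRing.scale /= mulr1 => H.
  have -> : u (t + h) - u t - q * h = - h * (q - h^-1 * (u (h + t) - u t)).
    by rewrite [h + t]addrC; field.
  by rewrite normrM normrN mulrC ler_wpM2r// ltW.
move=> H.
suff cv : h^-1 *: ((u \o shift t) (h *: (1 : R)) - u t) @[h --> (0 : R)^'] --> l.
  split; first by apply/cvg_ex; exists l.
  by apply: cvg_lim.
apply/cvgrPdist_lt => e e0.
have e20 : 0 < e / 2 by rewrite divr_gt0.
have [d d0 hd] := H _ e20.
apply/nbhs_ballP; exists d => // h; rewrite /ball /= sub0r normrN => hh h0.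
rewrite /GRing.scale /= mulr1.
have -> : l - h^-1 * (u (h + t) - u t) = - h^-1 * (u (t + h) - u t - l * h).
  by rewrite [h + t]addrC; field.
rewrite normrM normrN normfV mulrC ltr_pdivrMr ?normr_gt0//.
apply: (le_lt_trans (hd _ hh)); rewrite ltr_pM2r ?normr_gt0//.
by rewrite ltr_pdivrMr// ltr_pMr// ltr1n.
Qed.

Lemma rderiveP (u : R -> C) t l : rderive u t l <->
  forall e : R, 0 < e -> exists2 d : R, 0 < d & forall h : R, `|h| < d ->
    modulus (u (t + h) - u t - l * of_real h) <= e * `|h|.
Proof.
have reE h : complex.Re (u (t + h) - u t - l * of_real h) =
    complex.Re (u (t + h)) - complex.Re (u t) - complex.Re l * h.
  by rewrite !ReD !ReN ReM Re_real Im_real mulr0 subr0.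
have imE h : complex.Im (u (t + h) - u t - l * of_real h) =
    complex.Im (u (t + h)) - complex.Im (u t) - complex.Im l * h.
  by rewrite !ImD !ImN ImM Re_real Im_real mulr0 add0r.
split.
  move=> [/is_derive1P dr /is_derive1P di] e e0.
  have e20 : 0 < e / 2 by rewrite divr_gt0.
  have [d1 d10 h1] := dr _ e20.
  have [d2 d20 h2] := di _ e20.
  exists (Num.min d1 d2); first by rewrite lt_min d10.
  move=> h; rewrite lt_min => /andP[hh1 hh2].
  rewrite (le_trans (modulus_le_ReIm _))// reE imE (splitr e) mulrDl lerD//.
    exact: h1.
  exact: h2.
move=> H; split; apply/is_derive1P => e e0; have [d d0 hd] := H _ e0; exists d => // h /hd.
- by rewrite -reE; apply: le_trans; exact: Re_le_modulus.
- by rewrite -imE; apply: le_trans; exact: Im_le_modulus.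
Qed.

Lemma rderive_comp f (u : R -> C) t l m : is_derive (u t) (1 : C) f l -> rderive u t m ->
  rderive (fun s => f (u s)) t (l * m).
Proof.
move=> df /rderiveP du; apply/rderiveP => e e0.
have [d d0 hd] := chain_estimate m df e0.
have [d' d'0 hd'] := du _ d0.
exists (Num.min d d'); first by rewrite lt_min d0.
move=> h; rewrite lt_min => /andP[h1 h2].
have := hd (of_real h) (u (t + h) - u t).
by rewrite modulus_real addrCA subrr addr0 => /(_ h1 (hd' _ h2)).
Qed.

Lemma rderiveM (u v : R -> C) t l m : rderive u t l -> rderive v t m ->
  rderive (fun s => u s * v s) t (l * v t + u t * m).
Proof.
move=> [ur ui] [vr vi].
split.
- have := @is_deriveB R _ _ _ _ _ _ _ _ (is_deriveM ur vr) (is_deriveM ui vi).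
  rewrite (_ : (_ - _)%R = (fun s => complex.Re (u s * v s))); last first.
    by apply/funext => s; rewrite ReM.
  rewrite (_ : _ - _ = complex.Re (l * v t + u t * m)) => //.
  by rewrite ReD !ReM /GRing.scale /=; ring.
- have := @is_deriveD R _ _ _ _ _ _ _ _ (is_deriveM ur vi) (is_deriveM ui vr).
  rewrite (_ : (_ + _)%R = (fun s => complex.Im (u s * v s))); last first.
    by apply/funext => s; rewrite ImM.
  rewrite (_ : _ + _ = complex.Im (l * v t + u t * m)) => //.
  by rewrite ImD !ImM /GRing.scale /=; ring.
Qed.

Lemma rderive_cst c t : rderive (fun=> c) t 0.
Proof. by split; exact: is_derive_cst. Qed.

Lemma rderive_of_real t : rderive (@of_real R) t 1.
Proof. by split; [exact: is_derive_id|exact: is_derive_cst]. Qed.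

Lemma rderive_circle t : rderive (@circle R) t (Complex 0 1 * circle t).
Proof. exact: is_derive_circle. Qed.

Lemma rderive_circleM (x t : R) : rderive (fun s => circle (x * s)) t (Complex 0 x * circle (x * t)).
Proof. exact: is_derive_circleM. Qed.

End ChainRules.

(** * Derivatives of Cauchy transforms *)

Section HolomorphicTaylor.
Context {R : realType}.
Local Notation C := (cplx R).
Local Notation mu := (@lebesgue_measure R).
Local Notation T := `[0, 2 * pi : R]%classic.
Implicit Types (K L : R -> C) (c z w a h : C) (t r : R) (f : C -> C).

Lemma circle_mean_mul_bound K L (B : R) : cintegrable T K -> continuous L ->
  (forall t, modulus (L t) <= B) ->
  modulus (circle_mean (fun t => K t * L t)) <= B * real_circle_mean (fun t => modulus (K t)).
Proof.
move=> iK cL LB; have iKL := cintegrable_mulT iK cL.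
apply: (le_trans (le_modulus_circle_mean iKL)).
rewrite -real_circle_meanZ; last exact: integrable_modulus.
apply: le_real_circle_mean; first exact: integrable_modulus.
  by apply: rintegrableZ => //; exact: integrable_modulus.
by move=> t; rewrite modulusM mulrC ler_wpM2r ?modulus_ge0.
Qed.

(** Differentiation under the integral sign: a second-order remainder that is bounded
    uniformly on the circle replaces dominated convergence. *)
Lemma is_derive_circle_mean K (p : C -> R -> C) (dp : R -> C) z (d B : R) :
  cintegrable T K -> 0 < d ->
  (forall h, modulus h < d -> continuous (p (z + h))) -> continuous dp ->
  (forall h t, modulus h < d ->
     modulus (p (z + h) t - p z t - dp t * h) <= B * modulus h ^+ 2) ->
  is_derive z (1 : C) (fun w => circle_mean (fun t => K t * p w t))
    (circle_mean (fun t => K t * dp t)).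
Proof.
move=> iK d0 cp cdp rem.
have cpz : continuous (p z) by rewrite -[z]addr0; apply: cp; rewrite modulus0.
apply: (@is_deriveC_quadratic _ _ _ _ d (B * real_circle_mean (fun t => modulus (K t)))) => //.
move=> h hd.
have ip := cintegrable_mulT iK (cp h hd).
have ipz := cintegrable_mulT iK cpz.
have idp := cintegrable_mulT iK cdp.
rewrite -circle_meanB// mulrC -circle_meanZ// -circle_meanB//; last 2 first.
- exact: cintegrableB.
- exact: cintegrableZ.
under eq_circle_mean do rewrite mulrCA -!mulrBr.
have ch := continuous_mulC (@continuous_cstC R h) cdp.
have cc := continuous_subC (continuous_subC (cp h hd) cpz) ch.
rewrite [leRHS]mulrAC; apply: (circle_mean_mul_bound iK cc).
by move=> t; rewrite [h * _]mulrC; exact: rem.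
Qed.

Let near_disk z h : modulus z < 1 -> modulus h < (1 - modulus z) / 2 ->
  (1 - modulus z) / 2 <= 1 - modulus (z + h).
Proof.
move=> z1 hz; rewrite lerBrDr (le_trans (lerD (lexx _) (modulusD _ _)))//.
by rewrite addrA -lerBrDl; lra.
Qed.

Lemma cauchy_kernel_sub z w t : modulus z < 1 -> modulus w < 1 ->
  cauchy_kernel w t - cauchy_kernel z t =
  (w - z) * (circle (- t) * (cauchy_kernel z t * cauchy_kernel w t)).
Proof.
move=> z1 w1; have := cauchy_denom_neq0 t z1; have := cauchy_denom_neq0 t w1.
by rewrite /cauchy_kernel; move: (circle _) => u h1 h2; field; rewrite h1.
Qed.

Let cauchy_kernel_near z h t : modulus z < 1 -> modulus h < (1 - modulus z) / 2 ->
  modulus (cauchy_kernel (z + h) t) <= ((1 - modulus z) / 2)^-1.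
Proof.
move=> z1 hz; have nd := near_disk z1 hz.
have d0 : 0 < (1 - modulus z) / 2 by rewrite divr_gt0// subr_gt0.
have zh1 : modulus (z + h) < 1 by rewrite -subr_gt0 (lt_le_trans d0).
apply: (le_trans (cauchy_kernel_le t zh1)).
by rewrite lef_pV2// posrE subr_gt0.
Qed.

Lemma is_derive_cauchy_transform K z : cintegrable T K -> modulus z < 1 ->
  is_derive z (1 : C) (cauchy_transform K)
    (circle_mean (fun t => K t * (circle (- t) * cauchy_kernel z t ^+ 2))).
Proof.
move=> iK z1.
pose d := (1 - modulus z) / 2.
have d0 : 0 < d by rewrite divr_gt0// subr_gt0.
have h1 h : modulus h < d -> modulus (z + h) < 1.
  by move=> hd; rewrite -subr_gt0 (lt_le_trans d0)// near_disk.
apply: (@is_derive_circle_mean K cauchy_kernel _ z d (d^-1 ^+ 3) iK d0).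
- by move=> h hd; apply: continuous_cauchy_kernel; exact: h1.
- apply: (continuous_mulC (@continuous_circleN R)).
  exact: (@continuous_expC R _ 2 (continuous_cauchy_kernel z1)).
- move=> h t hd.
  have zz := cauchy_kernel_sub t z1 (h1 _ hd); rewrite [z + h - z]addrC addKr in zz.
  have -> : cauchy_kernel (z + h) t - cauchy_kernel z t -
      circle (- t) * cauchy_kernel z t ^+ 2 * h =
    h ^+ 2 * (circle (- t) ^+ 2 * (cauchy_kernel z t ^+ 2 * cauchy_kernel (z + h) t)).
    have -> : h ^+ 2 * (circle (- t) ^+ 2 * (cauchy_kernel z t ^+ 2 * cauchy_kernel (z + h) t))
      = h * circle (- t) * cauchy_kernel z t *
        (h * (circle (- t) * (cauchy_kernel z t * cauchy_kernel (z + h) t))) by ring.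
    by rewrite -zz mulrBr {1}zz; ring.
  rewrite modulusM modulusX mulrC ler_wpM2r ?sqr_ge0//.
  rewrite modulusM modulusX modulus_circle expr1n mul1r modulusM modulusX.
  have kz := @cauchy_kernel_near z 0 t z1; rewrite modulus0 addr0 in kz.
  by rewrite (exprSr _ 2) ler_pM ?exprn_ge0 ?modulus_ge0 ?lerXn2r ?nnegrE ?modulus_ge0
    ?invr_ge0 ?(ltW d0) ?kz// cauchy_kernel_near.
Qed.

Lemma derivable_cauchy_transform2 K z : cintegrable T K -> modulus z < 1 ->
  derivable (fun w : C => circle_mean (fun t => K t * (circle (- t) * cauchy_kernel w t ^+ 2)))
    z (1 : C).
Proof.
move=> iK z1.
pose d := (1 - modulus z) / 2.
have d0 : 0 < d by rewrite divr_gt0// subr_gt0.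
have h1 h : modulus h < d -> modulus (z + h) < 1.
  by move=> hd; rewrite -subr_gt0 (lt_le_trans d0)// near_disk.
suff : is_derive z (1 : C)
  (fun w : C => circle_mean (fun t => K t * (circle (- t) * cauchy_kernel w t ^+ 2)))
  (circle_mean (fun t => K t * (2 * (circle (- t) ^+ 2 * cauchy_kernel z t ^+ 3)))).
  by case.
apply: (@is_derive_circle_mean K (fun w t => circle (- t) * cauchy_kernel w t ^+ 2)
  _ z d (3 * d^-1 ^+ 4) iK d0).
- move=> h hd; apply: (continuous_mulC (@continuous_circleN R)).
  by apply: continuous_expC; apply: continuous_cauchy_kernel; exact: h1.
- apply: continuous_mulC; first exact: continuous_cstC.
  apply: (continuous_mulC (@continuous_expC R _ 2 (@continuous_circleN R))).
  exact: (@continuous_expC R _ 3 (continuous_cauchy_kernel z1)).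
- move=> h t hd.
  have zz := cauchy_kernel_sub t z1 (h1 _ hd); rewrite [z + h - z]addrC addKr in zz.
  set k' := cauchy_kernel (z + h) t; set k := cauchy_kernel z t.
  rewrite -/k -/k' in zz; set u := circle (- t) in zz *.
  have -> : u * k' ^+ 2 - u * k ^+ 2 - 2 * (u ^+ 2 * k ^+ 3) * h =
     h ^+ 2 * (u ^+ 3 * (k ^+ 2 * (k' * (k' + 2 * k)))).
    have -> : h ^+ 2 * (u ^+ 3 * (k ^+ 2 * (k' * (k' + 2 * k)))) =
      u * (h * u * k * (h * (u * (k * k'))) * (k' + 2 * k)) by ring.
    rewrite -zz.
    have e1 : u * k' ^+ 2 - u * k ^+ 2 = u * ((k' - k) * (k' + k)) by ring.
    by rewrite e1 {1}zz; ring.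
  rewrite modulusM modulusX mulrC ler_wpM2r ?sqr_ge0//.
  rewrite modulusM modulusX modulus_circle expr1n mul1r modulusM modulusX modulusM.
  have kz := @cauchy_kernel_near z 0 t z1; rewrite modulus0 addr0 in kz.
  have kz1 : modulus k <= d^-1 by exact: kz.
  have kz2 : modulus k' <= d^-1 by exact: cauchy_kernel_near.
  have -> : 3 * d^-1 ^+ 4 = d^-1 ^+ 2 * (d^-1 * (3 * d^-1)) by ring.
  have d'0 : 0 <= d^-1 by rewrite invr_ge0 ltW.
  apply: ler_pM; rewrite ?exprn_ge0 ?mulr_ge0 ?modulus_ge0//.
    by rewrite lerXn2r// nnegrE modulus_ge0.
  apply: ler_pM; rewrite ?modulus_ge0//.
  have -> : 3 * d^-1 = d^-1 + 2 * d^-1 by ring.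
  rewrite (le_trans (modulusD _ _))// lerD// modulusM.
  have -> : modulus (2 : C) = 2 by rewrite -of_real_nat modulus_real normr_nat.
  by rewrite ler_pM2l.
Qed.

Lemma holomorphic_is_derive f z : holomorphic_on_disk f -> modulus z < 1 ->
  is_derive z (1 : C) f (derive1 f z).
Proof.
move=> hf z1; rewrite derive1E; apply: derivableP.
by apply: hf; apply/unit_diskE.
Qed.

Lemma is_derive_derive1 f z l : is_derive z (1 : C) f l -> derive1 f z = l.
Proof. by move=> df; rewrite derive1E; exact: derive_val. Qed.

Lemma continuous_dilation f r : holomorphic_on_disk f -> 0 <= r < 1 ->
  continuous (fun t : R => f (of_real r * circle t)).
Proof.
move=> hf /andP[r0 r1] t.
apply: (@continuous_comp _ _ _ (fun t : R => of_real r * circle t) f).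
  by apply: cvgM; [exact: cvg_cst|exact: continuous_circle].
apply: (holomorphic_continuous hf).
by rewrite modulus_mul_circle modulus_real ger0_norm.
Qed.

Lemma modulus_div_real z r : 0 < r -> modulus (z / of_real r) = modulus z / r.
Proof. by move=> r0; rewrite modulusM modulusV modulus_real gtr0_norm. Qed.

Lemma holomorphic_derive_formula f r z : holomorphic_on_disk f -> r < 1 -> modulus z < r ->
  is_derive z (1 : C) f ((of_real r)^-1 * circle_mean (fun t => f (of_real r * circle t) *
     (circle (- t) * cauchy_kernel (z / of_real r) t ^+ 2))).
Proof.
move=> hf r1 zr; have r0 : 0 < r := le_lt_trans (modulus_ge0 _) zr.
have cK : cintegrable T (fun t => f (of_real r * circle t)).
  by apply: continuous_cintegrable; apply: continuous_dilation; rewrite ?(ltW r0).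
have zr1 : modulus (z / of_real r) < 1 by rewrite modulus_div_real// ltr_pdivrMr// mul1r.
apply: (@is_derive_near R _ (fun w => cauchy_transform (fun t => f (of_real r * circle t))
   (w / of_real r)) _ _ (r - modulus z)); first by rewrite subr_gt0.
  move=> w wz; apply: cauchy_formula => //.
  by rewrite -[w](subrK z) (le_lt_trans (modulusD _ _))// -ltrBrDr.
rewrite mulrC; apply: is_derive_compC; first exact: is_derive_cauchy_transform.
apply: (@is_deriveC_quadratic _ _ _ _ 1 0) => // h _.
have -> : (z + h) / of_real r - z / of_real r - (of_real r)^-1 * h = 0 by ring.
by rewrite modulus0 mul0r.
Qed.

(** Cauchy's formula presents [f] near [z] as a Cauchy transform, and these can be
    differentiated twice. *)
Lemma holomorphic_derive1 f : holomorphic_on_disk f -> holomorphic_on_disk (derive1 f).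
Proof.
move=> hf z /unit_diskE z1.
pose r := (1 + modulus z) / 2.
have r1 : r < 1 by rewrite /r; lra.
have zr : modulus z < r by rewrite /r; lra.
have r0 : 0 < r := le_lt_trans (modulus_ge0 _) zr.
have cK : cintegrable T (fun t => f (of_real r * circle t)).
  by apply: continuous_cintegrable; apply: continuous_dilation; rewrite ?(ltW r0).
have zr1 : modulus (z / of_real r) < 1 by rewrite modulus_div_real// ltr_pdivrMr// mul1r.
pose F (w : C) := circle_mean (fun t => f (of_real r * circle t) *
  (circle (- t) * cauchy_kernel w t ^+ 2)).
have /derivableP dF : derivable F (z / of_real r) (1 : C).
  exact: derivable_cauchy_transform2.
have scal c w : is_derive w (1 : C) (fun v => c * v) c.
  apply: (@is_deriveC_quadratic _ _ _ _ 1 0) => // h _.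
  have -> : c * (w + h) - c * w - c * h = 0 by ring.
  by rewrite modulus0 mul0r.
have dG : is_derive z (1 : C) (fun w => F (w / of_real r)) ('D_1 F (z / of_real r) * (of_real r)^-1).
  apply: is_derive_compC => //.
  by rewrite (_ : (fun w => w / of_real r) = fun w => (of_real r)^-1 * w)//; apply/funext => w; rewrite mulrC.
have dH := @is_derive_compC R _ (fun w => F (w / of_real r)) z _ _
  (scal (of_real r)^-1 (F (z / of_real r))) dG.
have rz : 0 < r - modulus z by rewrite subr_gt0.
suff : is_derive z (1 : C) (derive1 f) ((of_real r)^-1 * ('D_1 F (z / of_real r) * (of_real r)^-1)).
  by case.
apply: (is_derive_near rz _ dH).
move=> w wz; apply: is_derive_derive1; apply: holomorphic_derive_formula => //.
by rewrite -[w](subrK z) (le_lt_trans (modulusD _ _))// -ltrBrDr.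
Qed.

End HolomorphicTaylor.

(** * Taylor coefficients *)

Section TaylorParseval.
Context {R : realType}.
Local Notation C := (cplx R).
Local Notation mu := (@lebesgue_measure R).
Local Notation T := `[0, 2 * pi : R]%classic.
Implicit Types (K L : R -> C) (c z w a h : C) (t r : R) (f g : C -> C).

Lemma fourier_dilation0 f r : holomorphic_on_disk f -> 0 < r < 1 ->
  fourier (fun t => f (of_real r * circle t)) 0 = f 0.
Proof.
move=> hf /andP[r0 r1].
rewrite [RHS](cauchy_formula hf r1); last by rewrite modulus0.
apply: eq_circle_mean => t.
by rewrite expr0 /cauchy_kernel mul0r mul0r subr0 invr1.
Qed.

(** Integration by parts on the circle. *)
Lemma fourier_dilationS f r n : holomorphic_on_disk f -> 0 < r < 1 ->
  of_real r * fourier (fun t => derive1 f (of_real r * circle t)) n =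
  n.+1%:R * fourier (fun t => f (of_real r * circle t)) n.+1.
Proof.
move=> hf /andP[r0 r1]; have r01 : 0 <= r < 1 by rewrite ltW.
have cf := continuous_dilation hf r01.
have cdf := continuous_dilation (holomorphic_derive1 hf) r01.
set K : R -> C := fun t => derive1 f (of_real r * circle t).
set L := fun t => f (of_real r * circle t).
pose I : C := Complex 0 1.
have dL t : rderive L t (K t * (of_real r * (I * circle t))).
  apply: rderive_comp.
    apply: holomorphic_is_derive => //.
    by rewrite modulus_mul_circle modulus_real ger0_norm// ltW.
  have := rderiveM (rderive_cst (of_real r) t) (rderive_circle t).
  by rewrite mul0r add0r.
pose E t : C := circle (- n.+1%:R * t).
have dP t : rderive (fun t => L t * E t) t
  (of_real r * I * (K t * circle (- t) ^+ n) - I * n.+1%:R * (L t * circle (- t) ^+ n.+1)).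
  have := rderiveM (dL t) (rderive_circleM (- n.+1%:R) t).
  rewrite -/(E t) (_ : Complex 0 (- n.+1%:R) = - (I * n.+1%:R)); last first.
    by apply: eqC; rewrite ?ReN ?ImN ?ReM ?ImM -of_real_nat Re_real Im_real /=; ring.
  have -> : E t = circle (- t) ^+ n.+1 by rewrite circleN_exp.
  congr (rderive _ _ _); rewrite exprS.
  have -> : K t * (of_real r * (I * circle t)) * (circle (- t) * circle (- t) ^+ n) =
     of_real r * I * (K t * circle (- t) ^+ n) * (circle t * circle (- t)) by ring.
  by rewrite circleN mulr1; ring.
have iK := cintegrable_fourier n (@continuous_cintegrable R 0 (2 * pi) K cdf).
have iL := cintegrable_fourier n.+1 (@continuous_cintegrable R 0 (2 * pi) L cf).
have : cintegral T (fun t => of_real r * I * (K t * circle (- t) ^+ n) -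
    I * n.+1%:R * (L t * circle (- t) ^+ n.+1)) = 0.
  have -> : (0 : C) = L (2 * pi) * E (2 * pi) - L 0 * E 0.
    rewrite /L /E -[X in circle X]add0r circle_2pi.
    have -> : circle (- n.+1%:R * (2 * pi)) = 1 :> C.
      apply: (mulIf (circle_neq0 (n.+1%:R * (2 * pi)))).
      by rewrite -circleD mulNr addNr circle0 circle_mulpi mulr1.
    by rewrite mulr0 circle0 subrr.
  apply: (@cintegral_FTC R 0 (2 * pi) _ (fun t => L t * E t)).
  - exact/ltW/two_pi_gt0.
  - apply: continuous_subspaceT.
    apply: continuous_subC.
      apply: continuous_mulC; first exact: continuous_cstC.
      exact: (continuous_mulC cdf (@continuous_circleN_exp R n)).
    apply: continuous_mulC; first exact: continuous_cstC.
    exact: (continuous_mulC cf (@continuous_circleN_exp R n.+1)).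
  - by move=> t _; case: (dP t).
  - by move=> t _; case: (dP t).
rewrite cintegralB//; try exact: cintegrableZ.
rewrite !cintegralZ// => /eqP; rewrite subr_eq0 => /eqP E0.
have I0 : I != 0 by rewrite -modulus_eq0 modulusE /= expr0n expr1n add0r sqrtr1 oner_eq0.
apply: (mulfI I0); rewrite /fourier /circle_mean.
move: E0; move: (cintegral _ _) (cintegral _ _) => X Y E0.
have -> : I * (of_real r * (of_real (2 * pi)^-1 * Y)) = of_real (2 * pi)^-1 * (of_real r * I * Y).
  by ring.
by rewrite E0; ring.
Qed.

Lemma taylor_coef_derive1 f n : taylor_coef (derive1 f) n = n.+1%:R * taylor_coef f n.+1.
Proof.
rewrite /taylor_coef derive1Sn factS natrM invfM mulrCA; congr (_ * _).
by rewrite mulrA mulfV ?mul1r// pnatr_eq0.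
Qed.

Lemma fourier_dilation f r n : holomorphic_on_disk f -> 0 < r < 1 ->
  fourier (fun t => f (of_real r * circle t)) n = taylor_coef f n * of_real r ^+ n.
Proof.
elim: n f => [|n ih] f hf r01.
  by rewrite fourier_dilation0// expr0 mulr1 /taylor_coef /= fact0 divr1.
have n0 : n.+1%:R != 0 :> C by rewrite pnatr_eq0.
apply: (mulfI n0); rewrite -(fourier_dilationS n hf r01) (ih _ (holomorphic_derive1 hf) r01).
by rewrite taylor_coef_derive1 exprS; ring.
Qed.

Lemma eq_holomorphic f g : holomorphic_on_disk f -> (forall z, modulus z < 1 -> g z = f z) ->
  holomorphic_on_disk g.
Proof.
move=> hf gf z /unit_diskE z1.
suff : is_derive z (1 : C) g (derive1 f z) by case.
apply: (@is_derive_near R g f z _ (1 - modulus z)); first by rewrite subr_gt0.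
  move=> w wz; apply: gf; rewrite -[w](subrK z) (le_lt_trans (modulusD _ _))//.
  by rewrite -ltrBrDr.
exact: holomorphic_is_derive.
Qed.

(** Taylor coefficients are defined through derivatives of functions on the whole plane;
    being Fourier coefficients on a circle, they only depend on the values in the disk. *)
Lemma eq_taylor_coef f g n : holomorphic_on_disk f ->
  (forall z, modulus z < 1 -> g z = f z) -> taylor_coef g n = taylor_coef f n.
Proof.
move=> hf gf; have hg := eq_holomorphic hf gf.
have r0 : 0 < 2^-1 :> R by rewrite invr_gt0.
have r1 : 2^-1 < 1 :> R by rewrite invf_lt1// ltr1n.
have r01 : 0 < (2^-1 : R) < 1 by rewrite r0.
have rn0 : of_real (2^-1 : R) ^+ n != 0 :> C by rewrite expf_neq0// of_real_eq0 gt_eqF.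
apply: (mulIf rn0); rewrite -!fourier_dilation//.
apply: eq_circle_mean => t; congr (_ * _); apply: gf.
by rewrite modulus_mul_circle modulus_real gtr0_norm.
Qed.

Definition taylor_poly f N z : C := \sum_(n < N) taylor_coef f n * z ^+ n.

Lemma taylor_uniform f r : holomorphic_on_disk f -> 0 <= r < 1 ->
  exists B q : R, [/\ 0 <= B, 0 <= q, q < 1 & forall z N, modulus z <= r ->
    modulus (f z - taylor_poly f N z) <= q ^+ N * B].
Proof.
move=> hf /andP[r0 r1].
pose s := (1 + r) / 2.
have s0 : 0 < s by rewrite /s; lra.
have s1 : s < 1 by rewrite /s; lra.
have rs : r < s by rewrite /s; lra.
pose K t := f (of_real s * circle t).
have iK : cintegrable T K.
  by apply: continuous_cintegrable; apply: continuous_dilation => //; rewrite (ltW s0).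
pose A := real_circle_mean (fun t => modulus (K t)).
have A0 : 0 <= A by apply: real_circle_mean_ge0 => t; exact: modulus_ge0.
have q1 : r / s < 1 by rewrite ltr_pdivrMr// mul1r.
have q0 : 0 <= r / s by rewrite divr_ge0// ltW.
have q2 : 0 < 1 - r / s by rewrite subr_gt0.
exists ((1 - r / s)^-1 * A), (r / s); split => //.
  by rewrite mulr_ge0// invr_ge0 ltW.
move=> z N zr.
have zs : modulus z < s := le_lt_trans zr rs.
have zz : modulus (z / of_real s) <= r / s.
  by rewrite modulus_div_real// ler_pM2r// invr_gt0.
have z1 : modulus (z / of_real s) < 1 := le_lt_trans zz q1.
rewrite (cauchy_formula hf s1 zs).
have -> : taylor_poly f N z = \sum_(n < N) fourier K n * (z / of_real s) ^+ n.
  apply: eq_bigr => n _; rewrite fourier_dilation ?s0// expr_div_n mulrACA.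
  by rewrite mulfV ?mulr1// expf_neq0// of_real_eq0 gt_eqF.
apply: (le_trans (cauchy_transform_remainder N iK z1)).
apply: ler_pM; rewrite ?exprn_ge0 ?modulus_ge0//.
  by rewrite mulr_ge0// invr_ge0 subr_ge0 ltW.
  by rewrite lerXn2r// nnegrE modulus_ge0.
by rewrite ler_wpM2r// lef_pV2 ?posrE ?subr_gt0// lerD2l lerN2.
Qed.

End TaylorParseval.

(** * Parseval's identity *)

Section Parseval.
Context {R : realType}.
Local Notation C := (cplx R).
Local Notation mu := (@lebesgue_measure R).
Local Notation T := `[0, 2 * pi : R]%classic.
Implicit Types (K L : R -> C) (c z w a h : C) (t r : R) (f g : C -> C).

Definition conjC z : C := Complex (complex.Re z) (- complex.Im z).

Lemma modulus_conjC z : modulus (conjC z) = modulus z.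
Proof. by rewrite !modulusE /= sqrrN. Qed.

Lemma conjCM z w : conjC (z * w) = conjC z * conjC w.
Proof. by apply: eqC; rewrite /= ?ReM ?ImM /=; ring. Qed.

Lemma conjC_circle t : conjC (circle t) = circle (- t).
Proof. by apply: eqC; rewrite /= ?cosN ?sinN. Qed.

Lemma conjCX z n : conjC (z ^+ n) = conjC z ^+ n.
Proof.
elim: n => [|n ih]; first by apply: eqC; rewrite /= ?oppr0.
by rewrite !exprS conjCM ih.
Qed.

Lemma mul_conjC z : z * conjC z = of_real (modulus z ^+ 2).
Proof.
apply: eqC; rewrite ?ReM ?ImM /=; last by ring.
by rewrite sqr_modulus; ring.
Qed.

Lemma sqr_modulusB z w : modulus (z - w) ^+ 2 =
  modulus z ^+ 2 - 2 * complex.Re (z * conjC w) + modulus w ^+ 2.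
Proof. by rewrite !sqr_modulus ReM !ReD !ImD !ReN !ImN /=; ring. Qed.

Lemma rintegrable_continuous (u : R -> R) (a b : R) : continuous u ->
  mu.-integrable `[a, b] (EFin \o u).
Proof.
move=> cu; apply: continuous_compact_integrable; first exact: segment_compact.
exact: continuous_subspaceT.
Qed.

Lemma rintegrable_sqr_modulus K (a b : R) : continuous K ->
  mu.-integrable `[a, b] (EFin \o (fun t => modulus (K t) ^+ 2)).
Proof.
move=> cK; apply: rintegrable_continuous => t.
apply: cvgM; exact: (continuous_comp (cK t) (@continuous_modulus R _)).
Qed.

Lemma real_circle_meanD (u v : R -> R) : mu.-integrable T (EFin \o u) ->
  mu.-integrable T (EFin \o v) ->
  real_circle_mean (fun t => u t + v t) = real_circle_mean u + real_circle_mean v.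
Proof. by move=> iu iv; rewrite /real_circle_mean RintegralD// mulrDr. Qed.

Lemma eq_real_circle_mean (u v : R -> R) : u =1 v -> real_circle_mean u = real_circle_mean v.
Proof. by move=> uv; congr (_ * _); apply: eq_Rintegral => t _; exact: uv. Qed.

Lemma circle_mean_sqr_sub K (g : C) n : continuous K ->
  circle_mean (fun t => K t * circle (- t) ^+ n) = g ->
  real_circle_mean (fun t => modulus (K t - g * circle t ^+ n) ^+ 2) =
  real_circle_mean (fun t => modulus (K t) ^+ 2) - modulus g ^+ 2.
Proof.
move=> cK Kg.
have cKu : continuous (fun t => K t * circle (- t) ^+ n).
  exact: (continuous_mulC cK (@continuous_circleN_exp R n)).
have iKu := @continuous_cintegrable R 0 (2 * pi) _ cKu.
under eq_real_circle_mean => t.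
  rewrite sqr_modulusB conjCM conjCX conjC_circle mulrCA.
  rewrite modulusM modulusX modulus_circle expr1n mulr1.
  over.
have iRe : mu.-integrable T
   (EFin \o (fun t => complex.Re (conjC g * (K t * circle (- t) ^+ n)))).
  by case: (cintegrableZ (conjC g) (measurable_itv _) iKu).
have i1 := rintegrable_sqr_modulus 0 (2 * pi) cK.
have i2 : mu.-integrable T (EFin \o (fun t => (- 2) *
  complex.Re (conjC g * (K t * circle (- t) ^+ n)))) by exact: rintegrableZ.
have -> : real_circle_mean (fun t => modulus (K t) ^+ 2 -
     2 * complex.Re (conjC g * (K t * circle (- t) ^+ n)) + modulus g ^+ 2) =
   real_circle_mean (fun t => (modulus (K t) ^+ 2 +
     (- 2) * complex.Re (conjC g * (K t * circle (- t) ^+ n))) + modulus g ^+ 2).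
  by apply: eq_real_circle_mean => t; rewrite mulNr.
have i12 : mu.-integrable T (EFin \o (fun t => (modulus (K t) ^+ 2 +
     (- 2) * complex.Re (conjC g * (K t * circle (- t) ^+ n))))).
  exact: (integrableD _ i1 i2).
rewrite (real_circle_meanD i12 (rintegrable_cst _ _ _)) (real_circle_meanD i1 i2).
rewrite real_circle_meanZ// -Re_circle_mean circle_meanZ// Kg real_circle_mean_cst.
by rewrite mulrC [conjC g * g]mulrC mul_conjC Re_real; ring.
Qed.

Lemma continuous_taylor_poly f N r : continuous (fun t => taylor_poly f N (of_real r * circle t)).
Proof.
apply: (@continuous_sumC R N (fun n t => taylor_coef f n * (of_real r * circle t) ^+ n)) => n.
apply: continuous_mulC; first exact: continuous_cstC.
apply: continuous_expC; apply: continuous_mulC; first exact: continuous_cstC.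
exact: continuous_circle.
Qed.

Lemma circle_mean_remainder_coef f r N : holomorphic_on_disk f -> 0 < r < 1 ->
  circle_mean (fun t => (f (of_real r * circle t) - taylor_poly f N (of_real r * circle t)) *
     circle (- t) ^+ N) = taylor_coef f N * of_real r ^+ N.
Proof.
move=> hf r01.
have cf : continuous (fun t => f (of_real r * circle t)).
  by apply: continuous_dilation => //; case/andP: r01 => /ltW ->.
have cu := @continuous_circleN_exp R N.
pose G n t : C := taylor_coef f n * of_real r ^+ n * (circle t ^+ n * circle (- t) ^+ N).
have iG n : cintegrable T (G n).
  apply: continuous_cintegrable; apply: continuous_mulC; first exact: continuous_cstC.
  exact: (continuous_mulC (@continuous_expC R _ n (@continuous_circle R)) cu).
transitivity (circle_mean (fun t => f (of_real r * circle t) * circle (- t) ^+ N -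
   \sum_(n < N) G n t)).
  apply: eq_circle_mean => t; rewrite mulrBl; congr (_ - _).
  by rewrite mulr_suml; apply: eq_bigr => n _; rewrite exprMn /G !mulrA.
rewrite circle_meanB; last exact: cintegrable_sum.
  rewrite circle_mean_sum// big1 ?subr0.
    exact: fourier_dilation.
  move=> n _; rewrite circle_meanZ.
    have -> : circle_mean (fun t => circle t ^+ n * circle (- t) ^+ N) =
       circle_mean (fun t => circle (- t) ^+ (N - n)).
      apply: eq_circle_mean => t.
      have -> : circle (- t) ^+ N = circle (- t) ^+ n * circle (- t) ^+ (N - n) :> C.
        by rewrite -exprD subnKC// ltnW.
      rewrite mulrA.
      by rewrite -exprMn circleN expr1n mul1r.
    by rewrite circle_mean_circleN ?mulr0// subn_gt0.
  apply: continuous_cintegrable.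
  exact: (continuous_mulC (@continuous_expC R _ n (@continuous_circle R)) cu).
by apply: continuous_cintegrable; exact: (continuous_mulC cf cu).
Qed.

Lemma parseval_partial f r N : holomorphic_on_disk f -> 0 < r < 1 ->
  real_circle_mean (fun t => modulus
     (f (of_real r * circle t) - taylor_poly f N (of_real r * circle t)) ^+ 2) =
  real_circle_mean (fun t => modulus (f (of_real r * circle t)) ^+ 2) -
  \sum_(n < N) modulus (taylor_coef f n) ^+ 2 * (r ^+ 2) ^+ n.
Proof.
move=> hf r01.
have cf : continuous (fun t => f (of_real r * circle t)).
  by apply: continuous_dilation => //; case/andP: r01 => /ltW ->.
elim: N => [|N ih].
  rewrite big_ord0 subr0; apply: eq_real_circle_mean => t.
  by rewrite /taylor_poly big_ord0 subr0.
have cR := continuous_subC cf (@continuous_taylor_poly f N r).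
have := circle_mean_sqr_sub cR (circle_mean_remainder_coef N hf r01).
rewrite ih big_ord_recr /= opprD addrA.
have -> : modulus (taylor_coef f N * of_real r ^+ N) ^+ 2 =
    modulus (taylor_coef f N) ^+ 2 * (r ^+ 2) ^+ N.
  rewrite modulusM exprMn modulusX modulus_real ger0_norm.
    by rewrite -!exprM mulnC.
  by case/andP: r01 => /ltW.
move=> <-; apply: eq_real_circle_mean => t.
by rewrite /taylor_poly big_ord_recr /= opprD addrA exprMn mulrA.
Qed.

Lemma parseval_cvg f r : holomorphic_on_disk f -> 0 < r < 1 ->
  (\sum_(n < N) modulus (taylor_coef f n) ^+ 2 * (r ^+ 2) ^+ n) @[N --> \oo] -->
  real_circle_mean (fun t => modulus (f (of_real r * circle t)) ^+ 2).
Proof.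
move=> hf r01; have /andP[r0 r1] := r01.
have r0' : 0 <= r < 1 by rewrite ltW.
have cf := continuous_dilation hf r0'.
have [B [q [B0 q0 q1 Hq]]] := taylor_uniform hf r0'.
apply/cvgrPdist_le => e e0.
have q2 : q ^+ 2 < 1 by rewrite expr_lt1.
have [M hM] := exp_lt_eps (B ^+ 2) (sqr_ge0 q) q2 e0.
exists M => // N /= MN.
rewrite -parseval_partial//.
rewrite ger0_norm; last by apply: real_circle_mean_ge0 => t; rewrite sqr_ge0.
apply: le_trans (hM N MN).
rewrite -[leRHS]real_circle_mean_cst; apply: le_real_circle_mean.
- apply: rintegrable_sqr_modulus.
  exact: (continuous_subC cf (@continuous_taylor_poly f N r)).
- exact: rintegrable_cst.
- move=> t; rewrite -exprM mulnC exprM -exprMn.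
  rewrite lerXn2r ?nnegrE ?modulus_ge0 ?mulr_ge0 ?exprn_ge0//.
  by apply: Hq; rewrite modulus_mul_circle modulus_real gtr0_norm.
Qed.

(** By [parseval_partial] the partial sums miss the mean square by that of [f] minus its
    Taylor polynomial, which tends to 0 by uniform convergence on smaller disks. *)
Lemma parseval f r : holomorphic_on_disk f -> 0 < r < 1 ->
  (\sum_(0 <= n <oo) (modulus (taylor_coef f n) ^+ 2 * (r ^+ 2) ^+ n)%:E)%E =
  (real_circle_mean (fun t => modulus (f (of_real r * circle t)) ^+ 2))%:E.
Proof.
move=> hf r01; apply: cvg_lim => //.
under eq_fun do rewrite sumEFin big_mkord.
apply: cvg_EFin; first by near=> N.
exact: parseval_cvg.
Unshelve. all: by end_near. Qed.

End Parseval.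

(** * Products and primitives of holomorphic functions *)

Section Primitives.
Context {R : realType}.
Local Notation C := (cplx R).
Local Notation mu := (@lebesgue_measure R).
Local Notation I01 := `[0, 1 : R]%classic.
Implicit Types (K L : R -> C) (c z w a : C) (t r : R) (f g h : C -> C).

Lemma is_deriveMC f g z l m : is_derive z (1 : C) f l -> is_derive z (1 : C) g m ->
  is_derive z (1 : C) (fun w => f w * g w) (l * g z + f z * m).
Proof.
move=> df dg; have := is_deriveM df dg.
rewrite (_ : f z *: m + g z *: l = l * g z + f z * m)//.
by rewrite /GRing.scale /= addrC; congr (_ + _); rewrite mulrC.
Qed.

Lemma is_deriveDC f g z l m : is_derive z (1 : C) f l -> is_derive z (1 : C) g m ->
  is_derive z (1 : C) (fun w => f w + g w) (l + m).
Proof. by move=> df dg; have := is_deriveD df dg. Qed.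

Lemma is_derive_cstC c z : is_derive z (1 : C) (fun=> c) 0.
Proof. exact: is_derive_cst. Qed.

Lemma is_derive_idC z : is_derive z (1 : C) (fun w => w) 1.
Proof. exact: is_derive_id. Qed.

Lemma is_deriveXC f n z l : is_derive z (1 : C) f l ->
  is_derive z (1 : C) (fun w => f w ^+ n) (n%:R * f z ^+ n.-1 * l).
Proof.
move=> df; elim: n => [|n ih]; first by rewrite !mul0r; exact: is_derive_cstC.
under eq_fun do rewrite exprS.
have := is_deriveMC df ih.
rewrite (_ : l * f z ^+ n + f z * (n%:R * f z ^+ n.-1 * l) = n.+1%:R * f z ^+ n.+1.-1 * l)//.
rewrite /= -natr1; case: n {ih} => [|n] /=; first by rewrite !mul0r mulr0 addr0 expr0; ring.
by rewrite exprS; ring.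
Qed.

Lemma holomorphicM f g : holomorphic_on_disk f -> holomorphic_on_disk g ->
  holomorphic_on_disk (fun z => f z * g z).
Proof.
move=> hf hg z /unit_diskE z1.
by case: (is_deriveMC (holomorphic_is_derive hf z1) (holomorphic_is_derive hg z1)).
Qed.

Lemma holomorphicD f g : holomorphic_on_disk f -> holomorphic_on_disk g ->
  holomorphic_on_disk (fun z => f z + g z).
Proof.
move=> hf hg z /unit_diskE z1.
by case: (is_deriveDC (holomorphic_is_derive hf z1) (holomorphic_is_derive hg z1)).
Qed.

Lemma holomorphic_cst c : holomorphic_on_disk (fun=> c).
Proof. by move=> z _; case: (is_derive_cstC c z). Qed.

Lemma holomorphic_id : holomorphic_on_disk (fun z : C => z).
Proof. by move=> z _; case: (is_derive_idC z). Qed.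

Lemma holomorphicX f n : holomorphic_on_disk f -> holomorphic_on_disk (fun z => f z ^+ n).
Proof.
by move=> hf z /unit_diskE z1; case: (is_deriveXC n (holomorphic_is_derive hf z1)).
Qed.

Lemma holomorphic_bounded f r : holomorphic_on_disk f -> 0 <= r < 1 ->
  exists2 B : R, 0 <= B & forall z, modulus z <= r -> modulus (f z) <= B.
Proof.
move=> hf r01; have [B [q [B0 q0 q1 H]]] := taylor_uniform hf r01.
exists B => // z zr; have := H z 0%N zr.
by rewrite /taylor_poly big_ord0 subr0 expr0 mul1r.
Qed.

Let segment z w t : modulus z < 1 -> modulus w < 1 -> 0 <= t <= 1 ->
  modulus (z + of_real t * (w - z)) <= Num.max (modulus z) (modulus w).
Proof.
move=> z1 w1 /andP[t0 t1].
have -> : z + of_real t * (w - z) = of_real (1 - t) * z + of_real t * w.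
  by rewrite of_realB of_real1; ring.
apply: (le_trans (modulusD _ _)); rewrite !modulusM !modulus_real (ger0_norm t0).
rewrite ger0_norm ?subr_ge0//.
set M := Num.max _ _.
have -> : M = (1 - t) * M + t * M by ring.
by rewrite lerD// ler_wpM2l ?subr_ge0// /M le_max lexx ?orbT.
Qed.

Let continuous_segment f z w : holomorphic_on_disk f -> modulus z < 1 -> modulus w < 1 ->
  {within I01, continuous (fun t => f (z + of_real t * (w - z)))}.
Proof.
move=> hf z1 w1; apply: continuous_in_subspaceT => t; rewrite inE /= in_itv /= => t01.
apply: (@continuous_comp _ _ _ (fun t => z + of_real t * (w - z)) f).
  apply: cvgD; first exact: cvg_cst.
  by apply: cvgM; [exact: continuous_of_real|exact: cvg_cst].
apply: (holomorphic_continuous hf); apply: (le_lt_trans (segment z1 w1 t01)).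
by rewrite gt_max z1.
Qed.

Lemma segment_FTC f z w : holomorphic_on_disk f -> modulus z < 1 -> modulus w < 1 ->
  f w - f z = cintegral I01 (fun t => (w - z) * derive1 f (z + of_real t * (w - z))).
Proof.
move=> hf z1 w1.
have dP t : 0 <= t <= 1 -> rderive (fun s => f (z + of_real s * (w - z))) t
    ((w - z) * derive1 f (z + of_real t * (w - z))).
  move=> t01; rewrite mulrC; apply: rderive_comp.
    apply: (holomorphic_is_derive hf); apply: (le_lt_trans (segment z1 w1 t01)).
    by rewrite gt_max z1.
  apply/rderiveP => e e0; exists 1 => // h _.
  have -> : z + of_real (t + h) * (w - z) - (z + of_real t * (w - z)) - (w - z) * of_real h = 0.
    by rewrite of_realD; ring.
  by rewrite modulus0 mulr_ge0// ltW.
rewrite (_ : f w - f z = f (z + of_real 1 * (w - z)) - f (z + of_real 0 * (w - z))); last first.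
  by rewrite of_real1 mul1r mul0r addr0 [z + (w - z)]addrC subrK.
symmetry; apply: (@cintegral_FTC R 0 1 _ (fun t => f (z + of_real t * (w - z)))) => //.
- move=> t; apply: cvgM; first exact: cvg_cst.
  exact: (continuous_segment (holomorphic_derive1 hf) z1 w1).
- by move=> t /dP[].
- by move=> t /dP[].
Qed.

Lemma holomorphic_lipschitz f r : holomorphic_on_disk f -> 0 <= r < 1 ->
  exists2 B : R, 0 <= B & forall z w, modulus z <= r -> modulus w <= r ->
    modulus (f w - f z) <= B * modulus (w - z).
Proof.
move=> hf r01; have /andP[r0 r1] := r01.
have [B B0 hB] := holomorphic_bounded (holomorphic_derive1 hf) r01.
exists B => // z w zr wr.
have z1 := le_lt_trans zr r1; have w1 := le_lt_trans wr r1.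
rewrite segment_FTC//.
have -> : B * modulus (w - z) = B * modulus (w - z) * (1 - 0) by rewrite subr0 mulr1.
apply: cintegral_le_bound => //.
  apply: within_continuous_cintegrable => t; apply: cvgM; first exact: cvg_cst.
  exact: (continuous_segment (holomorphic_derive1 hf) z1 w1).
move=> t t01; rewrite modulusM mulrC ler_wpM2r ?modulus_ge0//.
by apply: hB; rewrite (le_trans (segment z1 w1 t01))// ge_max zr.
Qed.

Lemma holomorphic_quadratic f r : holomorphic_on_disk f -> 0 <= r < 1 ->
  exists2 B : R, 0 <= B & forall z w, modulus z <= r -> modulus w <= r ->
    modulus (f w - f z - derive1 f z * (w - z)) <= B * modulus (w - z) ^+ 2.
Proof.
move=> hf r01; have /andP[r0 r1] := r01.
have [B B0 hB] := holomorphic_lipschitz (holomorphic_derive1 hf) r01.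
exists B => // z w zr wr.
have z1 := le_lt_trans zr r1; have w1 := le_lt_trans wr r1.
rewrite segment_FTC//.
have -> : derive1 f z * (w - z) = cintegral I01 (fun=> (w - z) * derive1 f z).
  by rewrite cintegral_cst// subr0 of_real1 mul1r mulrC.
have -> : B * modulus (w - z) ^+ 2 = modulus (w - z) * (B * modulus (w - z)) * (1 - 0).
  by rewrite subr0 mulr1 expr2; ring.
apply: cintegral_near_le => //.
- apply: within_continuous_cintegrable => t; apply: cvgM; first exact: cvg_cst.
  exact: (continuous_segment (holomorphic_derive1 hf) z1 w1).
- by apply: continuous_cintegrable; exact: continuous_cstC.
- move=> t t01; have /andP[t0 t1] := t01.
  rewrite -mulrBr modulusM ler_wpM2l ?modulus_ge0//.
  have sr : modulus (z + of_real t * (w - z)) <= r.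
    by rewrite (le_trans (segment z1 w1 t01))// ge_max zr.
  apply: (le_trans (hB _ _ zr sr)); rewrite ler_wpM2l// addrC addKr.
  by rewrite modulusM modulus_real ger0_norm// -[leRHS]mul1r ler_wpM2r ?modulus_ge0.
Qed.

Lemma within_continuous_ray h z : holomorphic_on_disk h -> modulus z < 1 ->
  {within I01, continuous (fun t => h (of_real t * z))}.
Proof.
move=> hh z1.
have m0 : modulus (0 : C) < 1 by rewrite modulus0.
have := continuous_segment hh m0 z1.
rewrite (_ : (fun t => h (0 + of_real t * (z - 0))) = fun t => h (of_real t * z))//.
by apply/funext => t; rewrite add0r subr0.
Qed.

(** Differentiating under the integral sign gives the integral of
    [h (t z) + t z h' (t z)], the derivative of [t h (t z)] in [t]. *)
Lemma is_derive_primitive0 h z : holomorphic_on_disk h -> modulus z < 1 ->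
  is_derive z (1 : C) (primitive0 h) (h z).
Proof.
move=> hh z1.
have hh' := holomorphic_derive1 hh.
pose r := (1 + modulus z) / 2.
have zr : modulus z < r by rewrite /r; lra.
have r01 : 0 <= r < 1 by rewrite (le_trans (modulus_ge0 z) (ltW zr))/= /r; lra.
have [B B0 hB] := holomorphic_quadratic hh r01.
pose Q (w : C) := cintegral I01 (fun t => h (of_real t * w)).
pose D := cintegral I01 (fun t => of_real t * derive1 h (of_real t * z)).
have iD : cintegrable I01 (fun t => of_real t * derive1 h (of_real t * z)).
  apply: within_continuous_cintegrable => t.
  by apply: cvgM; [exact: (continuous_subspaceT (@continuous_of_real R))|exact: (within_continuous_ray hh' z1)].
have iQ w : modulus w < 1 -> cintegrable I01 (fun t => h (of_real t * w)).
  by move=> w1; apply: within_continuous_cintegrable; exact: within_continuous_ray.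
have dQ : is_derive z (1 : C) Q D.
  apply: (@is_deriveC_quadratic _ _ _ _ (r - modulus z) B); first by rewrite subr_gt0.
  move=> k hk.
  have zk : modulus (z + k) < r by rewrite (le_lt_trans (modulusD _ _))// -ltrBrDl.
  have zk1 : modulus (z + k) < 1 by apply: (lt_trans zk); case/andP: r01.
  rewrite /D mulrC -cintegralZ// /Q -cintegralB; [|by []|exact: iQ|exact: iQ].
  have -> : B * modulus k ^+ 2 = B * modulus k ^+ 2 * (1 - 0) by rewrite subr0 mulr1.
  apply: cintegral_near_le => //.
  - by apply: cintegrableB; [by []|exact: iQ|exact: iQ].
  - exact: cintegrableZ.
  - move=> t /andP[t0 t1].
    have tw (w : C) : modulus w < r -> modulus (of_real t * w) <= r.
      move=> wr; rewrite modulusM modulus_real ger0_norm// (le_trans _ (ltW wr))//.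
      by rewrite -[leRHS]mul1r ler_wpM2r ?modulus_ge0.
    have := hB _ _ (tw _ zr) (tw _ zk).
    have -> : of_real t * (z + k) - of_real t * z = of_real t * k by ring.
    rewrite (_ : derive1 h (of_real t * z) * (of_real t * k) =
      k * (of_real t * derive1 h (of_real t * z))); last by ring.
    move=> /le_trans; apply.
    rewrite ler_wpM2l// modulusM modulus_real ger0_norm// lerXn2r ?nnegrE ?mulr_ge0 ?modulus_ge0//.
    by rewrite -[leRHS]mul1r ler_wpM2r ?modulus_ge0.
have := is_deriveMC (is_derive_idC z) dQ.
suff -> : 1 * Q z + z * D = h z by [].
rewrite mul1r /D -cintegralZ// /Q -cintegralD; [|by []|exact: iQ|exact: cintegrableZ].
pose P t : C := of_real t * h (of_real t * z).
have -> : h z = P 1 - P 0 by rewrite /P of_real1 !mul1r mul0r subr0.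
have dP t : 0 <= t <= 1 -> rderive P t
   (h (of_real t * z) + z * (of_real t * derive1 h (of_real t * z))).
  move=> t01.
  have tz : modulus (of_real t * z) < 1.
    case/andP: t01 => t0 t1.
    rewrite modulusM modulus_real ger0_norm// (le_lt_trans _ z1)//.
    by rewrite -[leRHS]mul1r ler_wpM2r ?modulus_ge0.
  have dray : rderive (fun s => of_real s * z) t z.
    have := rderiveM (rderive_of_real t) (rderive_cst z t).
    by rewrite mul1r mulr0 addr0.
  have := rderiveM (rderive_of_real t) (rderive_comp (holomorphic_is_derive hh tz) dray).
  by rewrite mul1r [derive1 h _ * z]mulrC [of_real t * (z * _)]mulrCA.
apply: (@cintegral_FTC R 0 1 _ P) => //.
- move=> t; apply: cvgD; first exact: (within_continuous_ray hh z1).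
  apply: cvgM; first exact: cvg_cst.
  by apply: cvgM; [exact: (continuous_subspaceT (@continuous_of_real R))|exact: (within_continuous_ray hh' z1)].
- by move=> t /dP[].
- by move=> t /dP[].
Qed.

Lemma holomorphic_primitive0 h : holomorphic_on_disk h -> holomorphic_on_disk (primitive0 h).
Proof. by move=> hh z /unit_diskE z1; case: (is_derive_primitive0 hh z1). Qed.

Lemma derive1_primitive0 h z : holomorphic_on_disk h -> modulus z < 1 ->
  derive1 (primitive0 h) z = h z.
Proof. by move=> hh z1; apply: is_derive_derive1; exact: is_derive_primitive0. Qed.

Lemma primitive0_0 h : primitive0 h 0 = 0.
Proof. by rewrite /primitive0 mul0r. Qed.

Lemma taylor_coef_primitive0S h n : holomorphic_on_disk h ->
  n.+1%:R * taylor_coef (primitive0 h) n.+1 = taylor_coef h n.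
Proof.
move=> hh; rewrite -taylor_coef_derive1.
by apply: eq_taylor_coef => // z z1; exact: derive1_primitive0.
Qed.

Lemma taylor_coef0 f : taylor_coef f 0 = f 0.
Proof. by rewrite /taylor_coef /= fact0 divr1. Qed.

Lemma primitive0_linear (k g h : C -> C) c z : holomorphic_on_disk g ->
  holomorphic_on_disk h -> modulus z < 1 ->
  (forall w, modulus w < 1 -> k w = c * g w + h w) ->
  primitive0 k z = c * primitive0 g z + primitive0 h z.
Proof.
move=> hg hh z1 kE.
have i f : holomorphic_on_disk f -> cintegrable I01 (fun t => f (of_real t * z)).
  by move=> hf; apply: within_continuous_cintegrable; exact: within_continuous_ray.
rewrite /primitive0 mulrCA -mulrDr; congr (_ * _).
rewrite -cintegralZ//; last exact: i.
rewrite -cintegralD//; [|exact/cintegrableZ/i|exact: i].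
apply: eq_cintegral => t; rewrite inE /= in_itv /= => /andP[t0 t1]; apply: kE.
rewrite modulusM modulus_real ger0_norm// (le_lt_trans _ z1)//.
by rewrite -[leRHS]mul1r ler_wpM2r ?modulus_ge0.
Qed.

End Primitives.

(** * Comparing Hardy norms through derivatives *)

Section Comparison.
Context {R : realType}.
Local Notation C := (cplx R).
Local Notation mu := (@lebesgue_measure R).
Local Notation T := `[0, 2 * pi : R]%classic.
Local Open Scope ereal_scope.

Lemma nneseries_le (u : nat -> \bar R) (x : \bar R) : (forall n, 0 <= u n) ->
  (forall N, \sum_(0 <= i < N) u i <= x) -> \sum_(0 <= i <oo) u i <= x.
Proof.
move=> u0 ux; apply: lime_le; first by apply: is_cvg_nneseries => n _ _; exact: u0.
by near=> N; exact: ux.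
Unshelve. all: by end_near. Qed.

Lemma nneseries_shift_le (u : nat -> \bar R) : (forall n, 0 <= u n) ->
  \sum_(0 <= i <oo) u i.+1 <= \sum_(0 <= i <oo) u i.
Proof.
move=> u0; apply: nneseries_le => // N.
apply: le_trans (@nneseries_lim_ge R u xpredT 0%N N.+1 _); last by move=> n _ _; exact: u0.
by rewrite big_nat_recl// leeDr.
Qed.

Lemma measurable_funR_EFin (D : set R) (f : R -> R) : measurableR D -> continuous f ->
  @measurable_fun _ _ (measurableTypeR R) _ D (EFin \o f).
Proof.
move=> mD cf; apply/measurable_EFinP; apply: measurable_funTS.
exact: continuous_measurable_fun.
Qed.

Lemma real_circle_meanE (f : R -> R) : continuous f -> (forall t, 0 <= f t)%R ->
  (real_circle_mean f)%:E = ((2 * pi)^-1)%:E * \int[mu]_(t in T) (f t)%:E.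
Proof.
move=> cf f0; rewrite EFinM fineK//.
apply: integrable_fin_num => //; exact: rintegrable_continuous.
Qed.

(** Both sides are integrated over the interval from 0 to [y], term by term; this
    divides the n-th coefficient by n + 1. *)
Lemma nneseries_integrate (u v : nat -> \bar R) :
  (forall n, 0 <= u n) -> (forall n, 0 <= v n) ->
  (forall x : R, (0 < x < 1)%R ->
    \sum_(0 <= n <oo) (n.+1%:R * x ^+ n)%:E * u n <=
    \sum_(0 <= n <oo) (n.+1%:R * x ^+ n)%:E * v n) ->
  forall y : R, (0 < y < 1)%R ->
    \sum_(0 <= n <oo) (y ^+ n.+1)%:E * u n <= \sum_(0 <= n <oo) (y ^+ n.+1)%:E * v n.
Proof.
move=> u0 v0 uv y /andP[y0 y1].
have cp n : continuous (fun x : R => n.+1%:R * x ^+ n)%R.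
  move=> x; apply: cvgM; first exact: cvg_cst.
  exact: exprn_continuous.
have intE (w : nat -> \bar R) : (forall n, 0 <= w n) ->
    \int[mu]_(x in `]0%R, y[) \sum_(0 <= n <oo) (n.+1%:R * x ^+ n)%:E * w n =
    \sum_(0 <= n <oo) (y ^+ n.+1)%:E * w n.
  move=> w0; rewrite integral_nneseries //.
  - apply: eq_eseriesr => n _.
    rewrite ge0_integralZr//; first congr (_ * _); last 2 first.
    + by apply: measurable_funR_EFin.
    + by move=> x /=; rewrite in_itv/= => /andP[x0 _]; rewrite lee_fin mulr_ge0// exprn_ge0// ltW.
    transitivity (\int[mu]_(x in `[0%R, y]) (n.+1%:R * x ^+ n)%:E).
      symmetry; apply: integral_itv_bndoo; apply: measurable_funR_EFin => //; exact: cp.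
    have := @Rintegral_FTC R 0 y (fun x => n.+1%:R * x ^+ n)%R (fun x => x ^+ n.+1)%R (ltW y0).
    move=> /(_ (continuous_subspaceT (cp n))).
    have dX t : (0 <= t <= y)%R -> is_derive t (1%R : R) (fun x : R => x ^+ n.+1)%R (n.+1%:R * t ^+ n)%R.
      move=> _; have := @is_deriveX R _ id n.+1 t 1%R 1%R (is_derive_id _ _).
      by rewrite exprfctE /GRing.scale /= mulr1.
    move=> /(_ dX); rewrite expr0n subr0 => <-.
    by rewrite fineK//; apply: integrable_fin_num => //; exact: rintegrable_continuous.
  - move=> n; apply: emeasurable_funM; first by apply: measurable_funR_EFin.
    exact: measurable_cst.
  - move=> n x /=; rewrite in_itv/= => /andP[x0 _].
    by rewrite mule_ge0// lee_fin mulr_ge0// exprn_ge0// ltW.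
rewrite -!intE//; apply: ge0_le_integral => //.
- move=> x /=; rewrite in_itv/= => /andP[x0 _].
  apply: nneseries_ge0 => n _ _.
  by rewrite mule_ge0// lee_fin mulr_ge0// exprn_ge0// ltW.
- apply: ge0_emeasurable_sum => //.
  + move=> n x /=; rewrite in_itv/= => /andP[x0 _] _.
    by rewrite mule_ge0// lee_fin mulr_ge0// exprn_ge0// ltW.
  + move=> n _; apply: emeasurable_funM; first by apply: measurable_funR_EFin.
    exact: measurable_cst.
- apply: ge0_emeasurable_sum => //.
  + move=> n x /=; rewrite in_itv/= => /andP[x0 _] _.
    by rewrite mule_ge0// lee_fin mulr_ge0// exprn_ge0// ltW.
  + move=> n _; apply: emeasurable_funM; first by apply: measurable_funR_EFin.
    exact: measurable_cst.
- move=> x /=; rewrite in_itv/= => /andP[x0 xy]; apply: uv.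
  by rewrite x0 (lt_trans xy).
Qed.

Lemma nneseries_scaleS (w : nat -> \bar R) (y : R) : (forall n, 0 <= w n) -> (0 < y)%R ->
  \sum_(0 <= n <oo) (y ^+ n.+1)%:E * w n = y%:E * \sum_(0 <= n <oo) (y ^+ n)%:E * w n.
Proof.
move=> w0 y0; rewrite -nneseriesZl; last first.
  by move=> n _; rewrite mule_ge0// lee_fin exprn_ge0// ltW.
by apply: eq_eseriesr => n _; rewrite exprS EFinM muleA.
Qed.

(** Differentiating a power series multiplies the square of its n-th coefficient by
    [n ^ 2]; in the variable [x = r ^ 2] these factors are removed by integrating
    twice. *)
Lemma nneseries_weighted_le (p : nat -> R) (a : nat -> \bar R) (Q : \bar R) :
  (forall n, 0 <= p n)%R -> (forall n, 0 <= a n) ->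
  (forall x : R, (0 < x < 1)%R ->
    \sum_(0 <= n <oo) ((n.+1%:R ^+ 2 * p n.+1) * x ^+ n)%:E <=
    \sum_(0 <= n <oo) (n.+1%:R ^+ 2 * x ^+ n)%:E * a n.+1) ->
  (forall x : R, (0 < x < 1)%R -> \sum_(0 <= n <oo) (x ^+ n)%:E * a n <= Q) ->
  \sum_(0 <= n <oo) (p n.+1)%:E <= Q.
Proof.
move=> p0 a0 H HQ.
have s1 y : (0 < y < 1)%R ->
    \sum_(0 <= n <oo) (y ^+ n.+1)%:E * (n.+1%:R * p n.+1)%:E <=
    \sum_(0 <= n <oo) (y ^+ n.+1)%:E * (n.+1%:R%:E * a n.+1).
  apply: nneseries_integrate => [n|n|x x01].
  - by rewrite lee_fin mulr_ge0.
  - by rewrite mule_ge0.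
  - have := H x x01; under eq_eseriesr => n _.
      rewrite (_ : (n.+1%:R ^+ 2 * p n.+1 * x ^+ n)%:E =
        (n.+1%:R * x ^+ n)%:E * (n.+1%:R * p n.+1)%:E); last first.
        by rewrite -EFinM; congr EFin; ring.
      over.
    move=> /le_trans; apply; apply: lee_nneseries => [n _ _|n _].
      by rewrite mule_ge0// lee_fin mulr_ge0 ?exprn_ge0//; case/andP: x01 => /ltW.
    rewrite muleA -EFinM (_ : (n.+1%:R * x ^+ n * n.+1%:R = n.+1%:R ^+ 2 * x ^+ n)%R)//.
    by ring.
have s2 y : (0 < y < 1)%R ->
    \sum_(0 <= n <oo) (y ^+ n.+1)%:E * (p n.+1)%:E <=
    \sum_(0 <= n <oo) (y ^+ n.+1)%:E * a n.+1.
  apply: nneseries_integrate => [n|n|x x01]; [by rewrite lee_fin|by []|].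
  have x0 : (0 < x)%R by case/andP: x01.
  have := s1 x x01; rewrite !nneseries_scaleS//; last 2 first.
  - by move=> n; rewrite mule_ge0.
  - by move=> n; rewrite lee_fin mulr_ge0.
  rewrite lee_pmul2l// => h.
  apply: le_trans (le_trans h _); apply: lee_nneseries => [n _ _|n _].
  + by rewrite mule_ge0// ?lee_fin// mulr_ge0// exprn_ge0// ltW.
  + by rewrite -!EFinM lee_fin; rewrite le_eqVlt; apply/orP; left; apply/eqP; ring.
  + by rewrite !mule_ge0// lee_fin// exprn_ge0// ltW.
  + by rewrite muleA -EFinM mulrC.
have s3 (y : R) N : (0 < y < 1)%R -> (\sum_(0 <= n < N) y ^+ n.+1 * p n.+1)%:E <= Q.
  move=> y01; apply: le_trans (HQ y y01); have /andP[y0 _] := y01.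
  apply: le_trans (nneseries_shift_le _); last first.
    by move=> n; rewrite mule_ge0// lee_fin exprn_ge0// ltW.
  apply: le_trans (s2 y y01).
  rewrite -sumEFin; under eq_bigr do rewrite EFinM.
  apply: nneseries_lim_ge => n _ _.
  by rewrite mule_ge0// lee_fin// exprn_ge0// ltW.
apply: nneseries_le => [n|N]; first by rewrite lee_fin.
move: s3; case: Q {HQ} => [q| |] s3; [|by rewrite leey|]; last first.
  have h01 : (0 < (2^-1 : R) < 1)%R by rewrite invr_gt0 ltr0n /= invf_lt1// ltr1n.
  by have := s3 _ 0%N h01; rewrite leeNy_eq.
rewrite sumEFin lee_fin.
have cvN : (\sum_(0 <= n < N) y ^+ n.+1 * p n.+1)%R @[y --> (1 : R)^'-] -->
    (\sum_(0 <= n < N) p n.+1)%R.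
  have -> : (\sum_(0 <= n < N) p n.+1 = \sum_(0 <= n < N) 1 ^+ n.+1 * p n.+1)%R.
    by apply: eq_bigr => n _; rewrite expr1n mul1r.
  apply: cvg_at_left_filter.
  elim: N => [|N ih].
    by rewrite big_geq//; under eq_fun do rewrite big_geq//; exact: cvg_cst.
  rewrite big_nat_recr//=; under eq_fun do rewrite big_nat_recr//=.
  apply: cvgD => //; apply: cvgM; last exact: cvg_cst.
  exact: exprn_continuous.
rewrite -(cvg_lim _ cvN)//; apply: limr_le; first by apply/cvg_ex; eexists; exact: cvN.
near=> y; rewrite -lee_fin; apply: s3.
by apply/andP; split; near: y; [exact: nbhs_left_gt|exact: nbhs_left_lt].
Unshelve. all: by end_near. Qed.

Lemma circle_mean_nneseries (u : nat -> R -> R) : (forall k, continuous (u k)) ->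
  (forall k t, 0 <= u k t)%R ->
  \sum_(0 <= k <oo) (real_circle_mean (u k))%:E =
  ((2 * pi)^-1)%:E * \int[mu]_(t in T) \sum_(0 <= k <oo) (u k t)%:E.
Proof.
move=> cu u0; rewrite integral_nneseries//; last 2 first.
- by move=> k; apply: measurable_funR_EFin.
- by move=> k t _; rewrite lee_fin.
rewrite -nneseriesZl; last by move=> k _; apply: integral_ge0 => t _; rewrite lee_fin.
by apply: eq_eseriesr => k _; rewrite real_circle_meanE.
Qed.

Lemma measurable_circle_nneseries (u : nat -> R -> R) : (forall k, continuous (u k)) ->
  (forall k t, 0 <= u k t)%R ->
  @measurable_fun _ _ (measurableTypeR R) _ T (fun t => \sum_(0 <= k <oo) (u k t)%:E).
Proof.
move=> cu u0; apply: ge0_emeasurable_sum => //.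
- by move=> k t _ _; rewrite lee_fin.
- by move=> k _; apply: measurable_funR_EFin.
Qed.

Lemma continuous_sqr_modulus (K : R -> C) : continuous K ->
  continuous (fun t => modulus (K t) ^+ 2)%R.
Proof.
move=> cK t; apply: cvgM; exact: (continuous_comp (cK t) (@continuous_modulus R _)).
Qed.

Lemma parseval_weighted (G : nat -> C -> C) (w : nat -> R) (r : R) :
  (forall k, holomorphic_on_disk (G k)) -> (forall k, 0 <= w k)%R -> (0 < r < 1)%R ->
  ((2 * pi)^-1)%:E * \int[mu]_(t in T)
     \sum_(0 <= k <oo) (w k * modulus (G k (of_real r * circle t)%R) ^+ 2)%:E =
  \sum_(0 <= n <oo) ((r ^+ 2) ^+ n)%:E *
     \sum_(0 <= k <oo) (w k * modulus (taylor_coef (G k) n) ^+ 2)%:E.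
Proof.
move=> hG w0 r01; have r01' : (0 <= r < 1)%R by case/andP: r01 => /ltW ->.
have cG k : continuous (fun t => modulus (G k (of_real r * circle t)) ^+ 2)%R.
  exact: (continuous_sqr_modulus (continuous_dilation (hG k) r01')).
have cwG k : continuous (fun t => w k * modulus (G k (of_real r * circle t)) ^+ 2)%R.
  by move=> t; apply: cvgM; [exact: cvg_cst|exact: cG].
rewrite -(circle_mean_nneseries cwG); last by move=> k t; rewrite mulr_ge0// sqr_ge0.
transitivity (\sum_(0 <= k <oo) \sum_(0 <= n <oo)
    ((r ^+ 2) ^+ n * (w k * modulus (taylor_coef (G k) n) ^+ 2))%:E).
  apply: eq_eseriesr => k _.
  rewrite real_circle_meanZ; last exact: rintegrable_continuous.
  rewrite EFinM -(parseval (hG k) r01) -nneseriesZl; last first.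
    by move=> n _; rewrite lee_fin mulr_ge0// ?sqr_ge0// exprn_ge0// sqr_ge0.
  by apply: eq_eseriesr => n _; rewrite -EFinM; congr EFin; ring.
rewrite nneseries_interchange; last first.
  move=> k n; rewrite lee_fin; apply: mulr_ge0; first by rewrite exprn_ge0// sqr_ge0.
  by rewrite mulr_ge0// sqr_ge0.
apply: eq_eseriesr => n _; rewrite -nneseriesZl; last first.
  by move=> k _; rewrite lee_fin mulr_ge0// sqr_ge0.
by apply: eq_eseriesr => k _; rewrite EFinM.
Qed.

(** A pointwise comparison of derivatives and one of functions, in opposite directions,
    combine into a comparison of norms: Parseval's identity turns both into inequalities
    between power series in the square of the radius. *)
Lemma hardy_comparison (F f : C -> C) (G : nat -> C -> C) (w : nat -> R) (c : R) :
  holomorphic_on_disk F -> holomorphic_on_disk f -> (forall k, holomorphic_on_disk (G k)) ->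
  (forall k, 0 <= w k)%R -> (0 <= c)%R -> F 0%R = 0%R ->
  (forall z, (modulus z < 1)%R -> (modulus (derive1 F z) ^+ 2)%:E <=
     \sum_(0 <= k <oo) (w k * modulus (derive1 (G k) z) ^+ 2)%:E) ->
  (forall z, (modulus z < 1)%R ->
     \sum_(0 <= k <oo) (w k * modulus (G k z) ^+ 2)%:E <= (c * modulus (f z) ^+ 2)%:E) ->
  \sum_(0 <= n <oo) (modulus (taylor_coef F n) ^+ 2)%:E <=
  c%:E * \sum_(0 <= n <oo) (modulus (taylor_coef f n) ^+ 2)%:E.
Proof.
move=> hF hf hG w0 c0 F0 dFG Gf.
pose p n := (modulus (taylor_coef F n) ^+ 2)%R.
pose a n := \sum_(0 <= k <oo) (w k * modulus (taylor_coef (G k) n) ^+ 2)%:E.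
have p0 n : (0 <= p n)%R by rewrite sqr_ge0.
have wm0 k (z : C) : 0 <= (w k * modulus z ^+ 2)%:E by rewrite lee_fin mulr_ge0// sqr_ge0.
have a0 n : 0 <= a n by apply: nneseries_ge0 => k _ _.
have disk (r t : R) : (0 < r < 1)%R -> (modulus (of_real r * circle t : C) < 1)%R.
  by move=> /andP[r0 r1]; rewrite modulus_mul_circle modulus_real gtr0_norm.
have sq (x : R) : (0 < x < 1)%R -> exists2 r, (0 < r < 1)%R & (x = r ^+ 2)%R.
  move=> /andP[x0 x1]; exists (Num.sqrt x); last by rewrite sqr_sqrtr// ltW.
  by rewrite sqrtr_gt0 x0/= -sqrtr1 ltr_sqrt.
have H1 (x : R) : (0 < x < 1)%R ->
    \sum_(0 <= n <oo) ((n.+1%:R ^+ 2 * p n.+1) * x ^+ n)%:E <=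
    \sum_(0 <= n <oo) (n.+1%:R ^+ 2 * x ^+ n)%:E * a n.+1.
  move=> /sq[r r01 ->]; have r01' : (0 <= r < 1)%R by case/andP: r01 => /ltW ->.
  have hF' := holomorphic_derive1 hF.
  have -> : \sum_(0 <= n <oo) ((n.+1%:R ^+ 2 * p n.+1) * (r ^+ 2) ^+ n)%:E =
      \sum_(0 <= n <oo) (modulus (taylor_coef (derive1 F) n) ^+ 2 * (r ^+ 2) ^+ n)%:E.
    apply: eq_eseriesr => n _; congr (_ * _)%:E.
    by rewrite taylor_coef_derive1 modulusM -of_real_nat modulus_real normr_nat exprMn.
  have -> : \sum_(0 <= n <oo) (n.+1%:R ^+ 2 * (r ^+ 2) ^+ n)%:E * a n.+1 =
      \sum_(0 <= n <oo) ((r ^+ 2) ^+ n)%:E *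
     \sum_(0 <= k <oo) (w k * modulus (taylor_coef (derive1 (G k)) n) ^+ 2)%:E.
    apply: eq_eseriesr => n _; rewrite mulrC EFinM -muleA; congr (_ * _).
    rewrite -nneseriesZl => [|k _]; last exact: wm0.
    apply: eq_eseriesr => k _; rewrite taylor_coef_derive1 modulusM -of_real_nat.
    by rewrite modulus_real normr_nat exprMn -EFinM mulrCA.
  have hG' k := holomorphic_derive1 (hG k).
  rewrite (parseval hF' r01) -(parseval_weighted hG' w0 r01).
  have cF : continuous (fun t => modulus (derive1 F (of_real r * circle t)) ^+ 2)%R.
    exact: (continuous_sqr_modulus (continuous_dilation hF' r01')).
  rewrite real_circle_meanE//; last by move=> t; rewrite sqr_ge0.
  rewrite lee_pmul2l ?lte_fin ?invr_gt0 ?two_pi_gt0//.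
  apply: ge0_le_integral => //.
  - by move=> t _; rewrite lee_fin sqr_ge0.
  - exact: measurable_funR_EFin.
  - apply: measurable_circle_nneseries; last by move=> k t; rewrite -lee_fin; exact: wm0.
    move=> k t; apply: cvgM; first exact: cvg_cst.
    exact: (continuous_sqr_modulus (continuous_dilation (hG' k) r01')).
  - by move=> t _; apply: dFG; exact: disk.
have H2 (x : R) : (0 < x < 1)%R -> \sum_(0 <= n <oo) (x ^+ n)%:E * a n <=
    c%:E * \sum_(0 <= n <oo) (modulus (taylor_coef f n) ^+ 2)%:E.
  move=> /sq[r r01 ->]; have r01' : (0 <= r < 1)%R by case/andP: r01 => /ltW ->.
  rewrite -(parseval_weighted hG w0 r01).
  have cf : continuous (fun t => modulus (f (of_real r * circle t)) ^+ 2)%R.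
    exact: (continuous_sqr_modulus (continuous_dilation hf r01')).
  have ccf : continuous (fun t => c * modulus (f (of_real r * circle t)) ^+ 2)%R.
    by move=> t; apply: cvgM; [exact: cvg_cst|exact: cf].
  apply: (@le_trans _ _ ((2 * pi)^-1%:E *
      \int[mu]_(t in T) (c * modulus (f (of_real r * circle t)) ^+ 2)%:E)).
    rewrite lee_pmul2l ?lte_fin ?invr_gt0 ?two_pi_gt0//.
    apply: ge0_le_integral => //.
    - by move=> t _; apply: nneseries_ge0 => k _ _; exact: wm0.
    - apply: measurable_circle_nneseries; last by move=> k t; rewrite -lee_fin; exact: wm0.
      move=> k t; apply: cvgM; first exact: cvg_cst.
      exact: (continuous_sqr_modulus (continuous_dilation (hG k) r01')).
    - exact: measurable_funR_EFin.
    - by move=> t _; apply: Gf; exact: disk.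
  rewrite -real_circle_meanE//; last by move=> t; rewrite mulr_ge0// sqr_ge0.
  rewrite real_circle_meanZ; last exact: rintegrable_continuous.
  rewrite EFinM lee_wpmul2l ?lee_fin// -(parseval hf r01).
  apply: lee_nneseries => [n _ _|n _]; rewrite lee_fin.
    by rewrite mulr_ge0 ?sqr_ge0// exprn_ge0// sqr_ge0.
  rewrite -[leRHS]mulr1 ler_wpM2l ?sqr_ge0// exprn_ile1 ?sqr_ge0//.
  by case/andP: r01 => r0 r1; rewrite expr_le1// ltW.
have := nneseries_weighted_le p0 a0 H1 H2.
apply: le_trans.
rewrite [leLHS](nneseries_recl (P := xpredT)) //; last first.
  by move=> n _; rewrite lee_fin sqr_ge0.
rewrite taylor_coef0 F0 modulus0 expr0n add0e.
rewrite -(@nneseries_addn R (fun n => (modulus (taylor_coef F n) ^+ 2)%:E) 1) => [|n].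
  by under eq_eseriesr => n _ do rewrite addn1.
by rewrite lee_fin sqr_ge0.
Qed.

End Comparison.

(** * The complex exponential and Poisson weights *)

Section Exponential.
Context {R : realType}.
Local Notation C := (cplx R).
Implicit Types (z w h : C) (x y t : R).

Definition cexp z : C := of_real (expR (complex.Re z)) * circle (complex.Im z).

Lemma cexpD z w : cexp (z + w) = cexp z * cexp w.
Proof. by rewrite /cexp ReD ImD expRD circleD of_realM; ring. Qed.

Lemma modulus_cexp z : modulus (cexp z) = expR (complex.Re z).
Proof. by rewrite modulus_mul_circle modulus_real gtr0_norm// expR_gt0. Qed.

(** By additivity it suffices to differentiate at 0, where the real exponential and the
    circle map contribute separately. *)
Lemma is_derive_cexp z : is_derive z (1 : C) cexp (cexp z).
Proof.
have d0 : forall e : R, 0 < e -> exists2 d : R, 0 < d & forall h, modulus h < d ->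
    modulus (cexp h - 1 - h) <= e * modulus h.
  move=> e e0; have e3 : 0 < e / 3 by rewrite divr_gt0.
  have /is_derive1P/(_ _ e3)[d1 d10 h1] := @is_derive_expR R 0.
  have /rderiveP/(_ _ e3)[d2 d20 h2] := rderive_circle (0 : R).
  exists (Num.min (Num.min d1 d2) (e / 3)); first by rewrite !lt_min d10 d20.
  move=> h; rewrite !lt_min => /andP[/andP[hd1 hd2] he].
  set x := complex.Re h; set y := complex.Im h.
  have hx : `|x| <= modulus h := Re_le_modulus h.
  have hy : `|y| <= modulus h := Im_le_modulus h.
  have hE : h = of_real x + Complex 0 1 * of_real y.
    by apply: eqC; rewrite ?ReD ?ImD ?ReM ?ImM /=; ring.
  have -> : cexp h - 1 - h = of_real (expR x - 1 - x) * circle y +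
     (circle y - 1 - Complex 0 1 * of_real y) + of_real x * (circle y - 1).
    by rewrite {2}hE /cexp -/x -/y !of_realB of_real1; ring.
  have -> : e * modulus h = e / 3 * modulus h + e / 3 * modulus h + modulus h * (e / 3).
    by field.
  apply: (le_trans (modulusD _ _)); rewrite lerD//.
    apply: (le_trans (modulusD _ _)); rewrite lerD//.
      rewrite modulus_mul_circle modulus_real.
      have := h1 x (le_lt_trans hx hd1); rewrite add0r expR0 mul1r => /le_trans; apply.
      by rewrite ler_wpM2l// ltW.
    have := h2 y (le_lt_trans hy hd2); rewrite add0r circle0 mulr1 => /le_trans; apply.
    by rewrite ler_wpM2l// ltW.
  rewrite modulusM modulus_real ler_pM ?modulus_ge0//.
  have := @circle_lipschitz R 0 y; rewrite circle0 subr0 => /le_trans; apply.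
  by rewrite (le_trans hy)// ltW.
apply/is_deriveC => e e0.
pose M := modulus (cexp z).
have M0 : 0 < M by rewrite /M modulus_cexp expR_gt0.
have [d dd hd] := d0 _ (divr_gt0 e0 M0).
exists d => // h hh; rewrite cexpD.
have -> : cexp z * cexp h - cexp z - cexp z * h = cexp z * (cexp h - 1 - h) by ring.
rewrite modulusM -/M (le_trans (ler_wpM2l (ltW M0) (hd _ hh)))//.
by rewrite mulrA [M * _]mulrC divfK// gt_eqF.
Qed.

Lemma holomorphic_cexp (f : C -> C) : holomorphic_on_disk f ->
  holomorphic_on_disk (fun z => cexp (f z)).
Proof.
move=> hf z /unit_diskE z1.
by case: (is_derive_compC (is_derive_cexp (f z)) (holomorphic_is_derive hf z1)).
Qed.

Lemma cvg_exp_series x : series (exp_coeff x) @ \oo --> expR x.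
Proof. exact: is_cvg_series_exp_coeff. Qed.

Lemma eseries_EFin (u : nat -> R) (l : R) : (\sum_(k < N) u k) @[N --> \oo] --> l ->
  (\sum_(0 <= k <oo) (u k)%:E)%E = l%:E.
Proof.
move=> ul; apply: cvg_lim => //.
under eq_fun do rewrite sumEFin big_mkord.
by apply: cvg_EFin => //; near=> N.
Unshelve. all: by end_near. Qed.

Lemma nneseries_exp (c x : R) :
  (\sum_(0 <= k <oo) ((k`!%:R)^-1 * (c * x ^+ k))%:E)%E = (c * expR x)%:E.
Proof.
apply: eseries_EFin.
have -> : (fun N => \sum_(k < N) (k`!%:R)^-1 * (c * x ^+ k)) =
    (fun N => c * series (exp_coeff x) N).
  apply/funext => N; rewrite /series /= big_mkord mulr_sumr; apply: eq_bigr => k _.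
  by rewrite /exp_coeff /= mulrCA [_^-1 * _]mulrC.
by apply: cvgM; [exact: cvg_cst|exact: cvg_exp_series].
Qed.

(** Partial sums of the mean and the second moment of a Poisson law: [k / k!] and
    [k ^ 2 / k!] are shifts of the exponential coefficients. *)
Lemma sum_exp_weighted (A B D x : R) N :
  A + \sum_(k < N) (k.+1`!%:R)^-1 *
      (x ^+ k * (A * x + 2 * k.+1%:R * D + k.+1%:R ^+ 2 * B)) =
  A * series (exp_coeff x) N.+1 + 2 * D * series (exp_coeff x) N +
  B * (series (exp_coeff x) N + x * series (exp_coeff x) N.-1).
Proof.
rewrite /series /=; elim: N => [|N ih].
  rewrite big_ord0 /= big_nat1 !big_geq// /exp_coeff /= expr0 fact0 divr1.
  by ring.
rewrite big_ord_recr /= addrA ih.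
rewrite (big_nat_recr N.+1)//= (big_nat_recr N)//=.
have fn0 k : k`!%:R != 0 :> R by rewrite pnatr_eq0 -lt0n fact_gt0.
case: N {ih} => [|N] /=.
  by rewrite big_geq// /exp_coeff /= !fact0 expr0 expr1 factS fact0; field.
rewrite (big_nat_recr N)//= /exp_coeff /= !factS !natrM.
have n0 k : k.+1%:R != 0 :> R by rewrite pnatr_eq0.
have := fn0 N; have := n0 N; have := n0 N.+1; rewrite -!natr1 !exprS.
move=> h1 h2 h3; field.
by rewrite h1 h2 h3.
Qed.

(** The weights [1 / k!] and the powers [g ^ k] turn the family [e g ^ k] into one
    whose derivatives, [a g ^ k + k g ^ (k - 1) b] with [a = e'] and [b = e g'],
    have total square [exp (|g|^2) (|a + b conj g|^2 + |b|^2)]: this is the mean and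
    the variance of a Poisson law of parameter [|g|^2]. *)
Lemma exp_weighted_lower (a b g : C) :
  ((modulus b ^+ 2 * expR (modulus g ^+ 2))%:E <=
  \sum_(0 <= k <oo) ((k`!%:R)^-1 *
     modulus (a * g ^+ k + k%:R * g ^+ k.-1 * b) ^+ 2)%:E)%E.
Proof.
set x := modulus g ^+ 2.
pose A := modulus a ^+ 2; pose B := modulus b ^+ 2; pose D := complex.Re (a * g * conjC b).
pose term k := (k`!%:R)^-1 * modulus (a * g ^+ k + k%:R * g ^+ k.-1 * b) ^+ 2.
have sq (u v : C) (k : R) : modulus (u + of_real k * v) ^+ 2 =
    modulus u ^+ 2 + 2 * k * complex.Re (u * conjC v) + k ^+ 2 * modulus v ^+ 2.
  by rewrite !sqr_modulus !ReD !ImD !ReM !ImM /=; ring.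
have termS k : term k.+1 =
   (k.+1`!%:R)^-1 * (x ^+ k * (A * x + 2 * k.+1%:R * D + k.+1%:R ^+ 2 * B)).
  rewrite /term /=; congr (_ * _).
  have -> : a * g ^+ k.+1 + k.+1%:R * g ^+ k * b = g ^+ k * (a * g + of_real k.+1%:R * b).
    by rewrite of_real_nat exprS; ring.
  rewrite modulusM exprMn modulusX -exprM mulnC exprM -/x sq modulusM exprMn -/x -/A -/B.
  by rewrite -/D /A /x; ring.
have sumE N : \sum_(k < N.+1) term k = A * series (exp_coeff x) N.+1 +
   2 * D * series (exp_coeff x) N +
   B * (series (exp_coeff x) N + x * series (exp_coeff x) N.-1).
  rewrite -sum_exp_weighted big_ord_recl; congr (_ + _).
    by rewrite /term /= fact0 invr1 mul1r expr0 mulr1 !mul0r addr0.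
  by apply: eq_bigr => k _; exact: termS.
have -> : (\sum_(0 <= k <oo) (term k)%:E)%E =
    (A * expR x + 2 * D * expR x + B * (expR x + x * expR x))%:E.
  apply: eseries_EFin; rewrite -(cvg_shiftn 2) /=.
  have -> : (fun n => \sum_(k < n + 2) term k) = (fun n =>
     A * series (exp_coeff x) (n + 2)%N + 2 * D * series (exp_coeff x) (n + 1)%N +
     B * (series (exp_coeff x) (n + 1)%N + x * series (exp_coeff x) n)).
    by apply/funext => n; rewrite addn2 sumE addn1.
  have e0 := @cvg_exp_series x.
  have e1 : series (exp_coeff x) (n + 1)%N @[n --> \oo] --> expR x by rewrite cvg_shiftn.
  have e2 : series (exp_coeff x) (n + 2)%N @[n --> \oo] --> expR x by rewrite cvg_shiftn.
  apply: cvgD; first apply: cvgD.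
  - by apply: cvgM; [exact: cvg_cst|exact: e2].
  - by apply: cvgM; [exact: cvg_cst|exact: e1].
  - apply: cvgM; first exact: cvg_cst.
    by apply: cvgD => //; apply: cvgM; [exact: cvg_cst|exact: e0].
rewrite lee_fin -/B.
have -> : A * expR x + 2 * D * expR x + B * (expR x + x * expR x) =
   (A + 2 * D + B * x) * expR x + B * expR x by ring.
rewrite lerDr mulr_ge0 ?expR_ge0//.
have -> : A + 2 * D + B * x = modulus (a + b * conjC g) ^+ 2.
  by rewrite /A /B /D /x !sqr_modulus !ReD !ImD !ReM !ImM /=; ring.
exact: sqr_ge0.
Qed.

End Exponential.

(** * Norm bounds for the two integral operators *)

Section OperatorBounds.
Context {R : realType}.
Local Notation C := (cplx R).
Implicit Types (z w : C) (f g H : C -> C).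

Lemma holomorphicZ c f : holomorphic_on_disk f -> holomorphic_on_disk (fun z : C => c * f z).
Proof. by move=> hf; exact: (holomorphicM (@holomorphic_cst R c) hf). Qed.

Lemma holomorphic_integral_V f g : holomorphic_on_disk f -> holomorphic_on_disk g ->
  holomorphic_on_disk (integral_V g f).
Proof.
move=> hf hg; apply: holomorphic_primitive0; apply: (holomorphicM hf).
exact: holomorphic_derive1.
Qed.

Lemma holomorphic_integral_S f g : holomorphic_on_disk f -> holomorphic_on_disk g ->
  holomorphic_on_disk (integral_S g f).
Proof.
move=> hf hg; apply: holomorphic_primitive0; apply: (holomorphicM _ hg).
exact: holomorphic_derive1.
Qed.

(** The comparison is made with the functions [G k = f exp (- H / 2) g ^ k], weighted by
    [1 / k!]. Their squares add up to [|f| ^ 2 exp (|g| ^ 2 - Re H) <= |f| ^ 2], while those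
    of their derivatives add up to at least [|f g'| ^ 2 exp (|g| ^ 2 - Re H)], which is at
    least [exp (- M) |f g'| ^ 2]; and [f g'] is the derivative of [integral_V g f]. *)
Lemma volterra_bound f g H (M : R) : holomorphic_on_disk f -> holomorphic_on_disk g ->
  holomorphic_on_disk H ->
  (forall z, modulus z < 1 -> 0 <= complex.Re (H z) - modulus (g z) ^+ 2 <= M) ->
  (\sum_(0 <= n <oo) (modulus (taylor_coef (integral_V g f) n) ^+ 2)%:E <=
   (expR M)%:E * \sum_(0 <= n <oo) (modulus (taylor_coef f n) ^+ 2)%:E)%E.
Proof.
move=> hf hg hH gH.
pose mhalf : C := of_real (- 2^-1).
pose E z : C := f z * cexp (mhalf * H z).
have hE : holomorphic_on_disk E.
  by apply: (holomorphicM hf); apply: holomorphic_cexp; exact: holomorphicZ.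
have sqE z : modulus (E z) ^+ 2 = modulus (f z) ^+ 2 * expR (- complex.Re (H z)).
  rewrite modulusM exprMn modulus_cexp -expRM_natr; congr (_ * expR _).
  by rewrite ReM /=; field.
have w0 k : 0 <= expR M * (k`!%:R)^-1 by rewrite mulr_ge0 ?expR_ge0// invr_ge0.
have hFd : holomorphic_on_disk (fun u => f u * derive1 g u).
  by apply: (holomorphicM hf); exact: holomorphic_derive1.
apply: (hardy_comparison (G := fun k z => E z * g z ^+ k)
  (w := fun k => expR M * (k`!%:R)^-1) (holomorphic_integral_V hf hg) hf _ w0 (expR_ge0 _)).
- by move=> k; apply: (holomorphicM hE); exact: holomorphicX.
- exact: primitive0_0.
- move=> z z1; have /andP[lo hi] := gH z z1.
  have dE := holomorphic_is_derive hE z1.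
  have dg := holomorphic_is_derive hg z1.
  have dG k : derive1 (fun w => E w * g w ^+ k) z =
     derive1 E z * g z ^+ k + k%:R * g z ^+ k.-1 * (E z * derive1 g z).
    apply: is_derive_derive1; have := is_deriveMC dE (is_deriveXC k dg).
    by rewrite [E z * (_ * _)]mulrCA.
  under eq_eseriesr => k _ do rewrite dG -mulrA EFinM.
  rewrite nneseriesZl; last by move=> k _; rewrite lee_fin mulr_ge0 ?invr_ge0 ?sqr_ge0.
  apply: (@le_trans _ _ ((expR M)%:E *
    (modulus (E z * derive1 g z) ^+ 2 * expR (modulus (g z) ^+ 2))%:E)%E); last first.
    by rewrite lee_pmul2l ?lte_fin ?expR_gt0//; exact: exp_weighted_lower.
  rewrite /integral_V derive1_primitive0// -EFinM lee_fin (modulusM (E z)) (modulusM (f z)) !exprMn sqE.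
  have -> : expR M * (modulus (f z) ^+ 2 * expR (- complex.Re (H z)) *
      modulus (derive1 g z) ^+ 2 * expR (modulus (g z) ^+ 2)) =
    modulus (f z) ^+ 2 * modulus (derive1 g z) ^+ 2 *
     (expR M * expR (- complex.Re (H z)) * expR (modulus (g z) ^+ 2)) by ring.
  rewrite -[leLHS]mulr1; apply: ler_wpM2l; first by rewrite mulr_ge0 ?sqr_ge0.
  by rewrite -!expRD -expR0 ler_expR; lra.
- move=> z z1; have /andP[lo hi] := gH z z1.
  under eq_eseriesr => k _ do rewrite -mulrA EFinM.
  rewrite nneseriesZl; last by move=> k _; rewrite lee_fin mulr_ge0 ?invr_ge0 ?sqr_ge0.
  under eq_eseriesr => k _.
    rewrite modulusM modulusX exprMn -exprM mulnC exprM; over.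
  rewrite nneseries_exp -EFinM lee_fin; apply: ler_wpM2l; first exact: expR_ge0.
  rewrite sqE -mulrA -[leRHS]mulr1; apply: ler_wpM2l; first exact: sqr_ge0.
  by rewrite -expRD -expR0 ler_expR; lra.
Qed.

(** Here the derivative [f' g] is compared directly with [M f']. *)
Lemma integral_S_bound f g (M : R) : holomorphic_on_disk f -> holomorphic_on_disk g ->
  (forall z, modulus z < 1 -> modulus (g z) <= M) ->
  (\sum_(0 <= n <oo) (modulus (taylor_coef (integral_S g f) n) ^+ 2)%:E <=
   (M ^+ 2)%:E * \sum_(0 <= n <oo) (modulus (taylor_coef f n) ^+ 2)%:E)%E.
Proof.
move=> hf hg gM.
have M0 : 0 <= M.
  have m0 : modulus (0 : C) < 1 by rewrite modulus0.
  exact: le_trans (modulus_ge0 _) (gM _ m0).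
(* a single weight, so that the family reduces to [f] *)
pose w k : R := if k is 0%N then M ^+ 2 else 0.
have w0 k : 0 <= w k by case: k => //=; rewrite sqr_ge0.
have sw (u : R) : (\sum_(0 <= k <oo) (w k * u)%:E)%E = (M ^+ 2 * u)%:E.
  apply: eseries_EFin; rewrite -(cvg_shiftn 1) /=.
  have -> : (fun n => \sum_(k < n + 1) w k * u) = (fun=> M ^+ 2 * u).
    apply/funext => n; rewrite addn1 big_ord_recl big1 ?addr0//.
    by move=> i _; rewrite mul0r.
  exact: cvg_cst.
have hdg : holomorphic_on_disk (fun u => derive1 f u * g u).
  by apply: (holomorphicM _ hg); exact: holomorphic_derive1.
apply: (hardy_comparison (G := fun _ => f) (w := w) (holomorphic_integral_S hf hg)
   hf _ w0 (sqr_ge0 M)).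
- by [].
- exact: primitive0_0.
- move=> z z1; rewrite sw lee_fin /integral_S derive1_primitive0//.
  rewrite modulusM exprMn mulrC ler_wpM2r ?sqr_ge0// lerXn2r ?nnegrE ?modulus_ge0//.
  exact: gM.
- by move=> z z1; rewrite sw.
Qed.

End OperatorBounds.

(** * Square integrable functions on an interval *)

Section SquareIntegrable.
Context {R : realType}.
Local Notation C := (cplx R).
Local Notation mu := (@lebesgue_measure R).
Implicit Types (K L : R -> C) (c : C) (s t x y : R) (D : set R).

Definition sq_integrable D K : Prop :=
  cintegrable D K /\ mu.-integrable D (EFin \o (fun t => modulus (K t) ^+ 2)).

Lemma sqrD_le x y : (x + y) ^+ 2 <= 2 * x ^+ 2 + 2 * y ^+ 2.
Proof.
rewrite -subr_ge0 (_ : _ - _ = (x - y) ^+ 2); last by ring.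
exact: sqr_ge0.
Qed.

Lemma modulusB_sqr_le (z w : C) :
  modulus (z - w) ^+ 2 <= 2 * modulus z ^+ 2 + 2 * modulus w ^+ 2.
Proof.
apply: le_trans (sqrD_le _ _); rewrite lerXn2r ?nnegrE ?addr_ge0 ?modulus_ge0//.
exact: modulusB.
Qed.

Lemma sq_integrableB D K L : measurableR D -> sq_integrable D K -> sq_integrable D L ->
  sq_integrable D (fun t => K t - L t).
Proof.
move=> mD [iK K2] [iL L2]; split; first exact: cintegrableB.
apply: le_integrable (integrableD mD (rintegrableZ 2 mD K2) (rintegrableZ 2 mD L2)) => //.
  apply/measurable_EFinP; apply: measurable_funX.
  by apply: measurable_modulus => //; exact: cintegrableB.
move=> t Dt; rewrite /= lee_fin !ger0_norm ?addr_ge0 ?mulr_ge0 ?sqr_ge0 ?modulus_ge0//.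
exact: modulusB_sqr_le.
Qed.

Lemma continuous_sq_integrable s t K : continuous K -> sq_integrable `[s, t] K.
Proof. by move=> cK; split; [exact: continuous_cintegrable|exact: rintegrable_sqr_modulus]. Qed.

Lemma rintegrable_subitv (u : R -> R) (a b a' b' : R) : a <= a' -> b' <= b ->
  mu.-integrable `[a, b] (EFin \o u) -> mu.-integrable `[a', b'] (EFin \o u).
Proof.
move=> aa bb iu; apply: integrableS iu => //.
by apply: subset_itv; rewrite bnd_simp.
Qed.

Lemma sq_integrable_subitv (a b a' b' : R) K : a <= a' -> b' <= b ->
  sq_integrable `[a, b] K -> sq_integrable `[a', b'] K.
Proof.
move=> aa bb [iK K2]; split; first exact: cintegrable_subitv iK.
exact: rintegrable_subitv K2.
Qed.

Lemma sq_integrable_shift s t K c : sq_integrable `[s, t] K ->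
  mu.-integrable `[s, t] (EFin \o (fun x => modulus (K x - c) ^+ 2)).
Proof.
move=> K2; have [_] := @sq_integrableB _ _ (fun=> c) (measurable_itv _) K2
  (continuous_sq_integrable s t (@continuous_cstC R c)).
by [].
Qed.

Lemma RintegralD_itv s t (u v : R -> R) : mu.-integrable `[s, t] (EFin \o u) ->
  mu.-integrable `[s, t] (EFin \o v) ->
  \int[mu]_(x in `[s, t]) (u x + v x) =
  \int[mu]_(x in `[s, t]) u x + \int[mu]_(x in `[s, t]) v x.
Proof. by move=> iu iv; exact: RintegralD. Qed.

End SquareIntegrable.

(** * From mean oscillation to mean square oscillation *)

Section JohnNirenberg.
Context {R : realType}.
Local Notation C := (cplx R).
Local Notation mu := (@lebesgue_measure R).
Variables (b : R -> C) (u v M : R).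
Hypothesis b2 : sq_integrable `[u, v] b.
Hypothesis M0 : 0 < M.
Hypothesis bM : forall s t : R, u <= s -> s < t -> t <= v -> mean_oscillation b s t <= M.
Implicit Types (c : C) (s t : R).

Let ib s t : u <= s -> t <= v -> cintegrable `[s, t] b.
Proof. by move=> us tv; have [i _] := b2; exact: cintegrable_subitv i. Qed.

Let b2st s t : u <= s -> t <= v -> sq_integrable `[s, t] b.
Proof. by move=> us tv; exact: sq_integrable_subitv b2. Qed.

Let ibc s t c : u <= s -> t <= v -> cintegrable `[s, t] (fun x => b x - c).
Proof.
move=> us tv; apply: cintegrableB; [by []|exact: ib|].
by apply: continuous_cintegrable; exact: continuous_cstC.
Qed.

Let mid s t := (s + t) / 2.

Let mid_lt s t : s < t -> s < mid s t < t.
Proof. by move=> st; rewrite /mid; lra. Qed.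

Let avg := arc_mean b.

Let avgE s t : s < t -> of_real (t - s) * avg s t = cintegral `[s, t] b.
Proof.
move=> st; rewrite /avg /arc_mean mulrA -of_realM mulfV ?mul1r//.
by rewrite gt_eqF// subr_gt0.
Qed.

Let avg_mid s t : u <= s -> s < t -> t <= v ->
  of_real (t - s) * avg s t = of_real (mid s t - s) * avg s (mid s t) +
   of_real (t - mid s t) * avg (mid s t) t.
Proof.
move=> us st tv; have /andP[sm mt] := mid_lt st.
rewrite !avgE//; apply: cintegral_split; rewrite ?(ltW sm) ?(ltW mt)//; exact: ib.
Qed.

Let avg_sub_le s t c : u <= s -> s < t -> t <= v ->
  (t - s) * modulus (avg s t - c) <= \int[mu]_(x in `[s, t]) modulus (b x - c).
Proof.
move=> us st tv.
have -> : (t - s) * modulus (avg s t - c) = modulus (cintegral `[s, t] (fun x => b x - c)).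
  rewrite cintegralB//; [|exact: ib|]; last first.
    by apply: continuous_cintegrable; exact: continuous_cstC.
  rewrite cintegral_cst ?(ltW st)// -avgE// -mulrBr modulusM modulus_real ger0_norm//.
  by rewrite subr_ge0 ltW.
by apply: le_modulus_cintegral => //; exact: ibc.
Qed.

Let osc_le s t : u <= s -> s < t -> t <= v ->
  \int[mu]_(x in `[s, t]) modulus (b x - avg s t) <= M * (t - s).
Proof.
move=> us st tv; have := bM us st tv; rewrite /mean_oscillation.
by rewrite mulrC ler_pdivrMr// subr_gt0.
Qed.

Let imod s t c : u <= s -> t <= v ->
  mu.-integrable `[s, t] (EFin \o (fun x => modulus (b x - c))).
Proof. by move=> us tv; apply: integrable_modulus => //; exact: ibc. Qed.

Let Rint_mid (w : R -> R) s t : s < t -> mu.-integrable `[s, t] (EFin \o w) ->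
  \int[mu]_(x in `[s, t]) w x =
  \int[mu]_(x in `[s, mid s t]) w x + \int[mu]_(x in `[mid s t, t]) w x.
Proof.
move=> st iw; have /andP[sm mt] := mid_lt st.
by apply: Rintegral_split; rewrite ?ltW.
Qed.

(** Doubling an interval moves the average by at most [2 M]. *)
Let jump s t s' t' : u <= s -> s < t -> t <= v -> s <= s' -> s' < t' -> t' <= t ->
  t - s = 2 * (t' - s') -> modulus (avg s' t' - avg s t) <= 2 * M.
Proof.
move=> us st tv ss st' tt half.
have us' : u <= s' by rewrite (le_trans us).
have tv' : t' <= v by rewrite (le_trans tt).
have l0 : 0 < t' - s' by rewrite subr_gt0.
rewrite -(ler_pM2l l0).
apply: (le_trans (avg_sub_le (avg s t) us' st' tv')).
have -> : (t' - s') * (2 * M) = M * (t - s) by rewrite half; ring.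
apply: le_trans (osc_le us st tv).
have iw := imod (avg s t) us tv.
rewrite (@Rintegral_split R s s' t _ ss (le_trans (ltW st') tt) iw).
rewrite (@Rintegral_split R s' t' t _ (ltW st') tt (rintegrable_subitv ss (lexx _) iw)).
rewrite -[leLHS]add0r lerD// ?lerDl; apply: Rintegral_ge0 => x _; exact: modulus_ge0.
Qed.

Fixpoint dyadic_sum (phi : R -> R -> R) n s t : R :=
  if n is k.+1 then dyadic_sum phi k s ((s + t) / 2) + dyadic_sum phi k ((s + t) / 2) t
  else phi s t.

Let S c := dyadic_sum (fun s t => (t - s) * modulus (avg s t - c) ^+ 2).
Let L c := dyadic_sum (fun s t => (t - s) * modulus (avg s t - c)).

(** The difference of the squares is affine in the average, and averages are additive. *)
Let affine s t c c' : u <= s -> s < t -> t <= v ->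
  (t - s) * (modulus (avg s t - c) ^+ 2 - modulus (avg s t - c') ^+ 2) =
  (mid s t - s) * (modulus (avg s (mid s t) - c) ^+ 2 - modulus (avg s (mid s t) - c') ^+ 2) +
  (t - mid s t) * (modulus (avg (mid s t) t - c) ^+ 2 - modulus (avg (mid s t) t - c') ^+ 2).
Proof.
move=> us st tv; have E := avg_mid us st tv.
have aff (l : R) (z : C) : l * (modulus (z - c) ^+ 2 - modulus (z - c') ^+ 2) =
  - 2 * complex.Re (of_real l * z * conjC (c - c')) + l * (modulus c ^+ 2 - modulus c' ^+ 2).
  by rewrite !sqr_modulus !ReM !ImM !ReD !ImD /= !ReN !ImN ?ReD ?ImD ?ReN ?ImN; ring.
rewrite !aff E [(_ + _) * conjC _]mulrDl ReD.
by move: (complex.Re _) (complex.Re _) => X Y; rewrite /mid; field.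
Qed.

Let S_shift n : forall s t c c', u <= s -> s < t -> t <= v ->
  S c n s t = S c' n s t + (t - s) * (modulus (avg s t - c) ^+ 2 - modulus (avg s t - c') ^+ 2).
Proof.
elim: n => [|n ih] s t c c' us st tv; first by rewrite /S /=; ring.
have /andP[sm mt] := mid_lt st.
rewrite (affine c c' us st tv) /S /= -/(mid s t) -!/(S _ _ _ _).
rewrite (ih s (mid s t) c c') ?(le_trans (ltW mt))//.
rewrite (ih (mid s t) t c c') ?(le_trans us (ltW sm))//.
by ring.
Qed.

Let L_le n : forall s t c, u <= s -> s < t -> t <= v ->
  L c n s t <= \int[mu]_(x in `[s, t]) modulus (b x - c).
Proof.
elim: n => [|n ih] s t c us st tv; first exact: avg_sub_le.
have /andP[sm mt] := mid_lt st.
rewrite (Rint_mid st (imod c us tv)) /L /= -/(mid s t) lerD//.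
  by apply: ih => //; rewrite (le_trans (ltW mt)).
by apply: ih => //; rewrite (le_trans us (ltW sm)).
Qed.

Let L_ge n : forall s t c, u <= s -> s < t -> t <= v ->
  (t - s) * modulus (avg s t - c) <= L c n s t.
Proof.
elim: n => [|n ih] s t c us st tv; first by [].
have /andP[sm mt] := mid_lt st.
rewrite /L /= -/(mid s t).
apply: (le_trans _ (lerD (ih s (mid s t) c _ _ _) (ih (mid s t) t c _ _ _))) => //; last 2 first.
- by rewrite (le_trans (ltW mt)).
- by rewrite (le_trans us (ltW sm)).
have mE (l : R) z : 0 <= l -> l * modulus z = modulus (of_real l * z).
  by move=> l0; rewrite modulusM modulus_real ger0_norm.
have l1 : 0 <= t - s by rewrite subr_ge0 ltW.
have l2 : 0 <= mid s t - s by rewrite subr_ge0 ltW.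
have l3 : 0 <= t - mid s t by rewrite subr_ge0 ltW.
rewrite (mE _ _ l1) (mE _ _ l2) (mE _ _ l3); apply: le_trans (modulusD _ _).
rewrite le_eqVlt; apply/orP; left; apply/eqP; congr modulus.
rewrite !mulrBr (avg_mid us st tv).
have -> : of_real (t - s) = of_real (mid s t - s) + of_real (t - mid s t) :> C.
  by rewrite -of_realD; congr of_real; ring.
by ring.
Qed.

(** The stopping-time argument: as long as the average stays within [2 M] of the
    reference value [c] nothing is lost; on a maximal dyadic interval where it
    leaves that disk it is still within [4 M] of [c], and such intervals are
    charged to the L^1 oscillation by Chebyshev's inequality. *)
Let stopping n : (forall k, (k < n)%N -> forall s t, u <= s -> s < t -> t <= v ->
     S (avg s t) k s t <= 24 * M ^+ 2 * (t - s)) ->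
  forall s t, u <= s -> s < t -> t <= v -> S (avg s t) n s t <= 24 * M ^+ 2 * (t - s).
Proof.
move=> IH.
have claim k : (k <= n)%N -> forall s t c, u <= s -> s < t -> t <= v ->
    modulus (avg s t - c) <= 2 * M ->
    S c k s t <= 4 * M ^+ 2 * (t - s) + 20 * M * L c k s t.
  elim: k => [_|k ih kn] s t c us st tv bc.
    have l0 : 0 < t - s by rewrite subr_gt0.
    rewrite /S /L /= -[leLHS]addr0 lerD//; last first.
      by rewrite mulr_ge0 ?mulr_ge0 ?modulus_ge0 ?(ltW M0) ?(ltW l0).
    rewrite mulrC ler_pM2r// (_ : 4 * M ^+ 2 = (2 * M) ^+ 2); last by ring.
    by rewrite lerXn2r ?nnegrE ?modulus_ge0 ?mulr_ge0 ?(ltW M0).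
  have /andP[sm mt] := mid_lt st.
  have child s' t' : u <= s' -> s' < t' -> t' <= v ->
      modulus (avg s' t' - avg s t) <= 2 * M ->
      S c k s' t' <= 4 * M ^+ 2 * (t' - s') + 20 * M * L c k s' t'.
    move=> us' st' tv' ch.
    have l0 : 0 < t' - s' by rewrite subr_gt0.
    have [h|h] := leP (modulus (avg s' t' - c)) (2 * M).
      by apply: ih => //; exact: ltnW.
    rewrite (@S_shift k s' t' c (avg s' t') us' st' tv') subrr modulus0 expr0n /= subr0.
    have D := IH k kn s' t' us' st' tv'.
    have c4 : modulus (avg s' t' - c) <= 4 * M.
      have -> : avg s' t' - c = (avg s' t' - avg s t) + (avg s t - c) by ring.
      rewrite (le_trans (modulusD _ _))// (_ : 4 * M = 2 * M + 2 * M); last by ring.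
      exact: lerD.
    have Lg := L_ge k c us' st' tv'.
    have x16 : modulus (avg s' t' - c) ^+ 2 <= 16 * M ^+ 2.
      rewrite (_ : 16 * M ^+ 2 = (4 * M) ^+ 2); last by ring.
      by rewrite lerXn2r ?nnegrE ?modulus_ge0 ?mulr_ge0 ?(ltW M0).
    have h1 : (t' - s') * modulus (avg s' t' - c) ^+ 2 <= (t' - s') * (16 * M ^+ 2).
      by rewrite ler_pM2l.
    have h2 : 20 * M * ((t' - s') * (2 * M)) <= 20 * M * L c k s' t'.
      rewrite ler_pM2l ?mulr_gt0//; apply: le_trans Lg.
      by rewrite ler_pM2l// ltW.
    have h3 : 0 <= 4 * M ^+ 2 * (t' - s') by rewrite mulr_ge0 ?(ltW l0)// mulr_ge0// sqr_ge0.
    apply: (le_trans (lerD D h1)); apply: le_trans (lerD h3 h2).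
    by rewrite le_eqVlt; apply/orP; left; apply/eqP; ring.
  rewrite /S /L /= -/(mid s t) -!/(S _ _ _ _) -!/(L _ _ _ _).
  have -> : 4 * M ^+ 2 * (t - s) + 20 * M * (L c k s (mid s t) + L c k (mid s t) t) =
    (4 * M ^+ 2 * (mid s t - s) + 20 * M * L c k s (mid s t)) +
    (4 * M ^+ 2 * (t - mid s t) + 20 * M * L c k (mid s t) t) by ring.
  apply: lerD; apply: child => //.
  - by rewrite (le_trans (ltW mt)).
  - apply: jump => //; [exact: ltW|by rewrite /mid; field].
  - by rewrite (le_trans us (ltW sm)).
  - apply: jump => //; [exact: ltW|by rewrite /mid; field].
move=> s t us st tv.
have l0 : 0 < t - s by rewrite subr_gt0.
apply: (le_trans (claim n (leqnn n) s t (avg s t) us st tv _)).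
  by rewrite subrr modulus0 mulr_ge0// ltW.
have := le_trans (L_le n (avg s t) us st tv) (osc_le us st tv).
rewrite -(@ler_pM2l _ (20 * M)) ?mulr_gt0// => h.
apply: (le_trans (lerD (lexx _) h)).
by rewrite le_eqVlt; apply/orP; left; apply/eqP; ring.
Qed.

Let dyadic_bound n : forall s t, u <= s -> s < t -> t <= v ->
  S (avg s t) n s t <= 24 * M ^+ 2 * (t - s).
Proof.
by elim/ltn_ind: n => n ih; apply: stopping => k kn; exact: ih.
Qed.

Let isq s t c : u <= s -> t <= v ->
  mu.-integrable `[s, t] (EFin \o (fun x => modulus (b x - c) ^+ 2)).
Proof. by move=> us tv; apply: sq_integrable_shift; exact: b2st. Qed.

Let variance_shift s t c c' : u <= s -> s < t -> t <= v ->
  \int[mu]_(x in `[s, t]) (modulus (b x - c) ^+ 2) =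
  \int[mu]_(x in `[s, t]) (modulus (b x - c') ^+ 2) +
  (t - s) * (modulus (avg s t - c) ^+ 2 - modulus (avg s t - c') ^+ 2).
Proof.
move=> us st tv; have ibst := ib us tv.
pose k := modulus c ^+ 2 - modulus c' ^+ 2.
pose w := conjC (c - c').
have ptw (z : C) : modulus (z - c) ^+ 2 =
    modulus (z - c') ^+ 2 + (- 2 * complex.Re (w * z) + k).
  by rewrite /w /k !sqr_modulus !ReM /= !ReD !ImD /= !ReN !ImN; ring.
have [iRe _] := cintegrableZ w (measurable_itv _) ibst.
have iRe2 := rintegrableZ (- 2) (measurable_itv `[s, t]) iRe.
have ik := rintegrable_cst s t k.
have irest : mu.-integrable `[s, t]
    (EFin \o (fun x => - 2 * complex.Re (w * b x) + k)).
  exact: (integrableD _ iRe2 ik).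
under eq_Rintegral do rewrite ptw.
rewrite (RintegralD_itv (isq c' us tv) irest) (RintegralD_itv iRe2 ik); congr (_ + _).
rewrite RintegralZl// Rintegral_cst_itv ?ltW//.
have -> : \int[mu]_(x in `[s, t]) complex.Re (w * b x) =
    complex.Re (w * (of_real (t - s) * avg s t)).
  by rewrite avgE// -cintegralZ.
rewrite [in RHS]ptw addrAC subrr add0r.
by rewrite mulrCA (ReM (of_real _)) Re_real Im_real mul0r subr0; ring.
Qed.

Let V := dyadic_sum (fun s t => \int[mu]_(x in `[s, t]) (modulus (b x - avg s t) ^+ 2)).

Let variance_split n : forall s t c, u <= s -> s < t -> t <= v ->
  \int[mu]_(x in `[s, t]) (modulus (b x - c) ^+ 2) = S c n s t + V n s t.
Proof.
elim: n => [|n ih] s t c us st tv.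
  rewrite (variance_shift c (avg s t) us st tv) subrr modulus0 expr0n subr0 addrC.
  by rewrite /S /V.
have /andP[sm mt] := mid_lt st.
rewrite (Rint_mid st (isq c us tv)).
rewrite (ih s (mid s t) c us sm (le_trans (ltW mt) tv)).
rewrite (ih (mid s t) t c (le_trans us (ltW sm)) mt tv).
by rewrite /S /V /= -/(mid s t); ring.
Qed.

Let V_le (K : R -> C) (d eta : R) n : continuous K ->
  (forall x y, `|x - y| <= d -> modulus (K x - K y) <= eta) ->
  forall s t, u <= s -> s < t -> t <= v -> t - s <= 2 ^+ n * d ->
  V n s t <= 2 * \int[mu]_(x in `[s, t]) (modulus (b x - K x) ^+ 2) + 2 * eta ^+ 2 * (t - s).
Proof.
move=> cK Kd.
have ibK s t : u <= s -> t <= v ->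
    mu.-integrable `[s, t] (EFin \o (fun x => modulus (b x - K x) ^+ 2)).
  move=> us tv; have [_] := sq_integrableB (measurable_itv _) (b2st us tv)
    (continuous_sq_integrable s t cK).
  by [].
elim: n => [|n ih] s t us st tv std.
  rewrite /V /=.
  apply: (@le_trans _ _ (\int[mu]_(x in `[s, t]) (modulus (b x - K s) ^+ 2))).
    rewrite (variance_shift (K s) (avg s t) us st tv) lerDl subrr modulus0 expr0n subr0.
    by rewrite mulr_ge0 ?sqr_ge0// subr_ge0 ltW.
  have i1 := rintegrableZ 2 (measurable_itv `[s, t]) (ibK s t us tv).
  have i2 := rintegrable_cst s t (2 * eta ^+ 2).
  rewrite -RintegralZl//; last exact: ibK.
  rewrite -(Rintegral_cst_itv (2 * eta ^+ 2) (ltW st)) -(RintegralD_itv i1 i2).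
  apply: le_Rintegral => //; first exact: isq.
    exact: (integrableD _ i1 i2).
  move=> x /=; rewrite in_itv /= => /andP[sx xt].
  have -> : b x - K s = (b x - K x) - (K s - K x) by ring.
  apply: (le_trans (modulusB_sqr_le _ _)); rewrite lerD2l ler_pM2l//.
  have h : modulus (K s - K x) <= eta.
    apply: Kd; rewrite expr0 mul1r in std; rewrite distrC ger0_norm ?subr_ge0//.
    by rewrite (le_trans _ std)// lerD2r.
  by rewrite lerXn2r ?nnegrE ?modulus_ge0// (le_trans _ h)// modulus_ge0.
have /andP[sm mt] := mid_lt st.
have us' := le_trans us (ltW sm); have tv' := le_trans (ltW mt) tv.
rewrite (Rint_mid st (ibK s t us tv)) /V /= -/(mid s t).
have h1 : mid s t - s <= 2 ^+ n * d.
  rewrite -(@ler_pM2l _ 2)// mulrA -exprS (le_trans _ std)//.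
  by rewrite /mid le_eqVlt; apply/orP; left; apply/eqP; field.
have h2 : t - mid s t <= 2 ^+ n * d.
  rewrite -(@ler_pM2l _ 2)// mulrA -exprS (le_trans _ std)//.
  by rewrite /mid le_eqVlt; apply/orP; left; apply/eqP; field.
apply: (le_trans (lerD (ih s (mid s t) us sm tv' h1) (ih (mid s t) t us' mt tv h2))).
by rewrite le_eqVlt; apply/orP; left; apply/eqP; ring.
Qed.

Hypothesis approx : forall e : R, 0 < e -> exists K : R -> C, exists B : R,
  [/\ 0 <= B, continuous K, (forall x y, modulus (K x - K y) <= B * `|x - y|) &
      \int[mu]_(x in `[u, v]) (modulus (b x - K x) ^+ 2) <= e].

(** The variance of [b] on an interval is the variance of its averages over dyadic
    subintervals, which [dyadic_bound] controls uniformly in the generation, plus the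
    sum of the variances on these subintervals, which tends to 0 because [b] is a mean
    square limit of Lipschitz functions. *)
Lemma mean_square_oscillation s t : u <= s -> s < t -> t <= v ->
  \int[mu]_(x in `[s, t]) (modulus (b x - arc_mean b s t) ^+ 2) <= 24 * M ^+ 2 * (t - s).
Proof.
move=> us st tv; apply/ler_addgt0Pr => e e0.
have e4 : 0 < e / 4 by rewrite divr_gt0.
have l0 : 0 < t - s by rewrite subr_gt0.
have [K [B [B0 cK lip bK]]] := approx e4.
pose eta := Num.sqrt (e / (4 * (t - s))).
have eta0 : 0 < eta by rewrite sqrtr_gt0 divr_gt0// mulr_gt0.
have eta2 : 2 * eta ^+ 2 * (t - s) = e / 2.
  rewrite sqr_sqrtr ?divr_ge0 ?mulr_ge0 ?(ltW l0) ?(ltW e0)//.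
  by field; rewrite gt_eqF.
pose d := eta / (B + 1).
have B1 : 0 < B + 1 by rewrite ltr_wpDl.
have d0 : 0 < d by rewrite divr_gt0.
have Kd x y : `|x - y| <= d -> modulus (K x - K y) <= eta.
  move=> xy; apply: (le_trans (lip x y)).
  have -> : eta = (B + 1) * d by rewrite /d mulrC divfK// gt_eqF.
  by apply: ler_pM => //; rewrite lerDl.
have [n hn] := exists_half_lt (t - s) d0.
have std : t - s <= 2 ^+ n * d by rewrite mulrC -ler_pdivrMr ?exprn_gt0// ltW.
rewrite (variance_split n (arc_mean b s t) us st tv).
apply: lerD; first exact: dyadic_bound.
apply: (le_trans (V_le cK Kd us st tv std)); rewrite eta2.
rewrite [leRHS](_ : e = 2 * (e / 4) + e / 2); last by field.
rewrite lerD2r ler_pM2l//; apply: le_trans bK.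
have [_ ibK] := sq_integrableB (measurable_itv _) b2 (continuous_sq_integrable u v cK).
rewrite (@Rintegral_split R u s v _ us (le_trans (ltW st) tv) ibK).
rewrite (@Rintegral_split R s t v _ (ltW st) tv (rintegrable_subitv us (lexx _) ibK)).
by rewrite addrA addrAC lerDr addr_ge0//; apply: Rintegral_ge0 => x _; exact: sqr_ge0.
Qed.

Let isqP s t c (P : R -> R) : u <= s -> t <= v -> continuous P ->
  mu.-integrable `[s, t] (EFin \o (fun x => modulus (b x - c) ^+ 2 * P x)).
Proof.
move=> us tv cP; apply: integrableM_continuous; first exact: isq.
exact: continuous_subspaceT.
Qed.

Let weighted_le s t c (P : R -> R) (B : R) : u <= s -> s <= t -> t <= v -> continuous P ->
  (forall x, s <= x <= t -> P x <= B) ->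
  \int[mu]_(x in `[s, t]) (modulus (b x - c) ^+ 2 * P x) <=
  B * \int[mu]_(x in `[s, t]) (modulus (b x - c) ^+ 2).
Proof.
move=> us st tv cP PB; rewrite -RintegralZl//; last exact: isq.
apply: le_Rintegral => //; first exact: isqP.
  by apply: rintegrableZ => //; exact: isq.
move=> x /=; rewrite in_itv /= => xst.
by rewrite mulrC ler_wpM2r ?sqr_ge0// PB.
Qed.

(** A weight that is at most [2 ^ K / 4 ^ k] on the k-th dyadic shell around [s]
    sees only a bounded mean square oscillation: on the k-th interval the average
    differs from that on the innermost one by at most [2 k M], and the squares of
    these numbers are summable against [2 ^ - k]. *)
Lemma weighted_oscillation (K : nat) s (l al : R) (P : R -> R) :
  0 < l -> 0 <= al -> u <= s - l -> s + l <= v -> continuous P -> (forall x, 0 <= P x) ->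
  (forall x, `|x - s| <= l / 2 ^+ K -> P x <= al * 2 ^+ K) ->
  (forall k x, (k < K)%N -> l * 2 ^+ k / 2 ^+ K <= `|x - s| <= l * 2 ^+ k.+1 / 2 ^+ K ->
     P x <= al * 2 ^+ K / 4 ^+ k.+1) ->
  exists c, \int[mu]_(x in `[s - l, s + l]) (modulus (b x - c) ^+ 2 * P x) <=
    144 * al * l * M ^+ 2.
Proof.
move=> l0 al0 ul lv cP P0 Pin Pshell.
have p2 n : 0 < (2 : R) ^+ n by rewrite exprn_gt0.
have p4 n : 0 < (4 : R) ^+ n by rewrite exprn_gt0.
pose d k := l * 2 ^+ k / 2 ^+ K.
have d0 k : 0 < d k by rewrite /d !divr_gt0// mulr_gt0.
have dS k : d k.+1 = 2 * d k by rewrite /d exprS; field; rewrite gt_eqF.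
have dK : d K = l by rewrite /d mulfK// gt_eqF.
have dmono k : (k <= K)%N -> d k <= l.
  by move=> kK; rewrite -dK /d ler_pM2r ?invr_gt0// ler_pM2l// ler_weXn2l// ler1n.
pose a k := s - d k; pose e k := s + d k.
have ua k : (k <= K)%N -> u <= a k by move=> kK; rewrite (le_trans ul)// lerD2l lerN2 dmono.
have ev k : (k <= K)%N -> e k <= v by move=> kK; rewrite (le_trans _ lv)// lerD2l dmono.
have ae k : a k < e k by rewrite /a /e; have := d0 k; lra.
have len k : e k - a k = 2 * d k by rewrite /e /a; ring.
have aa k : a k.+1 <= a k by rewrite /a dS lerD2l lerN2; have := d0 k; lra.
have ee k : e k <= e k.+1 by rewrite /e dS lerD2l; have := d0 k; lra.
pose A k := avg (a k) (e k).
pose c := A 0%N; exists c.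
have Ac k : (k <= K)%N -> modulus (A k - c) <= 2 * k%:R * M.
  elim: k => [_|k ih kK]; first by rewrite subrr modulus0 mulr0 mul0r.
  have j : modulus (A k - A k.+1) <= 2 * M.
    apply: jump; rewrite ?ua ?ev//.
    by rewrite !len dS.
  have -> : A k.+1 - c = (A k - c) - (A k - A k.+1) by ring.
  apply: (le_trans (modulusB _ _)); rewrite -[k.+1%:R]natr1.
  have -> : 2 * (k%:R + 1) * M = 2 * k%:R * M + 2 * M by ring.
  by rewrite lerD// ih// ltnW.
have sqc k : (k <= K)%N -> \int[mu]_(x in `[a k, e k]) (modulus (b x - c) ^+ 2) <=
    2 * d k * ((24 + 4 * k%:R ^+ 2) * M ^+ 2).
  move=> kK; have uk := ua k kK; have vk := ev k kK.
  rewrite (variance_shift c (A k) uk (ae k) vk) subrr modulus0 expr0n subr0.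
  have h1 := mean_square_oscillation uk (ae k) vk.
  have h2 : modulus (A k - c) ^+ 2 <= (2 * k%:R * M) ^+ 2.
    by rewrite lerXn2r ?nnegrE ?modulus_ge0 ?Ac// !mulr_ge0// ltW.
  rewrite len in h1 *.
  apply: (le_trans (lerD h1 (ler_wpM2l _ h2))); first by rewrite mulr_ge0// ltW.
  by rewrite le_eqVlt; apply/orP; left; apply/eqP; ring.
(* [Tk k] is the sum of [(24 + 4 j ^ 2) / 2 ^ j] for [j <= k]; the whole series is 72. *)
pose Tk (k : nat) : R := 72 - (4 * k%:R ^+ 2 + 16 * k%:R + 48) / 2 ^+ k.
have main k : (k <= K)%N ->
    \int[mu]_(x in `[a k, e k]) (modulus (b x - c) ^+ 2 * P x) <= 2 * al * l * M ^+ 2 * Tk k.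
  elim: k => [K0|k ih kK].
    apply: (@le_trans _ _ (al * 2 ^+ K * \int[mu]_(x in `[a 0%N, e 0%N]) (modulus (b x - c) ^+ 2))).
      apply: (weighted_le c (ua _ K0) (ltW (ae 0%N)) (ev _ K0) cP) => x /andP[x1 x2].
      apply: Pin; move: x1 x2; rewrite /a /e /d expr0 mulr1 ler_norml => x1 x2.
      by apply/andP; split; [rewrite lerBrDl|rewrite lerBlDl].
    apply: (le_trans (ler_wpM2l _ (sqc 0%N K0))); first by rewrite mulr_ge0// ltW.
    rewrite /Tk /d expr0 mulr1 le_eqVlt; apply/orP; left; apply/eqP.
    by field; rewrite gt_eqF.
  have kK' := ltnW kK.
  have uS := ua _ kK; have vS := ev _ kK; have uk := ua _ kK'; have vk := ev _ kK'.
  have iP := isqP c uS vS cP.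
  rewrite (@Rintegral_split R (a k.+1) (a k) _ _ (aa k) (le_trans (ltW (ae k)) (ee k)) iP).
  rewrite (@Rintegral_split R (a k) (e k) _ _ (ltW (ae k)) (ee k)
    (isqP c uk vS cP)).
  set X := \int[mu]_(x in `[a k.+1, a k]) _; set Y := \int[mu]_(x in `[e k, e k.+1]) _.
  pose B := al * 2 ^+ K / 4 ^+ k.+1.
  have B0 : 0 <= B by rewrite divr_ge0 ?mulr_ge0// ltW.
  have dk0 := d0 k.
  have hX : X <= B * \int[mu]_(x in `[a k.+1, a k]) (modulus (b x - c) ^+ 2).
    apply: (weighted_le c uS (aa k) (le_trans (ltW (ae k)) vk) cP) => x /andP[x1 x2].
    apply: (Pshell k) => //; rewrite -!/(d _).
    have xs : x - s <= - d k by move: x2; rewrite /a; lra.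
    rewrite ler0_norm; last by lra.
    by apply/andP; split; [lra|move: x1; rewrite /a; lra].
  have hY : Y <= B * \int[mu]_(x in `[e k, e k.+1]) (modulus (b x - c) ^+ 2).
    apply: (weighted_le c (le_trans uk (ltW (ae k))) (ee k) vS cP) => x /andP[x1 x2].
    apply: (Pshell k) => //; rewrite -!/(d _).
    have xs : d k <= x - s by move: x1; rewrite /e; lra.
    rewrite ger0_norm; last by lra.
    by apply/andP; split; [lra|move: x2; rewrite /e; lra].
  have hZ : \int[mu]_(x in `[a k.+1, a k]) (modulus (b x - c) ^+ 2) +
      \int[mu]_(x in `[e k, e k.+1]) (modulus (b x - c) ^+ 2) <=
      2 * d k.+1 * ((24 + 4 * k.+1%:R ^+ 2) * M ^+ 2).
    apply: le_trans (sqc k.+1 kK).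
    rewrite (@Rintegral_split R (a k.+1) (a k) _ _ (aa k) (le_trans (ltW (ae k)) (ee k))
      (isq c uS vS)).
    rewrite (@Rintegral_split R (a k) (e k) _ _ (ltW (ae k)) (ee k) (isq c uk vS)).
    rewrite lerD2l lerDr; apply: Rintegral_ge0 => x _; exact: sqr_ge0.
  have hXY := lerD hX hY; rewrite -mulrDr in hXY.
  have hB := ler_wpM2l B0 hZ.
  have := lerD (ih kK') (le_trans hXY hB).
  move=> H; rewrite addrCA; apply: (le_trans H).
  rewrite /B /Tk /d !exprS -[k.+1%:R]natr1 le_eqVlt; apply/orP; left; apply/eqP.
  have e4 : (4 : R) ^+ k = 2 ^+ k * 2 ^+ k by rewrite -exprMn; congr (_ ^+ _); ring.
  by rewrite e4; field; rewrite !gt_eqF.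
have := main K (leqnn K); rewrite /a /e dK => /le_trans; apply.
have -> : 144 * al * l * M ^+ 2 = 2 * al * l * M ^+ 2 * 72 by ring.
by rewrite ler_wpM2l ?mulr_ge0 ?(ltW l0) ?sqr_ge0 ?(ltW M0)// /Tk gerBl divr_ge0 ?(ltW (p2 K))//.
Qed.

End JohnNirenberg.

(** * Dilations in mean square *)

Section BoundaryConvergence.
Context {R : realType}.
Local Notation C := (cplx R).
Local Notation mu := (@lebesgue_measure R).
Local Notation T := `[0, 2 * pi : R]%classic.
Implicit Types (K L : R -> C) (z : C) (r s t : R) (f g : C -> C).

Lemma holomorphic_dilation f r : holomorphic_on_disk f -> 0 < r < 1 ->
  holomorphic_on_disk (fun z => f (of_real r * z)).
Proof.
move=> hf /andP[r0 r1] z /unit_diskE z1.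
have rz : modulus (of_real r * z) < 1.
  by rewrite modulusM modulus_real gtr0_norm// mulr_ilt1 ?modulus_ge0 ?(ltW r0).
have dr : is_derive z (1 : C) (fun w => of_real r * w) (0 * z + of_real r * 1).
  exact: (is_deriveMC (is_derive_cstC (of_real r) z) (is_derive_idC z)).
by case: (is_derive_compC (holomorphic_is_derive hf rz) dr).
Qed.

Let half01 : 0 < (2^-1 : R) < 1.
Proof. by rewrite invr_gt0 ltr0n /= invf_lt1// ltr1n. Qed.

Let halfn_neq0 n : of_real (2^-1 : R) ^+ n != 0 :> C.
Proof. by rewrite expf_neq0// of_real_eq0 gt_eqF// invr_gt0. Qed.

Lemma taylor_coef_dilation f r n : holomorphic_on_disk f -> 0 < r < 1 ->
  taylor_coef (fun z => f (of_real r * z)) n = taylor_coef f n * of_real r ^+ n.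
Proof.
move=> hf r01; have /andP[r0 r1] := r01.
have rh : 0 < r * 2^-1 < 1.
  by rewrite mulr_gt0//= mulr_ilt1 ?(ltW r0)//; case/andP: half01 => // /ltW.
apply: (mulIf (halfn_neq0 n)).
rewrite -(fourier_dilation n (holomorphic_dilation hf r01) half01).
rewrite -mulrA -exprMn -of_realM -(fourier_dilation n hf rh).
by apply: eq_circle_mean => t; rewrite of_realM mulrA.
Qed.

Lemma taylor_coefB f g n : holomorphic_on_disk f -> holomorphic_on_disk g ->
  taylor_coef (fun z => f z - g z) n = taylor_coef f n - taylor_coef g n.
Proof.
move=> hf hg.
have hN : holomorphic_on_disk (fun z => -1 * g z) := @holomorphicZ R (-1) g hg.
have hB : holomorphic_on_disk (fun z => f z - g z).
  by apply: (eq_holomorphic (holomorphicD hf hN)) => z _; rewrite mulN1r.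
have h01 : 0 <= (2^-1 : R) < 1 by case/andP: half01 => /ltW ->.
have iK k (hk : holomorphic_on_disk k) := cintegrable_fourier n
  (@continuous_cintegrable R 0 (2 * pi) _ (continuous_dilation hk h01)).
apply: (mulIf (halfn_neq0 n)); rewrite mulrBl.
rewrite -(fourier_dilation n hB half01) -(fourier_dilation n hf half01).
rewrite -(fourier_dilation n hg half01) -(circle_meanB (iK f hf) (iK g hg)).
by apply: eq_circle_mean => t; rewrite mulrBl.
Qed.

Definition mean_square g r := real_circle_mean (fun t => modulus (g (of_real r * circle t)) ^+ 2).

(** By Parseval's identity this holds coefficient by coefficient:
    [(x - y) ^ 2 + y ^ 2 <= x ^ 2] for [0 <= y <= x], with [x] and [y] the n-th powers
    of the radii. *)
Lemma mean_square_dilation_sub g r s : holomorphic_on_disk g -> 0 < s <= r -> r < 1 ->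
  real_circle_mean (fun t => modulus
     (g (of_real r * circle t) - g (of_real s * circle t)) ^+ 2) <=
  mean_square g r - mean_square g s.
Proof.
move=> hg /andP[s0 sr] r1; have r0 := lt_le_trans s0 sr.
pose q := (1 + r) / 2.
have q1 : q < 1 by rewrite /q; lra.
have rq : r < q by rewrite /q; lra.
have q0 : 0 < q by rewrite (lt_trans r0).
have q01 : 0 < q < 1 by rewrite q0.
have inq x : 0 < x -> x < q -> 0 < x / q < 1.
  by move=> x0 xq; rewrite divr_gt0//= ltr_pdivrMr// mul1r.
have rq01 := inq r r0 rq; have sq01 := inq s s0 (le_lt_trans sr rq).
have hr := holomorphic_dilation hg rq01; have hs := holomorphic_dilation hg sq01.
pose G z := g (of_real (r / q) * z) - g (of_real (s / q) * z).
have hG : holomorphic_on_disk G.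
  apply: (eq_holomorphic (holomorphicD hr (@holomorphicZ R (-1) _ hs))) => z _.
  by rewrite mulN1r.
have r01 : 0 < r < 1 by rewrite r0.
have s01 : 0 < s < 1 by rewrite s0 (le_lt_trans sr).
have GE : real_circle_mean (fun t => modulus
     (g (of_real r * circle t) - g (of_real s * circle t)) ^+ 2) =
   real_circle_mean (fun t => modulus (G (of_real q * circle t)) ^+ 2).
  apply: eq_real_circle_mean => t; rewrite /G.
  by rewrite !mulrA -!of_realM !divfK// gt_eqF.
rewrite lerBrDr GE -lee_fin EFinD -(parseval hG q01) -(parseval hg r01) -(parseval hg s01).
have pos (a b : R) : 0 <= b -> forall n, (0 <= (a ^+ 2 * (b ^+ 2) ^+ n)%:E)%E.
  by move=> b0 n; rewrite lee_fin mulr_ge0 ?sqr_ge0// exprn_ge0// sqr_ge0.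
rewrite -nneseriesD; [|by move=> n _ _; apply: pos; exact: ltW..].
apply: lee_nneseries => [n _ _|n _].
  by rewrite adde_ge0//; apply: pos; exact: ltW.
rewrite -EFinD lee_fin (taylor_coefB n hr hs) !(taylor_coef_dilation n hg)//.
rewrite -mulrBr -!of_realX -of_realB modulusM modulus_real exprMn real_normK ?num_real//.
rewrite -[_ * _ * (q ^+ 2) ^+ n]mulrA -mulrDr; apply: ler_wpM2l; first exact: sqr_ge0.
have sw (x : R) : (x ^+ 2) ^+ n = (x ^+ n) ^+ 2 by rewrite -!exprM mulnC.
have dq (x : R) : (x / q) ^+ n * q ^+ n = x ^+ n by rewrite -exprMn divfK// gt_eqF.
rewrite !sw -exprMn mulrBl !dq.
have : s ^+ n <= r ^+ n by rewrite lerXn2r ?nnegrE ?(ltW s0) ?(ltW r0).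
have : 0 <= s ^+ n by rewrite exprn_ge0// ltW.
move: (s ^+ n) (r ^+ n) => x y x0 xy.
rewrite -subr_ge0 (_ : _ - _ = 2 * x * (y - x)); last by ring.
by rewrite mulr_ge0 ?mulr_ge0// subr_ge0.
Qed.

Definition hardy_sum f : \bar R := (\sum_(0 <= n <oo) (modulus (taylor_coef f n) ^+ 2)%:E)%E.

Lemma hardy_sum_ge0 f : (0 <= hardy_sum f)%E.
Proof. by apply: nneseries_ge0 => n _ _; rewrite lee_fin sqr_ge0. Qed.

Lemma hardy_norm_lty f : (hardy_norm f < +oo)%E = (hardy_sum f < +oo)%E.
Proof.
rewrite /hardy_norm -/(hardy_sum f); have := hardy_sum_ge0 f.
by case: (hardy_sum f) => //= x _; rewrite !ltry.
Qed.

Lemma mean_square_le f r : holomorphic_on_disk f -> 0 < r < 1 ->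
  ((mean_square f r)%:E <= hardy_sum f)%E.
Proof.
move=> hf r01; rewrite -(parseval hf r01); apply: lee_nneseries => [n _ _|n _].
  by rewrite lee_fin mulr_ge0 ?sqr_ge0// exprn_ge0// sqr_ge0.
rewrite lee_fin -[leRHS]mulr1 ler_wpM2l ?sqr_ge0// exprn_ile1 ?sqr_ge0//.
by case/andP: r01 => r0 r1; rewrite expr_le1// ltW.
Qed.

(** The mean squares increase with the radius and are bounded by the Hardy norm; their
    increments dominate the mean squares of the differences. *)
Lemma mean_square_cauchy g : hardy2 g -> forall e : R, 0 < e ->
  exists2 r0 : R, 0 < r0 < 1 & forall r s, r0 <= r < 1 -> r0 <= s < 1 ->
   real_circle_mean (fun t => modulus
     (g (of_real r * circle t) - g (of_real s * circle t)) ^+ 2) <= e.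
Proof.
move=> [hg]; rewrite hardy_norm_lty => glt e e0.
have [Q QE] : exists Q : R, hardy_sum g = Q%:E.
  by exists (fine (hardy_sum g)); rewrite fineK// ge0_fin_numE// hardy_sum_ge0.
have mQ r : 0 < r < 1 -> mean_square g r <= Q.
  by move=> r01; rewrite -lee_fin -QE; exact: mean_square_le.
pose E := [set mean_square g r | r in [set r : R | 0 < r < 1]].
have hsup : has_sup E.
  split; first by exists (mean_square g 2^-1), 2^-1 => //; exact: half01.
  by exists Q => _ [r r01 <-]; exact: mQ.
have [_ [r0 r01 <-] hr0] := sup_adherent e0 hsup.
exists r0 => // r s; wlog sr : r s / s <= r.
  move=> H hr hs; have [sr|rs] := leP s r; first exact: H.
  rewrite (@eq_real_circle_mean _ _ (fun t => modulus
     (g (of_real s * circle t) - g (of_real r * circle t)) ^+ 2)).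
    by apply: H => //; exact: ltW.
  by move=> t; rewrite modulusC.
move=> /andP[r0r r1] /andP[r0s s1].
have /andP[r00 _] := r01.
have s0 := lt_le_trans r00 r0s.
have s0r : 0 < s <= r by rewrite s0.
apply: (le_trans (mean_square_dilation_sub hg s0r r1)).
have mono x y : 0 < x <= y -> y < 1 -> mean_square g x <= mean_square g y.
  move=> xy y1; rewrite -subr_ge0; apply: le_trans (mean_square_dilation_sub hg xy y1).
  by apply: real_circle_mean_ge0 => t; exact: sqr_ge0.
have h1 : mean_square g r <= sup E.
  by apply: ub_le_sup; [case: hsup|exists r => //=; rewrite (lt_le_trans s0)].
have h2 : mean_square g r0 <= mean_square g s by apply: mono => //; rewrite r00.
by rewrite lerBlDr; apply: (le_trans h1); rewrite -lerBlDl; apply: (le_trans (ltW hr0)).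
Qed.

(** Fatou's lemma: mean square bounds survive almost everywhere convergence, which is
    all that is known of the radial limits. *)
Lemma limit_mean_square (u v e : R) K (Kn : nat -> R -> C) (b : R -> C) :
  continuous K -> (forall n, continuous (Kn n)) -> cintegrable `[u, v] b ->
  {ae mu, forall t : R, Kn n t @[n --> \oo] --> b t} ->
  (forall n, \int[mu]_(t in `[u, v]) (modulus (K t - Kn n t) ^+ 2) <= e) ->
  (\int[mu]_(t in `[u, v]) (modulus (K t - b t) ^+ 2)%:E <= e%:E)%E.
Proof.
move=> cK cKn ib lim le.
have iKb : cintegrable `[u, v] (fun t => K t - b t).
  by apply: cintegrableB; [by []|exact: continuous_cintegrable|].
have cKKn n := continuous_subC cK (cKn n).
pose F n t := (modulus (K t - Kn n t) ^+ 2)%:E.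
have mF n : @measurable_fun _ _ (measurableTypeR R) _ `[u, v] (F n).
  exact: (measurable_funR_EFin (measurable_itv _) (continuous_sqr_modulus (cKKn n))).
have F0 n t : `[u, v]%classic t -> (0 <= F n t)%E by move=> _; rewrite lee_fin sqr_ge0.
have mlim : @measurable_fun _ _ (measurableTypeR R) _ `[u, v] (fun t => limn_einf (F^~ t)).
  rewrite /limn_einf; apply: (measurableT_comp (@oppe_measurable R setT)).
  apply: (@measurable_fun_limn_esup _ (measurableTypeR R) R _ (fun n t => - F n t)%E) => n.
  exact: (measurableT_comp (@oppe_measurable R setT) (mF n)).
have lim0 t : (0 <= limn_einf (F^~ t))%E.
  rewrite limn_einf_lim; apply: lime_ge; first exact: is_cvg_einfs.
  near=> n; apply: le_ereal_inf_tmp => _ [k _ <-]; rewrite lee_fin; exact: sqr_ge0.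
apply: (@le_trans _ _ (\int[mu]_(t in `[u, v]) limn_einf (F^~ t))%E).
  rewrite le_eqVlt; apply/orP; left; apply/eqP; apply: ge0_ae_eq_integral => //.
  - apply/measurable_EFinP; apply: measurable_funX; exact: measurable_modulus.
  - by move=> t _; rewrite lee_fin sqr_ge0.
  - case: lim => N [mN N0 subN]; exists N; split => // t /= H; apply: subN => /= Kt.
    apply: H => _.
    have /cvg_limn_einf_sup[-> _] // : F n t @[n --> \oo] --> (modulus (K t - b t) ^+ 2)%:E.
    apply: cvg_EFin; first by near=> n.
    rewrite /comp /=.
    have cv : modulus (K t - Kn n t) @[n --> \oo] --> modulus (K t - b t).
      have c1 : K t - Kn n t @[n --> \oo] --> K t - b t.
        by apply: cvgB; [exact: cvg_cst|exact: Kt].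
      exact: (continuous_cvg _ (@continuous_modulus R _) c1).
    exact: (cvgM cv cv).
apply: (le_trans (fatou mu (measurable_itv _) mF F0)).
have Fe n : (\int[mu]_(t in `[u, v]) F n t <= e%:E)%E.
  have := le n; rewrite -lee_fin /Rintegral fineK//.
  by apply: integrable_fin_num => //; exact: (rintegrable_sqr_modulus _ _ (cKKn n)).
rewrite limn_einf_lim; apply: lime_le; first exact: is_cvg_einfs.
near=> n; apply: ge_ereal_inf; exists (\int[mu]_(t in `[u, v]) F n t)%E; last exact: Fe.
by exists n => /=.
Unshelve. all: by end_near. Qed.

End BoundaryConvergence.

(** * The Poisson kernel *)

Section PoissonKernel.
Context {R : realType}.
Local Notation C := (cplx R).
Local Notation mu := (@lebesgue_measure R).
Local Notation T := `[0, 2 * pi : R]%classic.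
Implicit Types (K L : R -> C) (z c : C) (r s t : R).

Definition poisson z t : R := 2 * complex.Re (cauchy_kernel z t) - 1.

Lemma poissonE z t : modulus z < 1 ->
  poisson z t = (1 - modulus z ^+ 2) / modulus (1 - z * circle (- t)) ^+ 2.
Proof.
move=> z1; have := cauchy_denom_neq0 t z1.
have e1 : modulus z = modulus (z * circle (- t)) by rewrite modulus_mul_circle.
rewrite /poisson /cauchy_kernel e1; move: (z * circle (- t)) => [x y] {e1}.
move=> w0.
have n0 : modulus (1 - Complex x y) ^+ 2 != 0 :> R by rewrite sqrf_eq0 modulus_eq0.
have -> : complex.Re (1 - Complex x y)^-1 = (1 - x) / modulus (1 - Complex x y) ^+ 2.
  by rewrite sqr_modulus.
have E : modulus (1 - Complex x y) ^+ 2 = (1 - x) ^+ 2 + y ^+ 2.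
  by rewrite sqr_modulus /=; ring.
have E' : modulus (Complex x y) ^+ 2 = x ^+ 2 + y ^+ 2 by rewrite sqr_modulus.
by rewrite E E' in n0 *; field; rewrite n0.
Qed.

Lemma continuous_poisson z : modulus z < 1 -> continuous (poisson z).
Proof.
move=> z1 t; apply: cvgB; last exact: cvg_cst.
apply: cvgM; first exact: cvg_cst.
exact: (continuous_comp (continuous_cauchy_kernel z1 (x := t)) (@continuous_Re R _)).
Qed.

Lemma poisson_ge0 z t : modulus z < 1 -> 0 <= poisson z t.
Proof.
move=> z1; rewrite poissonE// divr_ge0 ?sqr_ge0// subr_ge0.
by rewrite expr_le1 ?modulus_ge0// ltW.
Qed.

Lemma poisson_le z t : modulus z < 1 -> poisson z t <= 2 / (1 - modulus z).
Proof.
move=> z1; have d0 : 0 < 1 - modulus z by rewrite subr_gt0.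
rewrite /poisson (@le_trans _ _ (2 * complex.Re (cauchy_kernel z t)))//.
  by rewrite lerBlDr lerDl.
rewrite ler_pM2l// (le_trans (ler_norm _))// (le_trans (Re_le_modulus _))//.
exact: cauchy_kernel_le.
Qed.

Lemma poisson_2pi z t : poisson z (t + 2 * pi) = poisson z t.
Proof.
have e : circle (- t) = circle (- (t + 2 * pi)) :> C.
  by rewrite -[RHS]circle_2pi; congr circle; ring.
by rewrite /poisson /cauchy_kernel e.
Qed.

Lemma mean_poisson z : modulus z < 1 -> real_circle_mean (poisson z) = 1.
Proof.
move=> z1; have ck := continuous_cauchy_kernel z1.
have [iRe _] := @continuous_cintegrable R 0 (2 * pi) _ ck.
have i1 := rintegrable_cst 0 (2 * pi) (-1 : R).
have -> : real_circle_mean (poisson z) = real_circle_mean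
   (fun t => 2 * complex.Re (cauchy_kernel z t) + -1) by [].
rewrite (real_circle_meanD (rintegrableZ 2 (measurable_itv _) iRe) i1).
rewrite real_circle_meanZ// -Re_circle_mean circle_mean_cauchy_kernel//.
by rewrite real_circle_mean_cst /=; ring.
Qed.

Lemma cos_double_le (x : R) : 1 - cos (2 * x) <= 4 * (1 - cos x).
Proof.
rewrite mulr_natl cos_mulr2n -subr_ge0.
have -> : 4 * (1 - cos x) - (1 - (cos x ^+ 2 *+ 2 - 1)) = 2 * (1 - cos x) ^+ 2.
  by rewrite -mulr_natr; ring.
by rewrite mulr_ge0// sqr_ge0.
Qed.

(** Doubling the angle multiplies [1 - cos] by at most 4, so the bound at angles between
    [pi / 2] and [pi] propagates to smaller ones. *)
Lemma cos_dyadic_le (x : R) n : pi / 2 <= 2 ^+ n * `|x| <= pi -> (4 ^+ n)^-1 <= 1 - cos x.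
Proof.
wlog x0 : x / 0 <= x.
  move=> H; have [x0|/ltW x0] := leP 0 x; first exact: H.
  by rewrite -cosN -normrN; apply: H; rewrite oppr_ge0.
rewrite ger0_norm//; elim: n x x0 => [|n ih] x x0.
  rewrite !expr0 invr1 mul1r => /andP[x1 x2].
  rewrite lerDl oppr_ge0.
  have -> : cos x = - cos (pi - x) by rewrite cosB cospi sinpi; ring.
  rewrite oppr_le0; apply: cos_ge0_pihalf; apply/andP; split; lra.
move=> H; have := ih (2 * x); rewrite mulr_ge0// => /(_ isT).
rewrite mulrA -exprSr => /(_ H) => h.
rewrite exprS invfM -(@ler_pM2l _ 4)// mulrA mulfV// mul1r.
exact: le_trans h (cos_double_le x).
Qed.

Lemma sqr_modulus_denom r s t : modulus (1 - of_real r * circle s * circle (- t) : C) ^+ 2 =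
  (1 - r) ^+ 2 + 2 * r * (1 - cos (t - s)).
Proof.
rewrite -mulrA -circleD (_ : s - t = - (t - s)); last by ring.
move: (t - s) => x; rewrite sqr_modulus !ReD !ImD !ReN !ImN !ReM !ImM /= cosN sinN.
have := cos2Dsin2 x; move: (cos x) (sin x) => a b E.
have h : (0 - (r * - b + 0 * a)) ^+ 2 = r ^+ 2 * (1 - a ^+ 2).
  by rewrite (_ : 1 - a ^+ 2 = b ^+ 2); [ring|rewrite -E; ring].
by rewrite h; ring.
Qed.

(** The numerator of the Poisson kernel is at most [4 / 2 ^ K]; its denominator is at
    least an eighth of [1 - cos (t - s)], hence of [4 ^ (k + 1 - K)]. *)
Lemma poisson_shell r s t (K k : nat) : 0 <= r < 1 -> 1 - r <= 2 / 2 ^+ K -> (k < K)%N ->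
  pi * 2 ^+ k / 2 ^+ K <= `|t - s| <= pi * 2 ^+ k.+1 / 2 ^+ K ->
  poisson (of_real r * circle s) t <= 32 * 2 ^+ K / 4 ^+ k.+1.
Proof.
move=> /andP[r0 r1] rK kK /andP[t1 t2].
have mz : modulus (of_real r * circle s : C) = r.
  by rewrite modulus_mul_circle modulus_real ger0_norm.
rewrite poissonE ?mz// sqr_modulus_denom.
have p2 n : 0 < (2 : R) ^+ n by rewrite exprn_gt0.
have p4 n : 0 < (4 : R) ^+ n by rewrite exprn_gt0.
set q := 1 - cos (t - s).
have Kk : (K - k.+1 + k.+1 = K)%N by rewrite subnK.
have two n m : (2 : R) ^+ (n + m) = 2 ^+ n * 2 ^+ m by rewrite exprD.
have q1 : (4 ^+ (K - k.+1))^-1 <= q.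
  apply: cos_dyadic_le; rewrite -Kk two in t1 t2.
  have e2 : 2 ^+ k.+1 != 0 :> R by rewrite gt_eqF.
  have e3 : 2 ^+ (K - k.+1) != 0 :> R by rewrite gt_eqF.
  apply/andP; split.
    rewrite -(@ler_pM2l _ (2 ^+ (K - k.+1)))// in t1; apply: le_trans t1.
    rewrite le_eqVlt; apply/orP; left; apply/eqP; rewrite exprS.
    by field; rewrite e3 gt_eqF.
  rewrite -(@ler_pM2l _ (2 ^+ (K - k.+1)))// in t2; apply: (le_trans t2).
  rewrite le_eqVlt; apply/orP; left; apply/eqP.
  by field; rewrite e3 e2.
have q0 : 0 < q by apply: lt_le_trans q1; rewrite invr_gt0.
have q2 : q <= 2 by rewrite /q lerBlDr; have := cos_geN1 (t - s); lra.
have den : q / 8 <= (1 - r) ^+ 2 + 2 * r * q.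
  have [r2|r2] := leP (2^-1) r.
    have h1 : 0 <= (1 - r) ^+ 2 by exact: sqr_ge0.
    have h2 : 1 * q <= 2 * r * q by rewrite ler_pM2r//; lra.
    by lra.
  have h1 : (2^-1) ^+ 2 <= (1 - r) ^+ 2 by rewrite lerXn2r ?nnegrE//; lra.
  have h2 : 0 <= 2 * r * q by rewrite mulr_ge0 ?mulr_ge0// ltW.
  have h3 : (2^-1 : R) ^+ 2 = 4^-1 by field.
  by rewrite h3 in h1; lra.
have den0 : 0 < (1 - r) ^+ 2 + 2 * r * q by apply: lt_le_trans den; rewrite divr_gt0.
rewrite ler_pdivrMr//.
have lhs : 1 - r ^+ 2 <= 4 / 2 ^+ K.
  have -> : 1 - r ^+ 2 = (1 - r) * (1 + r) by ring.
  have -> : 4 / 2 ^+ K = 2 / 2 ^+ K * 2 :> R by rewrite mulrAC; congr (_ / _); ring.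
  by apply: ler_pM; rewrite ?subr_ge0 ?(ltW r1)//; lra.
apply: (le_trans lhs).
have rhs : (4 ^+ (K - k.+1))^-1 / 8 <= (1 - r) ^+ 2 + 2 * r * q.
  by apply: le_trans den; rewrite ler_pM2r.
have c0 : 0 <= 32 * 2 ^+ K / 4 ^+ k.+1 :> R by rewrite divr_ge0 ?mulr_ge0// ltW.
apply: le_trans (ler_wpM2l c0 rhs).
have four : (4 : R) ^+ (K - k.+1) * 4 ^+ k.+1 = 2 ^+ K * 2 ^+ K.
  by rewrite -exprD Kk -exprMn; congr (_ ^+ _); ring.
rewrite le_eqVlt; apply/orP; left; apply/eqP.
have -> : 32 * 2 ^+ K / 4 ^+ k.+1 * ((4 ^+ (K - k.+1))^-1 / 8) =
   4 * 2 ^+ K / (4 ^+ (K - k.+1) * 4 ^+ k.+1) :> R.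
  by field; rewrite !gt_eqF.
by rewrite four; field; rewrite gt_eqF.
Qed.

(** The angle is taken in this range so that the interval of length [2 pi] centred at it
    has nonnegative end points and lies in the interval from 0 to [4 pi]. *)
Lemma polar_form z : exists2 s : R, pi <= s <= 3 * pi & z = of_real (modulus z) * circle s.
Proof.
have [->|z0] := eqVneq z 0.
  exists pi; last by rewrite modulus0 mul0r.
  by have := pi_ge0 R; lra.
have m0 : 0 < modulus z by rewrite modulus_gt0.
pose x := complex.Re z / modulus z; pose y := complex.Im z / modulus z.
have xy : x ^+ 2 + y ^+ 2 = 1.
  by rewrite !expr_div_n -mulrDl -sqr_modulus mulfV// sqrf_eq0 gt_eqF.
have x1 : -1 <= x <= 1.
  rewrite -ler_norml normrM normfV (gtr0_norm m0) ler_pdivrMr// mul1r.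
  exact: Re_le_modulus.
have zE (s : R) : cos s = x -> sin s = y -> z = of_real (modulus z) * circle s.
  move=> cs ss; apply: eqC; rewrite ?ReM ?ImM Re_real Im_real mul0r ?subr0 ?addr0 /= ?cs ?ss.
    by rewrite mulrC divfK// gt_eqF.
  by rewrite mulrC divfK// gt_eqF.
have ac := acosK x1.
have ac0 := acos_ge0 x1; have acpi := acos_lepi x1.
have sn : sin (acos x) = `|y|.
  rewrite sin_acos//.
  by rewrite (_ : 1 - x ^+ 2 = y ^+ 2) ?sqrtr_sqr// -xy; ring.
have [y0|y0] := leP 0 y.
  exists (acos x + 2 * pi); first by apply/andP; split; lra.
  by apply: zE; rewrite mulr_natl ?cosD2pi ?sinD2pi// sn ger0_norm.
exists (- acos x + 2 * pi); first by apply/andP; split; lra.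
by apply: zE; rewrite mulr_natl ?cosD2pi ?sinD2pi ?cosN ?sinN// sn ltr0_norm// opprK.
Qed.

End PoissonKernel.

(** * Integrals of periodic functions *)

Section PeriodicIntegrals.
Context {R : realType}.
Local Notation mu := (@lebesgue_measure R).
Local Notation T := `[0, 2 * pi : R]%classic.

(** Both sides are computed with the same antiderivative of [u]. *)
Lemma Rintegral_translate (u : R -> R) (a b p : R) : a <= b -> 0 <= p -> continuous u ->
  \int[mu]_(t in `[a + p, b + p]) u t = \int[mu]_(t in `[a, b]) u (t + p).
Proof.
move=> ab p0 cu; pose F x := \int[mu]_(t in `[a - 1, x]) u t.
have dF x : a <= x -> is_derive x 1 F (u x).
  move=> ax; have x1 : x < x + 1 by rewrite ltrDl.
  have a1 : a - 1 < x by rewrite ltrBlDr (le_lt_trans ax).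
  have [dF FE] := continuous_FTC1_closed x1 (rintegrable_continuous (a - 1) (x + 1) cu) a1 (cu x).
  by apply: (DeriveDef dF); rewrite -derive1E.
have dFp x : a <= x -> is_derive x 1 (fun y => F (y + p)) (u (x + p)).
  move=> ax; have axp : a <= x + p by rewrite (le_trans ax)// lerDl.
  have dp : is_derive x 1 (fun y : R => y + p) 1.
    by rewrite -[X in is_derive _ _ _ X]addr0; apply: is_deriveD.
  by have := @is_derive1_comp R F (fun y => y + p) x _ _ (dF _ axp) dp; rewrite mulr1.
have cup : continuous (fun t => u (t + p)).
  move=> x; apply: (@continuous_comp _ _ _ (fun t => t + p) u); last exact: cu.
  by apply: cvgD; [exact: cvg_id|exact: cvg_cst].
have abp : a + p <= b + p by rewrite lerD2r.
have d1 t : a + p <= t <= b + p -> is_derive t 1 F (u t).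
  by move=> /andP[t1 _]; apply: dF; rewrite (le_trans _ t1)// lerDl.
have d2 t : a <= t <= b -> is_derive t 1 (fun y => F (y + p)) (u (t + p)).
  by move=> /andP[t1 _]; exact: dFp.
rewrite (Rintegral_FTC abp (continuous_subspaceT cu) d1).
by rewrite (Rintegral_FTC ab (continuous_subspaceT cup) d2).
Qed.

Lemma Rintegral_periodic (u : R -> R) (c : R) : continuous u ->
  (forall t, u (t + 2 * pi) = u t) -> 0 <= c <= 2 * pi ->
  \int[mu]_(t in `[c, c + 2 * pi]) u t = \int[mu]_(t in T) u t.
Proof.
move=> cu pu /andP[c0 c1]; have p0 := ltW (@two_pi_gt0 R).
have iu := rintegrable_continuous 0 (c + 2 * pi) cu.
have cc : c <= c + 2 * pi by rewrite lerDl.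
rewrite addrC in iu cc *.
have e1 := @Rintegral_split R _ c _ _ c0 cc iu.
have pc : 2 * pi <= 2 * pi + c by rewrite lerDl.
have e2 := @Rintegral_split R _ (2 * pi) _ _ p0 pc iu.
have e3 := Rintegral_translate c0 p0 cu.
rewrite add0r addrC in e3.
have e4 : \int[mu]_(t in `[0, c]) u (t + 2 * pi) = \int[mu]_(t in `[0, c]) u t.
  by apply: eq_Rintegral => t _; rewrite pu.
rewrite e1 e3 e4 in e2.
by apply: (addrI (\int[mu]_(t in `[0, c]) u t)); rewrite e2; exact: addrC.
Qed.

Lemma Rintegral_periodic2 (u : R -> R) : continuous u -> (forall t, u (t + 2 * pi) = u t) ->
  \int[mu]_(t in `[0, 4 * pi]) u t = 4 * pi * real_circle_mean u.
Proof.
move=> cu pu; have p0 := @two_pi_gt0 R.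
have i4 := rintegrable_continuous 0 (4 * pi) cu.
rewrite (@Rintegral_split R 0 (2 * pi) (4 * pi) _ (ltW p0) _ i4); last by lra.
have -> : 4 * pi = 2 * pi + 2 * pi :> R by ring.
rewrite Rintegral_periodic ?lexx ?(ltW p0)// /real_circle_mean.
have e (p I : R) : p != 0 -> I + I = (p + p) * (p^-1 * I) by move=> pn0; field.
by apply: e; rewrite gt_eqF.
Qed.

End PeriodicIntegrals.

(** * Poisson's formula *)

Section PoissonFormula.
Context {R : realType}.
Local Notation C := (cplx R).
Local Notation mu := (@lebesgue_measure R).
Local Notation T := `[0, 2 * pi : R]%classic.
Implicit Types (K : R -> C) (z c : C) (r s t : R) (g : C -> C).

Lemma conjCB z w : conjC (z - w) = conjC z - conjC w.
Proof. by apply: eqC; rewrite ?ReD ?ImD ?ReN ?ImN /= ?ReD ?ImD ?ReN ?ImN ?opprD. Qed.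

Lemma conjCK z : conjC (conjC z) = z.
Proof. by apply: eqC; rewrite /= ?opprK. Qed.

Lemma continuous_conjC K : continuous K -> continuous (fun t => conjC (K t)).
Proof.
move=> cK t; apply/cvgC => e e0.
have := cK t; move/cvgC => /(_ e e0); apply: filterS => s.
by rewrite -conjCB modulus_conjC.
Qed.

Lemma circle_mean_conjC K : cintegrable T K ->
  circle_mean (fun t => conjC (K t)) = conjC (circle_mean K).
Proof.
move=> [_ iK]; apply: eqC.
  have -> : complex.Re (conjC (circle_mean K)) = complex.Re (circle_mean K) by [].
  by rewrite !Re_circle_mean.
have -> : complex.Im (conjC (circle_mean K)) = - real_circle_mean (fun t => complex.Im (K t)).
  by rewrite -Im_circle_mean.
rewrite Im_circle_mean -mulN1r -real_circle_meanZ//.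
by apply: eq_real_circle_mean => t; rewrite mulN1r.
Qed.

(** The conjugate half of the Poisson kernel only sees the value at the centre, because
    the boundary values of a holomorphic function have no negative frequencies. *)
Lemma poisson_formula_dilation g r z : holomorphic_on_disk g -> 0 < r < 1 -> modulus z < 1 ->
  circle_mean (fun t => g (of_real r * circle t) * of_real (poisson z t)) = g (of_real r * z).
Proof.
move=> hg r01 z1; have /andP[r0 r1] := r01.
have r01' : 0 <= r < 1 by rewrite ltW.
pose K t : C := g (of_real r * circle t).
have cK : continuous K := continuous_dilation hg r01'.
have iK := @continuous_cintegrable R 0 (2 * pi) _ cK.
have ck := continuous_cauchy_kernel z1.
have cck := continuous_conjC ck.
have i1 := cintegrable_mulT iK ck.
have i2 := cintegrable_mulT iK cck.
have e1 : circle_mean (fun t => K t * cauchy_kernel z t) = g (of_real r * z).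
  have zr : modulus (of_real r * z) < r.
    by rewrite modulusM modulus_real (gtr0_norm r0) -[ltRHS]mulr1 ltr_pM2l.
  rewrite [RHS](cauchy_formula hg r1 zr) /cauchy_transform.
  by rewrite [of_real r * z]mulrC mulfK// of_real_eq0 gt_eqF.
have e0 : circle_mean K = g 0.
  rewrite -(fourier_dilation0 hg r01); apply: eq_circle_mean => t.
  by rewrite expr0 mulr1.
have e2 : circle_mean (fun t => K t * conjC (cauchy_kernel z t)) = g 0.
  have ccK := continuous_conjC cK.
  have icK := @continuous_cintegrable R 0 (2 * pi) _ ccK.
  have -> : circle_mean (fun t => K t * conjC (cauchy_kernel z t)) =
      conjC (cauchy_transform (fun t => conjC (K t)) z).
    rewrite -circle_mean_conjC; last exact: (cintegrable_mulT icK ck).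
    by apply: eq_circle_mean => t; rewrite conjCM conjCK.
  have fn n : fourier (fun t => conjC (K t)) n =
      conjC (circle_mean (fun t => K t * circle t ^+ n)).
    have cn := @continuous_expC R _ n (@continuous_circle R).
    rewrite -(circle_mean_conjC (cintegrable_mulT iK cn)).
    by apply: eq_circle_mean => t; rewrite conjCM conjCX conjC_circle.
  rewrite (@cauchy_transform_coef_eq R _ z (conjC (g 0)) icK z1) ?conjCK//.
    by rewrite fn -e0; congr conjC; apply: eq_circle_mean => t; rewrite expr0 mulr1.
  case=> // n _; rewrite fn; apply/eqP; rewrite -modulus_eq0 modulus_conjC modulus_eq0; apply/eqP.
  have hq : holomorphic_on_disk (fun w => w ^+ n.+1 * g w).
    exact: (@holomorphicM R (fun w : C => w ^+ n.+1) g (@holomorphicX R _ n.+1 (@holomorphic_id R)) hg).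
  have rn : of_real r ^+ n.+1 != 0 :> C by rewrite expf_neq0// of_real_eq0 gt_eqF.
  apply: (mulfI rn); rewrite mulr0.
  have cn := @continuous_expC R _ n.+1 (@continuous_circle R).
  rewrite -(circle_meanZ _ (cintegrable_mulT iK cn)).
  have := fourier_dilation0 hq r01; rewrite exprS mul0r mul0r => <-.
  by apply: eq_circle_mean => t; rewrite expr0 mulr1 exprMn /K; ring.
have -> : circle_mean (fun t => K t * of_real (poisson z t)) = circle_mean (fun t =>
    K t * cauchy_kernel z t + K t * conjC (cauchy_kernel z t) - K t).
  apply: eq_circle_mean => t.
  have -> : of_real (poisson z t) = cauchy_kernel z t + conjC (cauchy_kernel z t) - 1 :> C.
    by apply: eqC; rewrite ?ReD ?ImD ?ReN ?ImN /= ?oppr0 ?addr0 /poisson; ring.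
  ring.
have i12 := cintegrableD (measurable_itv _) i1 i2.
by rewrite (circle_meanB i12 iK) (circle_meanD i1 i2) e0 e1 e2 addrK.
Qed.

End PoissonFormula.

(** * The boundary function of an element of the Hardy space *)

Section BoundaryFunction.
Context {R : realType}.
Local Notation C := (cplx R).
Local Notation mu := (@lebesgue_measure R).
Local Notation T := `[0, 2 * pi : R]%classic.
Variables (g : C -> C) (b : R -> C).
Hypothesis g2 : hardy2 g.
Hypothesis bv : boundary_values g b.
Hypothesis ib : forall s t : R, s < t -> cintegrable `[s, t] b.
Implicit Types (z c : C) (r s t e : R).

Let hg : holomorphic_on_disk g. Proof. by case: g2. Qed.

Let dil r t : C := g (of_real r * circle t).

Let dil_continuous r : 0 < r < 1 -> continuous (dil r).
Proof. by move=> /andP[r0 r1]; apply: (continuous_dilation hg); rewrite (ltW r0). Qed.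

Let dil_periodic r t : dil r (t + 2 * pi) = dil r t.
Proof. by rewrite /dil circle_2pi. Qed.

Let four_pi_gt0 : 0 < 4 * pi :> R.
Proof. by rewrite mulr_gt0 ?pi_gt0. Qed.

(** Dilations form a Cauchy family in mean square, and [b] is their limit almost
    everywhere. The interval has twice the length of the circle, so that it contains an
    interval of length [2 pi] centred at a representative of every angle. *)
Lemma boundary_approx e : 0 < e -> exists2 r0 : R, 0 < r0 < 1 & forall r, r0 <= r < 1 ->
  sq_integrable `[0, 4 * pi] (fun t => dil r t - b t) /\
  \int[mu]_(t in `[0, 4 * pi]) (modulus (dil r t - b t) ^+ 2) <= e.
Proof.
move=> e0; have e4 : 0 < e / (4 * pi) by rewrite divr_gt0.
have [r0 r01 cauchy] := mean_square_cauchy g2 e4; exists r0 => // r rr.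
have /andP[r00 r0lt] := r01.
have pos x : r0 <= x < 1 -> 0 < x < 1.
  by case/andP=> x0 x1; rewrite x1 andbT (lt_le_trans r00).
pose s n : R := 1 - (1 - r0) * harmonic n.
have har1 n : @harmonic R n <= 1 by rewrite invf_le1 ?ltr0n// ler1n.
have sr n : r0 <= s n < 1.
  apply/andP; split.
    rewrite /s lerBrDl -lerBrDr -[leRHS]mulr1; apply: ler_wpM2l => //.
    by rewrite subr_ge0 ltW.
  by rewrite /s ltrBlDr ltrDl mulr_gt0 ?harmonic_gt0// subr_gt0.
have s1 : s n @[n --> \oo] --> (1 : R)^'-.
  have s1' : s n @[n --> \oo] --> (1 : R).
    rewrite -[X in _ --> X]subr0 -[X in _ --> _ - X](mulr0 (1 - r0)).
    apply: cvgB; first exact: cvg_cst.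
    apply: cvgM; [exact: cvg_cst|exact: cvg_harmonic].
  move=> A A1; have : \forall n \near \oo, s n < 1 -> A (s n) := s1' _ A1.
  by apply: filterS => n; apply; case/andP: (sr n).
have ib4 : cintegrable `[0, 4 * pi] b by exact: ib.
have cr := dil_continuous (pos r rr).
have csn n := dil_continuous (pos _ (sr n)).
have lim : {ae mu, forall t : R, dil (s n) t @[n --> \oo] --> b t}.
  case: bv => N [mN N0 subN]; exists N; split => // t /= H; apply: subN => /= Kt.
  apply: H; exact: (cvg_comp s (fun x => dil x t) s1 Kt).
have le n : \int[mu]_(t in `[0, 4 * pi]) (modulus (dil r t - dil (s n) t) ^+ 2) <= e.
  rewrite (@Rintegral_periodic2 R (fun t => modulus (dil r t - dil (s n) t) ^+ 2)).
  - by rewrite mulrC -ler_pdivlMr//; exact: cauchy.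
  - exact: (continuous_sqr_modulus (continuous_subC cr (csn n))).
  - by move=> t; rewrite !dil_periodic.
have fat := limit_mean_square cr csn ib4 lim le.
have iB : cintegrable `[0, 4 * pi] (fun t => dil r t - b t).
  exact: (cintegrableB (measurable_itv _) (continuous_cintegrable _ _ cr) ib4).
have i2 : mu.-integrable `[0, 4 * pi] (EFin \o (fun t => modulus (dil r t - b t) ^+ 2)).
  apply/integrableP; split.
    apply/measurable_EFinP; apply: measurable_funX.
    exact: (measurable_modulus (measurable_itv _) iB).
  apply: le_lt_trans (ltry e); apply: le_trans fat; rewrite le_eqVlt; apply/orP; left.
  apply/eqP; apply: eq_integral => t _.
  by rewrite /= ger0_norm// sqr_ge0.
split; first by [].
by rewrite -lee_fin /Rintegral fineK//; exact: integrable_fin_num.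
Qed.

Lemma boundary_sq_integrable : sq_integrable `[0, 4 * pi] b.
Proof.
have [r0 r01 /(_ r0)] := boundary_approx (@ltr01 R).
have /andP[r00 r0lt] := r01; rewrite lexx r0lt => /(_ isT)[sB _].
have cr := dil_continuous r01.
have := sq_integrableB (measurable_itv _) (continuous_sq_integrable 0 (4 * pi) cr) sB.
have -> // : (fun t => dil r0 t - (dil r0 t - b t)) = b.
by apply/funext => t; rewrite subKr.
Qed.

Lemma le_Rintegral_subitv (f : R -> R) (u v u' v' : R) : u <= u' -> u' <= v' -> v' <= v ->
  (forall t, 0 <= f t) -> mu.-integrable `[u, v] (EFin \o f) ->
  \int[mu]_(t in `[u', v']) f t <= \int[mu]_(t in `[u, v]) f t.
Proof.
move=> uu uv vv f0 fi; have u'v := le_trans uv vv.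
rewrite (@Rintegral_split R u u' v _ uu u'v fi).
rewrite (@Rintegral_split R u' v' v _ uv vv (rintegrable_subitv uu (lexx v) fi)).
rewrite addrCA lerDl; apply: addr_ge0; exact: Rintegral_ge0.
Qed.

Lemma boundary_approx1 e : 0 < e -> exists2 r0 : R, 0 < r0 < 1 & forall r, r0 <= r < 1 ->
  real_circle_mean (fun t => modulus (dil r t - b t)) <= e.
Proof.
move=> e0; have p0 := @two_pi_gt0 R.
have e20 : 0 < 2 * pi * e ^+ 2 by rewrite mulr_gt0// exprn_gt0.
have [r0 r01 H] := boundary_approx e20; exists r0 => // r rr.
have [sB le] := H r rr; have p24 : 2 * pi <= 4 * pi :> R by have := pi_ge0 R; lra.
have [i1 i2] := sq_integrable_subitv (lexx 0) p24 sB.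
have im := integrable_modulus (measurable_itv _) i1.
have le2 : real_circle_mean (fun t => modulus (dil r t - b t) ^+ 2) <= e ^+ 2.
  rewrite /real_circle_mean [leLHS]mulrC ler_pdivrMr// [leRHS]mulrC; apply: le_trans le.
  case: sB => _ i4; apply: le_Rintegral_subitv => //; last by move=> t; exact: sqr_ge0.
  exact: ltW.
have e2 : 0 < 2 * e by rewrite mulr_gt0.
have ic := rintegrable_cst 0 (2 * pi) (e / 2).
have iZ := rintegrableZ (2 * e)^-1 (measurable_itv _) i2.
(* [x <= e / 2 + x ^ 2 / (2 e)] *)
apply: (@le_trans _ _ (real_circle_mean
  (fun t => e / 2 + (2 * e)^-1 * modulus (dil r t - b t) ^+ 2))).
  have iS : mu.-integrable T (EFin \o (fun t => e / 2 + (2 * e)^-1 * modulus (dil r t - b t) ^+ 2)).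
    exact: (rintegrableD (measurable_itv _) ic iZ).
  apply: (le_real_circle_mean im iS).
  move=> t; set x := modulus _; rewrite -subr_ge0.
  have -> : e / 2 + (2 * e)^-1 * x ^+ 2 - x = (2 * e)^-1 * (x - e) ^+ 2.
    by field; rewrite gt_eqF.
  by rewrite mulr_ge0 ?sqr_ge0// invr_ge0 ltW.
rewrite (real_circle_meanD ic iZ) real_circle_mean_cst (real_circle_meanZ _ i2).
have h : (2 * e)^-1 * e ^+ 2 = e / 2 by field; rewrite gt_eqF.
have := ler_wpM2l (ltW (_ : 0 < (2 * e)^-1)) le2; rewrite invr_gt0 => /(_ e2).
by rewrite h; lra.
Qed.

Let ibT : cintegrable T b.
Proof. exact: (ib (@two_pi_gt0 R)). Qed.

(** The formula for the dilations passes to the limit since the Poisson kernel is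
    bounded. *)
Lemma poisson_formula_boundary z : modulus z < 1 ->
  circle_mean (fun t => b t * of_real (poisson z t)) = g z.
Proof.
move=> z1; apply/eqP; rewrite -subr_eq0 -modulus_eq0; apply/eqP/le_anti.
rewrite modulus_ge0 andbT; apply/ler_addgt0Pr => e e0; rewrite add0r.
have d0 : 0 < 1 - modulus z by rewrite subr_gt0.
pose B := 2 / (1 - modulus z); have B0 : 0 < B by rewrite divr_gt0.
have z01 : 0 <= modulus z < 1 by rewrite modulus_ge0.
have [L L0 lip] := holomorphic_lipschitz hg z01.
have eB : 0 < e / (2 * B) by rewrite divr_gt0// mulr_gt0.
have [r0 r01 H] := boundary_approx1 eB.
have /andP[r00 r0lt] := r01.
pose q := e / (2 * (L + 1)).
have L1 : 0 < L + 1 by rewrite ltr_wpDl.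
have q0 : 0 < q by rewrite divr_gt0// mulr_gt0.
pose r := Num.max r0 (1 - q).
have rr : r0 <= r < 1 by rewrite le_max lexx/= gt_max r0lt ltrBlDr ltrDl.
have r1q : 1 - r <= q by rewrite lerBlDr addrC -lerBlDr le_max lexx orbT.
have /andP[rr0 r1] := rr; have r0' := lt_le_trans r00 rr0.
have r01' : 0 < r < 1 by rewrite r0'.
have cP : continuous (fun t => of_real (poisson z t) : C).
  by move=> t; apply: (continuous_comp (continuous_poisson z1 (x := t))); exact: continuous_of_real.
have iD := @continuous_cintegrable R 0 (2 * pi) _ (dil_continuous r01').
have iDb := cintegrableB (measurable_itv _) iD ibT.
have -> : circle_mean (fun t => b t * of_real (poisson z t)) - g z =
    (g (of_real r * z) - g z) - circle_mean (fun t => (dil r t - b t) * of_real (poisson z t)).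
  have -> : circle_mean (fun t => (dil r t - b t) * of_real (poisson z t)) =
      g (of_real r * z) - circle_mean (fun t => b t * of_real (poisson z t)).
    rewrite -(poisson_formula_dilation hg r01' z1) -(circle_meanB (cintegrable_mulT iD cP)
      (cintegrable_mulT ibT cP)).
    by apply: eq_circle_mean => t; rewrite mulrBl.
  by ring.
apply: (le_trans (modulusB _ _)).
have h1 : modulus (g (of_real r * z) - g z) <= e / 2.
  have zr : modulus (of_real r * z) <= modulus z.
    by rewrite modulusM modulus_real gtr0_norm// ler_piMl ?modulus_ge0// ltW.
  apply: (le_trans (lip _ _ (lexx _) zr)).
  have -> : of_real r * z - z = of_real (r - 1) * z by rewrite of_realB of_real1 mulrBl mul1r.
  rewrite modulusM modulus_real -normrN opprB ger0_norm ?subr_ge0 ?(ltW r1)//.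
  apply: (@le_trans _ _ ((L + 1) * q)); last by rewrite /q le_eqVlt; apply/orP; left; apply/eqP; field; rewrite gt_eqF.
  apply: ler_pM; rewrite ?lerDl// ?mulr_ge0 ?modulus_ge0// ?subr_ge0 ?(ltW r1)//.
  rewrite -[leRHS]mulr1; apply: ler_pM; rewrite ?modulus_ge0 ?subr_ge0 ?(ltW r1)//.
  exact: ltW.
have h2 : modulus (circle_mean (fun t => (dil r t - b t) * of_real (poisson z t))) <= e / 2.
  have PB t : modulus (of_real (poisson z t)) <= B.
    by rewrite modulus_real ger0_norm ?poisson_ge0//; exact: poisson_le.
  apply: (le_trans (circle_mean_mul_bound iDb cP PB)).
  apply: (le_trans (ler_wpM2l (ltW B0) (H r rr))).
  by rewrite le_eqVlt; apply/orP; left; apply/eqP; field; rewrite gt_eqF.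
have := lerD h1 h2; lra.
Qed.

Lemma dilation_lipschitz r : 0 < r < 1 -> exists2 B : R, 0 <= B &
  forall x y, modulus (dil r x - dil r y) <= B * `|x - y|.
Proof.
move=> /andP[r0 r1]; have r01 : 0 <= r < 1 by rewrite ltW.
have [B B0 lip] := holomorphic_lipschitz hg r01; exists B => // x y.
have mr t : modulus (of_real r * circle t : C) <= r.
  by rewrite modulus_mul_circle modulus_real ger0_norm// ltW.
apply: (le_trans (lip _ _ (mr y) (mr x))); apply: ler_wpM2l => //.
rewrite -mulrBr modulusM modulus_real (gtr0_norm r0) -[leRHS]mul1r.
by apply: ler_pM; rewrite ?modulus_ge0 ?(ltW r0) ?(ltW r1)//; exact: circle_lipschitz.
Qed.

Variable M : R.
Hypothesis M0 : 0 < M.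
Hypothesis bM : forall s t : R, s < t -> t <= s + 2 * pi -> mean_oscillation b s t <= M.

(** With [K] the first integer such that [2 ^ - K <= 1 - |z|], the Poisson kernel is a
    weight of the kind considered in [weighted_oscillation], centred at the angle
    of [z]. *)
Lemma poisson_oscillation z : modulus z < 1 -> exists s, exists c, pi <= s <= 3 * pi /\
  \int[mu]_(x in `[s - pi, s + pi]) (modulus (b x - c) ^+ 2 * poisson z x) <=
  144 * 32 * pi * M ^+ 2.
Proof.
move=> z1; have [s /andP[s1 s3] zE] := polar_form z; exists s.
have d0 : 0 < 1 - modulus z by rewrite subr_gt0.
have u0 : 0 <= s - pi by rewrite subr_ge0.
have v4 : s + pi <= 4 * pi by lra.
have b2 := sq_integrable_subitv u0 v4 boundary_sq_integrable.
have bMw x y : s - pi <= x -> x < y -> y <= s + pi -> mean_oscillation b x y <= M.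
  by move=> x1 xy y1; apply: bM => //; lra.
have approx e : 0 < e -> exists K : R -> C, exists B : R,
    [/\ 0 <= B, continuous K, (forall x y, modulus (K x - K y) <= B * `|x - y|) &
      \int[mu]_(x in `[s - pi, s + pi]) (modulus (b x - K x) ^+ 2) <= e].
  move=> e0; have [r0 r01 /(_ r0)] := boundary_approx e0.
  have /andP[r00 r0lt] := r01; rewrite lexx r0lt => /(_ isT)[[_ i2] le].
  have [B B0 lip] := dilation_lipschitz r01.
  exists (dil r0), B; split => //; first exact: dil_continuous.
  have -> : (fun x => modulus (b x - dil r0 x) ^+ 2) = (fun x => modulus (dil r0 x - b x) ^+ 2).
    by apply/funext => x; rewrite modulusC.
  apply: le_trans le; apply: le_Rintegral_subitv => //; last by move=> t; exact: sqr_ge0.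
  by have := pi_ge0 R; lra.
have [K KP Kmin] : exists2 K : nat, 1 / 2 ^+ K <= 1 - modulus z & 1 - modulus z <= 2 / 2 ^+ K.
  have [n nz] := exists_half_lt 1 d0.
  have ex : exists n, 1 / 2 ^+ n <= 1 - modulus z by exists n; exact: ltW.
  case: (ex_minnP ex) => K KP Kmin; exists K => //.
  case: K KP Kmin => [|K] _ Kmin.
    by rewrite expr0 divr1; have := modulus_ge0 z; lra.
  have : ~~ (1 / 2 ^+ K <= 1 - modulus z) by apply/negP => /Kmin; rewrite ltnn.
  rewrite -ltNge => /ltW h; apply: (le_trans h).
  by rewrite exprS invfM mulrA mulfV// mul1r.
have p2 n : 0 < (2 : R) ^+ n by rewrite exprn_gt0.
have mz : 0 <= modulus z < 1 by rewrite modulus_ge0.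
suff [c hc] : exists c, \int[mu]_(x in `[s - pi, s + pi]) (modulus (b x - c) ^+ 2 * poisson z x) <=
    144 * 32 * pi * M ^+ 2 by exists c; split; [rewrite s1|].
apply: (@weighted_oscillation _ b (s - pi) (s + pi) M b2 M0 bMw approx K s pi 32 (poisson z)) => //.
- exact: pi_gt0.
- exact: continuous_poisson.
- by move=> x; exact: poisson_ge0.
- move=> x _; apply: (le_trans (poisson_le x z1)).
  rewrite ler_pdivrMr//; have := KP; rewrite div1r => h.
  have h2 : 1 <= 2 ^+ K * (1 - modulus z).
    by rewrite -(@ler_pM2l _ (2 ^+ K))// in h; rewrite mulfV ?gt_eqF// in h.
  by rewrite -mulrA; lra.
- by move=> k x kK h; rewrite zE; apply: (poisson_shell mz Kmin kK h).
Qed.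

(** Passing from the interval centred at the angle of [z] to the fundamental interval:
    the dilations of [g] are periodic and approximate [b] on both. *)
Lemma poisson_oscillation_circle z s c : modulus z < 1 -> pi <= s <= 3 * pi ->
  \int[mu]_(x in T) (modulus (b x - c) ^+ 2 * poisson z x) <=
  4 * \int[mu]_(x in `[s - pi, s + pi]) (modulus (b x - c) ^+ 2 * poisson z x).
Proof.
move=> z1 /andP[s1 s3].
have d0 : 0 < 1 - modulus z by rewrite subr_gt0.
pose B := 2 / (1 - modulus z); have B0 : 0 < B by rewrite divr_gt0.
have sp : s - pi <= 2 * pi by lra.
have total (I D W q p e : R) : I <= 2 * D + q -> D <= 2 * W + p -> q <= e / 3 -> p <= e / 3 ->
    I <= 4 * W + e by lra.
have cP := continuous_poisson z1.
have P0 x : 0 <= poisson z x := poisson_ge0 x z1.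
have PB x : poisson z x <= B := poisson_le x z1.
(* [|x| ^ 2 <= 2 |y| ^ 2 + 2 |x - y| ^ 2] under the integral *)
have triangle (u v : R) (X Y : R -> C) : sq_integrable `[u, v] X -> sq_integrable `[u, v] Y ->
    \int[mu]_(x in `[u, v]) (modulus (X x) ^+ 2 * poisson z x) <=
    2 * \int[mu]_(x in `[u, v]) (modulus (Y x) ^+ 2 * poisson z x) +
    2 * B * \int[mu]_(x in `[u, v]) (modulus (X x - Y x) ^+ 2).
  move=> X2 Y2; have mI : measurableR `[u, v] := measurable_itv _.
  have [_ XY2] := sq_integrableB mI X2 Y2.
  have wP := continuous_subspaceT cP (A := `[u, v]).
  have [_ X2'] := X2; have [_ Y2'] := Y2.
  have iX := integrableM_continuous X2' wP; have iY := integrableM_continuous Y2' wP.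
  have iZY := rintegrableZ 2 mI iY; have iZXY := rintegrableZ (2 * B) mI XY2.
  rewrite -(RintegralZl _ mI iY) -(RintegralZl _ mI XY2) -(RintegralD_itv iZY iZXY).
  apply: (le_Rintegral mI iX (rintegrableD mI iZY iZXY)) => x _ /=.
  have h : modulus (X x) ^+ 2 <= 2 * modulus (Y x) ^+ 2 + 2 * modulus (X x - Y x) ^+ 2.
    have := modulusB_sqr_le (Y x) (Y x - X x).
    by rewrite subKr [modulus (Y x - X x)]modulusC.
  apply: (le_trans (ler_wpM2r (P0 x) h)).
  have : modulus (X x - Y x) ^+ 2 * poisson z x <= modulus (X x - Y x) ^+ 2 * B.
    by apply: ler_wpM2l => //; exact: sqr_ge0.
  move: (modulus (X x - Y x) ^+ 2) (modulus (Y x) ^+ 2) (poisson z x) => d y p hd.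
  have -> : (2 * y + 2 * d) * p = 2 * (y * p) + 2 * (d * p) by ring.
  have -> : 2 * B * d = 2 * (d * B) by ring.
  by rewrite lerD2l ler_pM2l.
have p24 : 2 * pi <= 4 * pi :> R by have := pi_ge0 R; lra.
have u0 : 0 <= s - pi by rewrite subr_ge0.
have v4 : s + pi <= 4 * pi by lra.
have uv : s - pi <= s + pi by have := pi_ge0 R; lra.
have cc := @continuous_cstC R c.
have bc u v : 0 <= u -> v <= 4 * pi -> sq_integrable `[u, v] (fun x => b x - c).
  move=> hu hv; apply: (@sq_integrableB R _ b (fun=> c) (measurable_itv _)).
    exact: (sq_integrable_subitv hu hv boundary_sq_integrable).
  exact: (continuous_sq_integrable u v cc).
apply/ler_addgt0Pr => e e0.
have e6 : 0 < e / (6 * B) by rewrite divr_gt0// mulr_gt0.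
have [r r01 /(_ r)] := boundary_approx e6.
have /andP[r0 r1] := r01; rewrite lexx r1 => /(_ isT)[[_ i4] le].
have cd := continuous_subC (dil_continuous r01) cc.
have dc u v := continuous_sq_integrable u v cd.
have small u v : 0 <= u -> u <= v -> v <= 4 * pi ->
    \int[mu]_(x in `[u, v]) (modulus ((b x - c) - (dil r x - c)) ^+ 2) <= e / (6 * B) /\
    \int[mu]_(x in `[u, v]) (modulus ((dil r x - c) - (b x - c)) ^+ 2) <= e / (6 * B).
  move=> hu huv hv.
  have h : \int[mu]_(x in `[u, v]) (modulus (dil r x - b x) ^+ 2) <= e / (6 * B).
    by apply: le_trans le; apply: le_Rintegral_subitv => // t; exact: sqr_ge0.
  split; apply: le_trans h; rewrite le_eqVlt; apply/orP; left; apply/eqP.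
    by apply: eq_Rintegral => x _; rewrite modulusC; congr (modulus _ ^+ 2); ring.
  by apply: eq_Rintegral => x _; congr (modulus _ ^+ 2); ring.
have [h1 _] := small _ _ (lexx 0) (ltW (@two_pi_gt0 R)) p24.
have [_ h2] := small _ _ u0 uv v4.
have t1 := triangle _ _ _ _ (bc _ _ (lexx 0) p24) (dc 0 (2 * pi)).
have t2 := triangle _ _ _ _ (dc (s - pi) (s + pi)) (bc _ _ u0 v4).
have per : \int[mu]_(x in `[s - pi, s + pi]) (modulus (dil r x - c) ^+ 2 * poisson z x) =
    \int[mu]_(x in T) (modulus (dil r x - c) ^+ 2 * poisson z x).
  have -> : s + pi = s - pi + 2 * pi by ring.
  apply: (@Rintegral_periodic R (fun x => modulus (dil r x - c) ^+ 2 * poisson z x)).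
  - move=> x; apply: cvgM; [exact: (continuous_sqr_modulus cd)|exact: cP].
  - by move=> t; rewrite dil_periodic poisson_2pi.
  - by rewrite u0.
rewrite per in t2.
have hB X : X <= e / (6 * B) -> 2 * B * X <= e / 3.
  move=> hX; have B2 : 0 <= 2 * B by rewrite mulr_ge0// ltW.
  apply: (le_trans (ler_wpM2l B2 hX)).
  by rewrite le_eqVlt; apply/orP; left; apply/eqP; field; rewrite gt_eqF.
exact: (total _ _ _ _ _ _ t1 t2 (hB _ h1) (hB _ h2)).
Qed.

(** * A harmonic majorant *)

Let sq t := modulus (b t) ^+ 2.

Let isqT : mu.-integrable T (EFin \o sq).
Proof.
have p24 : 2 * pi <= 4 * pi :> R by have := pi_ge0 R; lra.
by have [] := sq_integrable_subitv (lexx 0) p24 boundary_sq_integrable.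
Qed.

Let cintegrable_sq : cintegrable T (fun t => of_real (sq t)).
Proof. by split => //; exact: (rintegrable_cst 0 (2 * pi) 0). Qed.

(** The real part of the Herglotz transform of a function is its Poisson integral. *)
Let herglotz z : C :=
  of_real 2 * cauchy_transform (fun t => of_real (sq t)) z - of_real (real_circle_mean sq).

Let holomorphic_herglotz : holomorphic_on_disk herglotz.
Proof.
move=> z /unit_diskE z1.
have d1 := is_deriveMC (is_derive_cstC (of_real 2) z) (is_derive_cauchy_transform cintegrable_sq z1).
by have [] := is_deriveDC d1 (is_derive_cstC (- of_real (real_circle_mean sq)) z).
Qed.

Let weighted_integrable z (f : R -> R) : modulus z < 1 -> mu.-integrable T (EFin \o f) ->
  mu.-integrable T (EFin \o (fun t => f t * poisson z t)).
Proof.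
move=> z1 fi; apply: (integrableM_continuous fi).
exact: (continuous_subspaceT (continuous_poisson z1)).
Qed.

Let Re_herglotz z : modulus z < 1 ->
  complex.Re (herglotz z) = real_circle_mean (fun t => sq t * poisson z t).
Proof.
move=> z1; have [iRe _] := cintegrable_mulT cintegrable_sq (continuous_cauchy_kernel z1).
have mT : measurableR T := measurable_itv _.
have -> : real_circle_mean (fun t => sq t * poisson z t) = real_circle_mean (fun t =>
    2 * complex.Re (of_real (sq t) * cauchy_kernel z t) + (-1) * sq t).
  by apply: eq_real_circle_mean => t; rewrite ReM /= /poisson; ring.
rewrite (real_circle_meanD (rintegrableZ 2 mT iRe) (rintegrableZ (-1) mT isqT)).
rewrite (real_circle_meanZ _ iRe) (real_circle_meanZ _ isqT) -Re_circle_mean.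
by rewrite /herglotz ReD ReN ReM (Re_real (real_circle_mean sq)) (Re_real 2) (Im_real 2) mul0r subr0 mulN1r.
Qed.

(** The variance formula for the probability with Poisson density, under which [b] has
    the mean [g z]. *)
Let oscillation_identity z c : modulus z < 1 ->
  real_circle_mean (fun t => modulus (b t - c) ^+ 2 * poisson z t) =
  complex.Re (herglotz z) - modulus (g z) ^+ 2 + modulus (g z - c) ^+ 2.
Proof.
move=> z1; rewrite (Re_herglotz z1).
have mT : measurableR T := measurable_itv _.
have cP : continuous (fun t => of_real (poisson z t) : C).
  by move=> t; apply: (continuous_comp (continuous_poisson z1 (x := t))); exact: continuous_of_real.
have i1 := weighted_integrable z1 isqT.
have ibP := cintegrable_mulT ibT cP.
have [i2 _] := cintegrableZ (conjC c) mT ibP.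
have i3 := rintegrable_continuous 0 (2 * pi) (continuous_poisson z1).
have -> : real_circle_mean (fun t => modulus (b t - c) ^+ 2 * poisson z t) =
    real_circle_mean (fun t => (sq t * poisson z t +
      (-2) * complex.Re (conjC c * (b t * of_real (poisson z t)))) +
      modulus c ^+ 2 * poisson z t).
  apply: eq_real_circle_mean => t; rewrite sqr_modulusB -/(sq t).
  have -> : complex.Re (conjC c * (b t * of_real (poisson z t))) =
      complex.Re (b t * conjC c) * poisson z t by rewrite !ReM !ImM /=; ring.
  by ring.
have i12 := rintegrableD mT i1 (rintegrableZ (-2) mT i2).
rewrite (real_circle_meanD i12 (rintegrableZ (modulus c ^+ 2) mT i3)).
rewrite (real_circle_meanD i1 (rintegrableZ (-2) mT i2)).
rewrite (real_circle_meanZ _ i2) (real_circle_meanZ _ i3) mean_poisson// -Re_circle_mean.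
rewrite (circle_meanZ (conjC c) ibP) poisson_formula_boundary//.
rewrite [modulus (g z - c) ^+ 2]sqr_modulusB [conjC c * g z]mulrC; ring.
Qed.

(** The difference is the variance of [b] under the Poisson density: it is nonnegative,
    and at most the mean of [|b - c| ^ 2] for every [c]. *)
Lemma boundary_harmonic_majorant : exists H : C -> C, holomorphic_on_disk H /\
  forall z, modulus z < 1 -> 0 <= complex.Re (H z) - modulus (g z) ^+ 2 <=
    4 * (144 * 32 * pi * M ^+ 2) / (2 * pi).
Proof.
exists herglotz; split; first exact: holomorphic_herglotz.
move=> z z1; apply/andP; split.
  have := oscillation_identity (g z) z1.
  rewrite subrr modulus0 expr0n /= addr0 => <-.
  by apply: real_circle_mean_ge0 => t; rewrite mulr_ge0 ?sqr_ge0 ?poisson_ge0.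
have [s [c [s13 osc]]] := poisson_oscillation z1.
apply: (@le_trans _ _ (real_circle_mean (fun t => modulus (b t - c) ^+ 2 * poisson z t))).
  by rewrite (oscillation_identity c z1) lerDl sqr_ge0.
have four0 : 0 <= 4 :> R by [].
have h := le_trans (poisson_oscillation_circle c z1 s13) (ler_wpM2l four0 osc).
by rewrite /real_circle_mean [leLHS]mulrC ler_pM2r ?invr_gt0 ?two_pi_gt0.
Qed.

End BoundaryFunction.

Lemma BMOA_harmonic_majorant (R : realType) (g : cplx R -> cplx R) : BMOA g ->
  exists H : cplx R -> cplx R, exists M : R, holomorphic_on_disk H /\
    forall z, modulus z < 1 -> 0 <= complex.Re (H z) - modulus (g z) ^+ 2 <= M.
Proof.
move=> [g2 [b [bv [ib [M bM]]]]].
have M0 : 0 < `|M| + 1 by rewrite ltr_wpDl.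
have bM' s t : s < t -> t <= s + 2 * pi -> mean_oscillation b s t <= `|M| + 1.
  move=> st ts; apply: (le_trans (bM s t st ts)).
  by rewrite (le_trans (ler_norm _))// lerDl.
have [H [hH HM]] := boundary_harmonic_majorant g2 bv ib M0 bM'.
by exists H, (4 * (144 * 32 * pi * (`|M| + 1) ^+ 2) / (2 * pi)).
Qed.

(** * Hankel parts and bounded operators *)

Section AsymptoticHankel.
Context {R : realType}.
Local Notation C := (cplx R).
Implicit Types (z c : C) (f g h q : C -> C) (T : (C -> C) -> (C -> C)).

Lemma holomorphic_mulX m q : holomorphic_on_disk q ->
  holomorphic_on_disk (fun z => z ^+ m * q z).
Proof.
exact: (@holomorphicM R (fun z : C => z ^+ m) q (@holomorphicX R _ m (@holomorphic_id R))).
Qed.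

(** The coefficient is, up to a power of the radius, the mean of [z ^ (m - k) q z] on a
    circle, that is its value at 0. *)
Lemma taylor_coef_mulX m q k : holomorphic_on_disk q -> (k < m)%N ->
  taylor_coef (fun z => z ^+ m * q z) k = 0.
Proof.
move=> hq km.
have r01 : 0 < (2^-1 : R) < 1 by rewrite invr_gt0 ltr0n /= invf_lt1// ltr1n.
have rn n : of_real (2^-1 : R) ^+ n != 0 :> C.
  by rewrite expf_neq0// of_real_eq0 invr_eq0 pnatr_eq0.
have hm n := @holomorphic_mulX n q hq.
apply: (mulIf (rn k)); rewrite mul0r -(fourier_dilation k (hm m) r01).
have [/andP[r0 r1]] := r01.
pose K t : C := (of_real 2^-1 * circle t) ^+ (m - k) * q (of_real 2^-1 * circle t).
have e0 : circle_mean K = 0.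
  transitivity (fourier K 0); first by apply: eq_circle_mean => t; rewrite expr0 mulr1.
  rewrite [LHS](fourier_dilation0 (hm (m - k)%N) r01).
  by rewrite expr0n subn_eq0 leqNgt km mul0r.
have ci := @continuous_cintegrable R 0 (2 * pi) _
  (continuous_dilation (hm (m - k)%N) (_ : 0 <= 2^-1 < 1)).
suff -> : fourier (fun t => (of_real 2^-1 * circle t) ^+ m * q (of_real 2^-1 * circle t)) k =
    of_real 2^-1 ^+ k * circle_mean K by rewrite e0 mulr0.
rewrite -circle_meanZ; last by apply: ci; rewrite (ltW r0).
apply: eq_circle_mean => t.
have cc : circle t ^+ k * circle (- t) ^+ k = 1 :> C.
  by rewrite -exprMn -circleD subrr circle0 expr1n.
have -> : (of_real 2^-1 * circle t) ^+ m =
    (of_real 2^-1 * circle t) ^+ (m - k) * (of_real 2^-1 ^+ k * circle t ^+ k) :> C.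
  by rewrite -exprMn -exprD subnK// ltnW.
move: cc; move: (circle t ^+ k) (circle (- t) ^+ k) => x y xy.
set A := _ ^+ (m - k); set Q := q _; set r := of_real 2^-1 ^+ k.
by transitivity (r * (A * Q) * (x * y)); [ring|rewrite xy mulr1].
Qed.

Lemma iter_shift n f : iter n Defs.shift f = (fun z => z ^+ n * f z).
Proof.
elim: n => [|n ih]; first by apply/funext => z; rewrite expr0 mul1r.
by rewrite iterS ih; apply/funext => z; rewrite /Defs.shift exprS mulrA.
Qed.

Lemma taylor_coef_integral_V_shift f g n k : holomorphic_on_disk f -> holomorphic_on_disk g ->
  (k <= n)%N -> taylor_coef (integral_V g (iter n.+1 Defs.shift f)) k = 0.
Proof.
move=> hf hg kn; rewrite iter_shift /integral_V.
case: k kn => [|k] kn; first by rewrite taylor_coef0 primitive0_0.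
have hq := holomorphicM hf (holomorphic_derive1 hg).
have hm := @holomorphic_mulX n.+1 _ hq.
have -> : (fun u => u ^+ n.+1 * f u * derive1 g u) =
    (fun u => u ^+ n.+1 * (f u * derive1 g u)) by apply/funext => u; rewrite mulrA.
have k0 : k.+1%:R != 0 :> C by rewrite pnatr_eq0.
apply: (mulfI k0); rewrite mulr0 (taylor_coef_primitive0S k hm).
by apply: (taylor_coef_mulX hq); rewrite (leq_trans kn).
Qed.

(** Differentiating loses one power of [z], and integrating regains it. *)
Lemma taylor_coef_integral_S_shift f g n k : holomorphic_on_disk f -> holomorphic_on_disk g ->
  (k <= n)%N -> taylor_coef (integral_S g (iter n.+1 Defs.shift f)) k = 0.
Proof.
move=> hf hg kn; rewrite iter_shift /integral_S.
case: k kn => [|k] kn; first by rewrite taylor_coef0 primitive0_0.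
have hm := @holomorphic_mulX n.+1 _ hf.
have hd := holomorphic_derive1 hm.
pose q z := (n.+1%:R * f z + z * derive1 f z) * g z.
have hq : holomorphic_on_disk q.
  apply: (@holomorphicM R _ g _ hg); apply: holomorphicD.
    exact: (@holomorphicZ R n.+1%:R f hf).
  exact: (holomorphicM (@holomorphic_id R) (holomorphic_derive1 hf)).
have k0 : k.+1%:R != 0 :> C by rewrite pnatr_eq0.
apply: (mulfI k0); rewrite mulr0 (taylor_coef_primitive0S k (holomorphicM hd hg)).
rewrite -[RHS](taylor_coef_mulX hq (kn : (k < n)%N)).
apply: (eq_taylor_coef k (@holomorphic_mulX n q hq)) => z z1.
have := is_deriveMC (is_deriveXC n.+1 (is_derive_idC z)) (holomorphic_is_derive hf z1).
move=> /is_derive_derive1 ->; rewrite /q /= exprS; ring.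
Qed.

Lemma hardy_sum0 : hardy_sum (fun=> 0 : C) = 0%E.
Proof.
have h0 : holomorphic_on_disk (fun=> 0 : C) := @holomorphic_cst R 0.
apply: eseries0 => n _ _.
by have := taylor_coefB n h0 h0; rewrite !subrr => ->; rewrite modulus0 expr0n.
Qed.

Lemma hardy_norm0 : hardy_norm (fun=> 0 : C) = 0%E.
Proof. by rewrite /hardy_norm -/(hardy_sum _) hardy_sum0 sqrte0. Qed.

Lemma hardy2_0 : hardy2 (fun=> 0 : C).
Proof.
by split; [exact: (@holomorphic_cst R 0)|rewrite hardy_norm0 ltry].
Qed.

Lemma operator_norm_eq0 T : (forall f, hardy2 f -> T f = fun=> 0) -> operator_norm T = 0%E.
Proof.
move=> T0; rewrite /operator_norm.
rewrite [X in ereal_sup X](_ : _ = [set 0%E]) ?ereal_sup1//.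
apply/seteqP; split => [_ [f [f2 _] <-]|_ ->] /=; first by rewrite T0// hardy_norm0.
by exists (fun=> 0 : C); [split; [exact: hardy2_0|rewrite hardy_norm0]|
  rewrite (T0 _ hardy2_0) hardy_norm0].
Qed.

Lemma bounded_operatorP T (B : R) : 0 <= B ->
  (forall f, hardy2 f -> holomorphic_on_disk (T f)) ->
  (forall a f h, hardy2 f -> hardy2 h -> forall z, modulus z < 1 ->
     T (fun w => a * f w + h w) z = a * T f z + T h z) ->
  (forall f, hardy2 f -> (hardy_sum (T f) <= B%:E * hardy_sum f)%E) ->
  bounded_operator T.
Proof.
move=> B0 hT lin bnd; split.
- move=> f f2; split; first exact: hT.
  rewrite hardy_norm_lty; apply: (le_lt_trans (bnd f f2)).
  have := f2.2; rewrite hardy_norm_lty; have := hardy_sum_ge0 f.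
  by case: (hardy_sum f) => // x _ _; rewrite -EFinM ltry.
- by move=> a f h f2 h2 z /unit_diskE; exact: lin.
- apply: (@le_lt_trans _ _ (sqrte B%:E)); last by rewrite /= ltry.
  apply: ge_ereal_sup => _ [f [f2 f1] <-].
  rewrite /hardy_norm -/(hardy_sum _) lee_sqrt ?lee_fin//.
  apply: (le_trans (bnd f f2)); rewrite -[leRHS]mule1; apply: lee_pmul => //.
    exact: hardy_sum_ge0.
  rewrite -lee_sqrt; last by rewrite lee_fin.
  by have -> : sqrte 1 = 1%E :> \bar R by rewrite /= sqrtr1.
Qed.

(** The flip in the n-th Hankel part only uses the coefficients up to [n], so it
    vanishes identically and not merely in the limit. *)
Lemma asymptotic_symbol_zeroP T :
  (forall n f k, hardy2 f -> (k <= n)%N -> taylor_coef (T (iter n.+1 Defs.shift f)) k = 0) ->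
  asymptotic_symbol_zero T.
Proof.
move=> T0; split.
  apply: (@bounded_operatorP _ 0) => //.
  - by move=> f _; exact: (@holomorphic_cst R 0).
  - by move=> a f h _ _ z _; rewrite mulr0 addr0.
  - by move=> f _; rewrite mul0e hardy_sum0.
rewrite (_ : (fun n => operator_norm _) = fun=> 0%E); first exact: cvg_cst.
apply/funext => n; apply: operator_norm_eq0 => f f2; apply/funext => z.
rewrite subr0 /hankel_part /flip_op big1// => -[k kn] _ /=.
by rewrite T0// mul0r.
Qed.

Lemma integral_V_bounded g : BMOA g -> bounded_operator (integral_V g).
Proof.
move=> bg; have hg : holomorphic_on_disk g by case: bg => -[].
have [H [M [hH HM]]] := BMOA_harmonic_majorant bg.
apply: (@bounded_operatorP _ (expR M)).
- exact: expR_ge0.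
- by move=> f [hf _]; exact: holomorphic_integral_V.
- move=> a f h [hf _] [hh _] z z1.
  have hdg := holomorphic_derive1 hg.
  apply: (primitive0_linear (holomorphicM hf hdg) (holomorphicM hh hdg) z1) => w _.
  by rewrite mulrDl mulrA.
- by move=> f [hf _]; exact: (volterra_bound hf hg hH HM).
Qed.

Lemma integral_S_bounded g : hardy_infty g -> bounded_operator (integral_S g).
Proof.
move=> [hg [M gM]].
have gM' z : modulus z < 1 -> modulus (g z) <= M by move=> /unit_diskE; exact: gM.
apply: (@bounded_operatorP _ (M ^+ 2)).
- exact: sqr_ge0.
- by move=> f [hf _]; exact: holomorphic_integral_S.
- move=> a f h [hf _] [hh _] z z1.
  have hdf := holomorphic_derive1 hf; have hdh := holomorphic_derive1 hh.
  apply: (primitive0_linear (holomorphicM hdf hg) (holomorphicM hdh hg) z1) => w w1.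
  have dfw := holomorphic_is_derive hf w1; have dhw := holomorphic_is_derive hh w1.
  have /is_derive_derive1 -> := is_deriveDC (is_deriveMC (is_derive_cstC a w) dfw) dhw.
  by rewrite mul0r add0r mulrDl mulrA.
- by move=> f [hf _]; exact: (integral_S_bound hf hg gM').
Qed.

End AsymptoticHankel.

Theorem theorem3p7 (R : realType) :
  (forall g : cplx R -> cplx R, BMOA g ->
     uniformly_asymptotically_hankel (integral_V g) /\
     asymptotic_symbol_zero (integral_V g)) /\
  (forall g : cplx R -> cplx R, hardy_infty g ->
     uniformly_asymptotically_hankel (integral_S g) /\
     asymptotic_symbol_zero (integral_S g)).
Proof.
split=> g gP.
- have hg : holomorphic_on_disk g by case: gP => -[].
  have zero : asymptotic_symbol_zero (integral_V g).
    apply: asymptotic_symbol_zeroP => n f k [hf _].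
    exact: taylor_coef_integral_V_shift.
  split; last exact: zero.
  split; first exact: (integral_V_bounded gP).
  by exists (fun _ _ => 0); exact: zero.
- have hg : holomorphic_on_disk g by case: gP.
  have zero : asymptotic_symbol_zero (integral_S g).
    apply: asymptotic_symbol_zeroP => n f k [hf _].
    exact: taylor_coef_integral_S_shift.
  split; last exact: zero.
  split; first exact: (integral_S_bounded gP).
  by exists (fun _ _ => 0); exact: zero.
Qed.
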